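(* Let $m>0$ and $b=(b_1,\dots,b_d)\in\mathbb{R}^d$ be constants, and let $f$ be piecewise constant on the mesh $\mathcal{T}_H$ of $\Omega\subset\mathbb{R}^d$, with value $f_K$ on $K\in\mathcal{T}_H$. Let $u_{H,B}\in V_{H,B}^{\mathrm{adv}}$ be the Adv-MsFEM-lin-B solution, i.e. the unique element of $V_{H,B}^{\mathrm{adv}}$ such that $a(u_{H,B},v)=\int_\Omega f\,v$ for all $v\in V_{H,B}^{\mathrm{adv}}$. Then $$u_{H,B}=u_H+\sum_{K\in\mathcal{T}_H}\sum_{\alpha=1}^d\partial_\alpha(u_H|_K)\,\chi_K^{\alpha}+\sum_{K\in\mathcal{T}_H}f_K\,B_K,$$ where $u_H\in V_H$ is the unique solution to the $\mathbb{P}_1$ SUPG scheme $$\forall v_H\in V_H,\quad\int_\Omega m\,\nabla u_H\cdot\nabla v_H+v_H\,b\cdot\nabla u_H+\tau^B\,(b\cdot\nabla u_H)(b\cdot\nabla v_H)=\int_\Omega f\,v_H+\tau^B f\,b\cdot\nabla v_H,$$ with the piecewise constant stabilization parameter $\tau^B|_K=\frac{1}{|K|}\int_K B_K$ for all $K\in\mathcal{T}_H$.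
   Context: $\Omega\subset\mathbb{R}^d$ is an open bounded polytope and $\mathcal{T}_H$ is a regular conforming simplicial mesh of $\Omega$. $V_H$ is the space of continuous functions on $\Omega$ that are affine on each $K\in\mathcal{T}_H$ and vanish on $\partial\Omega$; $\phi_1^{\mathbb{P}_1},\dots,\phi_N^{\mathbb{P}_1}$ is its standard nodal basis (associated with the internal vertices). The operator is $\mathcal{L}u=-m\,\Delta u+b\cdot\nabla u$ with bilinear form $a(u,v)=\int_\Omega m\,\nabla u\cdot\nabla v+v\,b\cdot\nabla u$. Basis functions: for $1\le i\le N$, $\phi_i^{\mathrm{adv}}\in H^1_0(\Omega)$ is the unique function such that, for every $K\in\mathcal{T}_H$, $\mathcal{L}\phi_i^{\mathrm{adv}}=0$ weakly in $K$ and $\phi_i^{\mathrm{adv}}=\phi_i^{\mathbb{P}_1}$ on $\partial K$. Bubbles: $B_K\in H^1_0(K)$ is the unique weak solution to $\mathcal{L}B_K=1$ in $K$, $B_K=0$ on $\partial K$, extended by $0$ outside $K$. Numerical correctors: for $1\le\alpha\le d$, $\chi_K^\alpha\in H^1_0(K)$ is the unique weak solution to $\mathcal{L}\chi_K^\alpha=-\mathcal{L}x^\alpha$ in $K$, $\chi_K^\alpha=0$ on $\partial K$, where $x^\alpha$ is the $\alpha$-th coordinate function; it is extended by $0$ outside $K$. The Adv-MsFEM-lin-B space is $V_{H,B}^{\mathrm{adv}}=\operatorname{Span}\{\phi_i^{\mathrm{adv}},\ 1\le i\le N\}\oplus\operatorname{Span}\{B_K,\ K\in\mathcal{T}_H\}$.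 *)

(* Defs.v *)
From HB Require Import structures.
From mathcomp Require Import all_boot all_order all_algebra.
From mathcomp Require Import all_classical all_reals all_analysis.

Set Implicit Arguments.
Unset Strict Implicit.
Unset Printing Implicit Defensive.
Import Order.TTheory GRing.Theory Num.Theory.
Import numFieldNormedType.Exports.

Local Open Scope classical_set_scope.
Local Open Scope ring_scope.

(* Borel sigma-algebra of R^n, generated by the coordinate functions. *)
Section measurable_rV.
Context {R : realType} {n : nat}.

Let coord (i : 'I_n) (x : 'rV[R]_n) : R := x ord0 i.

HB.instance Definition _ := @isMeasurable.Build
  (measure_tuple_display default_measure_display) 'rV[R]_n (g_sigma_preimage coord)
  (@sigma_algebra0 _ _ _) (@sigma_algebraC _ _) (@sigma_algebra_bigcup _ _ _).

Lemma measurable_coord (i : 'I_n) :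
  measurable_fun [set: 'rV[R]_n] (fun x : 'rV[R]_n => x ord0 i).
Proof.
move=> _ Y mY; rewrite setTI; apply: sub_sigma_algebra => /=.
rewrite -bigcup_seq/=; exists i => /=; first by rewrite mem_index_enum.
by exists Y => //; rewrite setTI.
Qed.

Lemma measurable_fun_rV d (T : measurableType d) (f : T -> 'rV[R]_n) :
  (forall i, measurable_fun setT (fun x => f x ord0 i : measurableTypeR R)) ->
  measurable_fun setT f.
Proof.
move=> mf; suff mS : @measurable _ 'rV[R]_n `<=`
    [set Y | measurable (f @^-1` Y)].
  by move=> _ Y mY; rewrite setTI; exact: mS.
apply: smallest_sub.
  split=> /=; first by rewrite preimage_set0; exact: measurable0.
    by move=> A mA; rewrite setTD preimage_setC; exact: measurableC.
  by move=> F mF; rewrite preimage_bigcup; exact: bigcupT_measurable.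
rewrite -bigcup_seq; apply: bigcup_sub => i _.
move=> _ [B mB <-]; rewrite setTI /= -comp_preimage.
by rewrite -[X in measurable X]setTI; exact: (mf i measurableT B mB).
Qed.

End measurable_rV.

Section lebesgue_rV.
Context {R : realType}.

Definition cons_rV n (p : measurableTypeR R * 'rV[R]_n) : 'rV[R]_n.+1 :=
  row_mx (const_mx p.1 : 'rV_1) p.2.

Definition behead_rV n (x : 'rV[R]_n.+1) : 'rV[R]_n :=
  \row_j x ord0 (lift ord0 j).

Lemma cons_rV0 n p : @cons_rV n p ord0 ord0 = p.1.
Proof.
have -> : ord0 = lshift n ord0 :> 'I_(1 + n) by apply: val_inj.
by apply: etrans (row_mxEl _ _ _ _) _; rewrite mxE.
Qed.

Lemma cons_rVS n p j : @cons_rV n p ord0 (lift ord0 j) = p.2 ord0 j.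
Proof.
have -> : lift ord0 j = rshift 1 j :> 'I_(1 + n) by apply: val_inj.
exact: row_mxEr.
Qed.

Lemma measurable_cons_rV n : measurable_fun setT (@cons_rV n).
Proof.
apply: measurable_fun_rV => i; have [j|] := unliftP ord0 i => ->.
- under eq_fun do rewrite cons_rVS.
  by apply: (measurableT_comp (measurable_coord j)); exact: measurable_snd.
- under eq_fun do rewrite cons_rV0.
  exact: measurable_fst.
Qed.

Lemma measurable_behead_rV n : measurable_fun setT (@behead_rV n).
Proof.
apply: measurable_fun_rV => i.
by under eq_fun do rewrite mxE; exact: measurable_coord.
Qed.

HB.instance Definition _ n :=
  isMeasurableFun.Build _ _ _ _ (@cons_rV n) (@measurable_cons_rV n).

Section step.
Context {n : nat} (mu : {sigma_finite_measure set 'rV[R]_n -> \bar R}).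

Definition lebesgue_rV_step : set 'rV[R]_n.+1 -> \bar R :=
  pushforward (lebesgue_measure \x mu)%E (@cons_rV n).

Let step0 : lebesgue_rV_step set0 = 0%E.
Proof. exact: measure0. Qed.

Let step_ge0 A : (0 <= lebesgue_rV_step A)%E.
Proof. exact: measure_ge0. Qed.

Let step_sigma_additive : semi_sigma_additive lebesgue_rV_step.
Proof. exact: measure_semi_sigma_additive. Qed.

HB.instance Definition _ := isMeasure.Build _ _ _ lebesgue_rV_step
  step0 step_ge0 step_sigma_additive.

Let step_sigma_finite : sigma_finite setT lebesgue_rV_step.
Proof.
have /sigma_finiteP[A [AT ndA Aoo]] := sigma_finiteT (@lebesgue_measure R).
have /sigma_finiteP[B [BT ndB Boo]] := sigma_finiteT mu.
pose F k : set 'rV[R]_n.+1 :=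
  (fun x : 'rV[R]_n.+1 => x ord0 ord0) @^-1` A k `&` @behead_rV n @^-1` B k.
have mF k : measurable (F k).
  apply: measurableI; rewrite -[X in measurable X]setTI.
    by apply: (@measurable_coord R n.+1 ord0) => //; have [] := Aoo k.
  by apply: measurable_behead_rV => //; have [] := Boo k.
exists F => [|k].
  rewrite predeqE => x; split=> // _.
  have [i _ Ai] : (\bigcup_i A i) (x ord0 ord0) by rewrite -AT.
  have [j _ Bj] : (\bigcup_i B i) (behead_rV x) by rewrite -BT.
  exists (maxn i j) => //; split.
    by have /subsetPset := ndA _ _ (leq_maxl i j); exact.
  by have /subsetPset := ndB _ _ (leq_maxr i j); exact.
split=> //; have [mA Afin] := Aoo k; have [mB Bfin] := Boo k.
rewrite /lebesgue_rV_step /pushforward.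
have -> : @cons_rV n @^-1` F k = A k `*` B k.
  rewrite predeqE => p; rewrite /F /preimage /= cons_rV0.
  suff -> : behead_rV (cons_rV p) = p.2 by [].
  by apply/rowP => j; rewrite mxE cons_rVS.
by rewrite product_measure1E//= lte_mul_pinfty// ge0_fin_numE.
Qed.

HB.instance Definition _ := @Measure_isSigmaFinite.Build _ _ _ lebesgue_rV_step
  step_sigma_finite.

End step.

(* Lebesgue measure on R^n, as an iterated product measure. *)
Fixpoint lebesgue_rV n : {sigma_finite_measure set 'rV[R]_n -> \bar R} :=
  match n with
  | 0 => \d_(0 : 'rV[R]_0)
  | n'.+1 => lebesgue_rV_step (lebesgue_rV n')
  end.

End lebesgue_rV.

Section sobolev.
Context {R : realType} {d : nat}.
Local Notation E := 'rV[R]_d.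
Local Notation leb := (@lebesgue_rV R d).
Implicit Types (U : set E) (u v phi : E -> R) (g : E -> E).

Definition dotp (x y : E) : R := \sum_(i < d) x ord0 i * y ord0 i.

Definition partial (i : 'I_d) phi : E -> R := 'D_(delta_mx ord0 i) phi.

Definition iter_partial (s : seq 'I_d) phi : E -> R := foldr partial phi s.

Definition smooth phi : Prop := forall (s : seq 'I_d) (x : E),
  {for x, continuous (iter_partial s phi)} /\
  forall i, derivable (iter_partial s phi) x (delta_mx ord0 i).

(* C_c^oo(U) *)
Definition test_fun U phi : Prop :=
  [/\ smooth phi, compact (closure [set x | phi x != 0])
    & closure [set x | phi x != 0] `<=` U].

Definition L2 U u : Prop :=
  measurable_fun U u /\ (\int[leb]_(x in U) (u x ^+ 2)%:E < +oo)%E.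

Definition weak_grad U u g : Prop :=
  (forall i, L2 U (fun x => g x ord0 i)) /\
  forall phi i, test_fun U phi ->
    \int[leb]_(x in U) (u x * partial i phi x) =
    - \int[leb]_(x in U) (g x ord0 i * phi x).

Definition H1 U u : Prop := L2 U u /\ exists g, weak_grad U u g.

(* A representative of the weak gradient on U; it is meaningful, and unique up
   to null sets, for u in H^1(U). *)
Definition grad U u : E -> E := xget (fun=> 0) [set g | weak_grad U u g].

(* H^1_0(U): the closure of C_c^oo(U) in H^1(U). *)
Definition H10 U u : Prop :=
  H1 U u /\
  exists phi : nat -> E -> R, (forall n, test_fun U (phi n)) /\
    (fun n => \int[leb]_(x in U)
       ((phi n x - u x) ^+ 2 +
        \sum_(i < d) (partial i (phi n) x - grad U u x ord0 i) ^+ 2)%:E)%E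
    @ \oo --> 0%E.

Definition bilin (m : R) (b : E) U u v : R :=
  \int[leb]_(x in U)
    (m * dotp (grad U u x) (grad U v x) + v x * dotp b (grad U u x)).

(* L u = F weakly in U, where L u = - m Laplace(u) + b . grad u and F is a
   linear form on H^1_0(U). *)
Definition weak_sol (m : R) (b : E) U u (F : (E -> R) -> R) : Prop :=
  forall v, H10 U v -> bilin m b U u v = F v.

End sobolev.

Section mesh.
Context {R : realType} {d : nat}.
Local Notation E := 'rV[R]_d.
Local Notation leb := (@lebesgue_rV R d).

(* Convex hull of the points p i, for i in S. *)
Definition hull (I : finType) (p : I -> E) (S : pred I) : set E :=
  [set x | exists t : I -> R, [/\ forall i, 0 <= t i,
     \sum_(i | S i) t i = 1 & x = \sum_(i | S i) t i *: p i]].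

(* Not necessarily convex; the third condition excludes slits. *)
Definition open_polytope (Omega : set E) : Prop :=
  [/\ open Omega, bounded_set Omega, (closure Omega)° = Omega
    & exists (n k : nat) (p : 'I_n -> 'I_k -> E),
        closure Omega = \bigcup_j hull (p j) predT].

Definition bdry (Omega : set E) : set E := closure Omega `\` Omega°.

Definition nondegenerate (p : 'I_d.+1 -> E) : Prop :=
  row_free (\matrix_(i < d) (p (lift ord0 i) - p ord0)).

(* A mesh is given by its finite type T of elements and their vertices. *)
Section elements.
Context {T : finType} (vtx : T -> 'I_d.+1 -> E).

Definition cell (K : T) : set E := hull (vtx K) predT.

Definition elt (K : T) : set E := (cell K)°.

Definition conforming_mesh (Omega : set E) : Prop :=
  [/\ forall K, nondegenerate (vtx K),
     closure Omega = \bigcup_K cell K,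
     forall K K', K != K' -> elt K `&` elt K' = set0
   & forall K K', cell K `&` cell K' =
       hull (vtx K) [pred i | vtx K i \in codom (vtx K')]].

(* The function equal to c K on each open element K (the skeleton of the mesh,
   where it is set to 0, is a null set). *)
Definition pwconst (c : T -> R) (x : E) : R := \sum_K c K * \1_(elt K) x.

Definition affine_on (A : set E) (v : E -> R) (p : E) : Prop :=
  exists c : R, forall x, A x -> v x = dotp p x + c.

(* The constant gradient of v|_K, for v affine on K. *)
Definition cell_grad (v : E -> R) (K : T) : E :=
  xget 0 [set p | affine_on (cell K) v p].

Definition P1 (Omega : set E) (v : E -> R) : Prop :=
  [/\ {within closure Omega, continuous v},
     forall K, exists p, affine_on (cell K) v p
   & forall x, bdry Omega x -> v x = 0].

Definition internal_vertices (Omega : set E) : set E :=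
  [set x | Omega x /\ exists K i, x = vtx K i].

Definition nodal_basis (Omega : set E) (N : nat) (phi : 'I_N -> E -> R) : Prop :=
  exists z : 'I_N -> E,
    [/\ injective z, range z = internal_vertices Omega,
       forall i, P1 Omega (phi i) & forall i j, phi i (z j) = (i == j)%:R].

Section msfem.
Variables (m : R) (b : E) (Omega : set E).

(* phiadv i = phi i on the boundary of K: the difference has zero trace there,
   i.e. belongs to H^1_0(K). *)
Definition adv_basis (N : nat) (phi phiadv : 'I_N -> E -> R) : Prop :=
  forall i, H10 Omega (phiadv i) /\
    forall K, weak_sol m b (elt K) (phiadv i) (fun=> 0) /\
      H10 (elt K) (fun x => phiadv i x - phi i x).

(* Bubbles and correctors are extended by 0 outside K. *)
Definition bubbles (B : T -> E -> R) : Prop :=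
  forall K, [/\ H10 (elt K) (B K),
    weak_sol m b (elt K) (B K) (fun v => \int[leb]_(x in elt K) v x)
  & forall x, ~ elt K x -> B K x = 0].

Definition correctors (chi : T -> 'I_d -> E -> R) : Prop :=
  forall K alpha, [/\ H10 (elt K) (chi K alpha),
    weak_sol m b (elt K) (chi K alpha)
      (fun v => - bilin m b (elt K) (fun x => x ord0 alpha) v)
  & forall x, ~ elt K x -> chi K alpha x = 0].

(* Elements of H^1_0(Omega) are functions up to a.e. equality. *)
Definition VHB (N : nat) (phiadv : 'I_N -> E -> R) (B : T -> E -> R)
    (u : E -> R) : Prop :=
  H10 Omega u /\ exists (c : 'I_N -> R) (beta : T -> R),
    u = (fun x => \sum_i c i * phiadv i x + \sum_K beta K * B K x)
      %[ae leb in Omega].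

Definition galerkin (N : nat) (phiadv : 'I_N -> E -> R) (B : T -> E -> R)
    (f u : E -> R) : Prop :=
  VHB phiadv B u /\ forall v, VHB phiadv B v ->
    bilin m b Omega u v = \int[leb]_(x in Omega) (f x * v x).

Definition tauB (B : T -> E -> R) : E -> R :=
  pwconst (fun K => (fine (leb (elt K)))^-1 * \int[leb]_(x in elt K) B K x).

Definition supg (tau f u : E -> R) : Prop :=
  P1 Omega u /\ forall v, P1 Omega v ->
    \int[leb]_(x in Omega)
      (m * dotp (grad Omega u x) (grad Omega v x)
       + v x * dotp b (grad Omega u x)
       + tau x * dotp b (grad Omega u x) * dotp b (grad Omega v x)) =
    \int[leb]_(x in Omega)
      (f x * v x + tau x * f x * dotp b (grad Omega v x)).

End msfem.
End elements.
End mesh.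

(* Main.v *)
Require Import Defs.
From mathcomp Require Import all_boot all_order all_algebra.
From mathcomp Require Import all_classical all_reals all_analysis measurable_realfun.
From mathcomp Require Import ring lra.

Set Implicit Arguments.
Unset Strict Implicit.
Unset Printing Implicit Defensive.
Import Order.TTheory GRing.Theory Num.Theory.
Import numFieldNormedType.Exports.

Local Open Scope classical_set_scope.
Local Open Scope ring_scope.

(** On an element K the correctors and the functions phi_i^adv - phi_i are
    multiples of the bubble. Indeed, for an affine function l with gradient p
    and for v in H^1_0(K), the gradient of v has mean zero, so that
    a_K(l, v) = (b . p) int_K v ([bil_cstl]). Since b is constant, b . grad is
    skew-symmetric on H^1_0(K) and a_K is coercive there; hence the solution w
    of a_K(w, v) = k int_K v is k B_K ([weak_sol_unique]). This gives
    chi_K^alpha = - b_alpha B_K ([corrector_bubble]) and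
    phi_i^adv = phi_i - sum_K (b . grad phi_i|_K) B_K ([adv_eq_P1_bubbles]), so
    that the multiscale space is V_H plus the span of the bubbles.

    Write an element of it as u = v + sum_K gamma_K B_K with v in V_H, and let
    sigma_K = int_K B_K = a(B_K, B_K) >= 0. Integration by parts on K gives
    a(v, B_K) = (b . grad v|_K) sigma_K and
    a(B_K, w) = - (b . grad w|_K) sigma_K for w in V_H, while distinct bubbles
    live on disjoint elements ([bil_enriched]). Testing the Galerkin equation with
    B_K yields sigma_K gamma_K = sigma_K (f_K - b . grad v|_K); testing it with w
    and eliminating gamma_K yields the SUPG equation, because
    tau_K |K| = sigma_K. Both steps are equivalences ([galerkin_supg]). When
    sigma_K = 0 the bubble vanishes by coercivity and gamma_K does not matter.
    The SUPG form is coercive on V_H, which is finite-dimensional, so the SUPG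
    problem is well posed, and the Galerkin problem inherits this.

    The weak gradient of a function is an arbitrarily chosen representative, so
    its uniqueness almost everywhere is needed throughout: it follows from
    [fundamental_lemma]. Functions of H^1_0 are handled together with a gradient,
    as L^2 limits of test functions ([test_limit]). *)

(** * Borel sets and Lebesgue measure on R^n *)

Section borel.
Context {R : realType} {n : nat}.
Local Notation E := 'rV[R]_n.
Implicit Types (x y c : E) (r : R).

Lemma ball_rVP c r x : 0 < r ->
  ball c r x <-> forall i, `|c ord0 i - x ord0 i| < r.
Proof.
by move=> r0; split => [[_ h] i|h]; [exact: h|split => // i j; rewrite ord1; exact: h].
Qed.

Lemma measurable_ball_rV c r : 0 < r -> measurable (ball c r : set E).
Proof.
move=> r0.
have -> : ball c r = \bigcap_(i in [set: 'I_n])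
    ((fun x : E => x ord0 i) @^-1` (ball (c ord0 i) r)).
  apply/seteqP; split => x.
    by move/ball_rVP => h i _ /=; exact: h.
  by move=> h; apply/ball_rVP => // i; exact: (h i).
apply: fin_bigcap_measurable => [|i _]; first exact: finite_finset.
rewrite -[X in measurable X]setTI; apply: measurable_coord => //.
by apply: open_measurable; exact: ball_open.
Qed.

(** R^n has a countable base of balls with rational centres and radii; a ball
    of the sup norm is a box, so it belongs to the sigma-algebra generated by the
    coordinates. *)
Lemma open_measurable_rV (A : set E) : open A -> measurable A.
Proof.
move=> oA.
pose q (k : 'rV[rat]_n * rat) : set E :=
  ball (map_mx (ratr : rat -> R) k.1) (ratr k.2 : R).
have -> : A = \bigcup_(k in [set k | 0 < k.2 /\ q k `<=` A]) q k.
  apply/seteqP; split => [x Ax|x [k [_ qA] qx]]; last exact: qA.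
  have /nbhs_ballP[e /= e0 xeA] : nbhs x A by exact: open_nbhs_nbhs.
  have [r] := rat_in_itvoo (divr_gt0 e0 (ltr0n R 2)).
  rewrite in_itv /= => /andP[r0 re].
  have [y yP] : exists y : 'rV[rat]_n, forall i,
      `|x ord0 i - ratr (y ord0 i)| < ratr r.
    have h i : exists z : rat, `|x ord0 i - ratr z| < ratr r.
      have [z] := @rat_in_itvoo R (x ord0 i - ratr r) (x ord0 i + ratr r) ltac:(lra).
      rewrite in_itv /= => /andP[z1 z2]; exists z; rewrite ltr_norml; lra.
    exists (\row_i sval (cid (h i))) => i; rewrite mxE.
    exact: (svalP (cid (h i))).
  exists (y, r) => /=; last by apply/ball_rVP => // i; rewrite mxE distrC.
  split; first by rewrite -(ltr0q R).
  move=> z /= /ball_rVP zh; apply: xeA; apply/ball_rVP => // i.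
  have := zh r0 i; have := yP i; rewrite mxE.
  rewrite !ltr_norml; lra.
rewrite bigcup_mkcond; apply: countable_bigcupT_measurable => [|k].
  exact: countableP.
case: ifPn => // /[!inE] -[k0 _].
by apply: measurable_ball_rV; rewrite ltr0q.
Qed.

Lemma continuous_measurable_rV (D : set E) (f : E -> R) : open D ->
  {in D, continuous f} -> measurable_fun D f.
Proof.
move=> oD cf; apply: (measurability _ (RGenOpens.measurableE R)) => _ [_ [a [b ->] <-]].
apply: open_measurable_rV; rewrite openE => x [Dx fx]; apply: filterI.
  exact: open_nbhs_nbhs.
apply: (cf x (mem_set Dx)); apply: open_nbhs_nbhs; split => //.
Qed.

End borel.

Section lebesgue.
Context {R : realType}.
Local Notation leb n := (@lebesgue_rV R n).

Lemma lebesgue_rVS n (A : set 'rV[R]_n.+1) :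
  leb n.+1 A = (lebesgue_measure \x leb n)%E (@cons_rV R n @^-1` A).
Proof. by []. Qed.

Lemma lebesgue_rV_ball n (c : 'rV[R]_n) (r : R) : 0 < r ->
  leb n (ball c r) = ((2 * r) ^+ n)%:E.
Proof.
move=> r0; elim: n c => [|n IH] c.
  rewrite /= diracE mem_set ?expr0//; apply/ball_rVP => // -[] //.
rewrite lebesgue_rVS.
have -> : @cons_rV R n @^-1` (ball c r) = ball (c ord0 ord0) r `*` ball (behead_rV c) r.
  apply/seteqP; split => -[t y] /=.
    move/(ball_rVP _ _ r0) => h; split.
      by have := h ord0; rewrite cons_rV0.
    apply/ball_rVP => // i; have := h (lift ord0 i); rewrite cons_rVS mxE; exact.
  move=> [h1 /(ball_rVP _ _ r0) h2]; apply/ball_rVP => // i.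
  by have [j|] := unliftP ord0 i => ->; rewrite (cons_rVS, cons_rV0)// -?mxE//; have := h2 j; rewrite mxE.
rewrite product_measure1E.
- rewrite IH exprS EFinM mulr_natl; congr (_ * _)%E.
  exact: lebesgue_measure_ball (ltW r0).
- by apply: open_measurable; exact: ball_open.
- exact: measurable_ball_rV.
Qed.

Lemma lebesgue_rV_bounded n (A : set 'rV[R]_n) : bounded_set A ->
  measurable A -> (leb n A < +oo)%E.
Proof.
move=> bA mA; have [r r0 Ar] := ex_strict_bound_gt0 bA.
apply: (@le_lt_trans _ _ (leb n (ball 0 r))).
  apply: le_measure; rewrite ?inE//; first exact: measurable_ball_rV.
  by move=> x /Ar /= xr; rewrite mx_norm_ball /ball_ /= sub0r normrN.
by rewrite lebesgue_rV_ball// ltry.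
Qed.

Lemma lebesgue_rV_open_gt0 n (A : set 'rV[R]_n) x : open A -> A x ->
  (0 < leb n A)%E.
Proof.
move=> oA Ax; have /nbhs_ballP[e /= e0 xeA] : nbhs x A by exact: open_nbhs_nbhs.
apply: (@lt_le_trans _ _ (leb n (ball x e))).
  by rewrite lebesgue_rV_ball// lte_fin exprn_gt0 ?mulr_gt0.
apply: le_measure => //; rewrite inE; first exact: measurable_ball_rV.
exact: open_measurable_rV.
Qed.

Lemma dotp_cons n (p : 'rV[R]_n.+1) (z : measurableTypeR R * 'rV[R]_n) :
  dotp p (cons_rV z) = p ord0 ord0 * z.1 + dotp (behead_rV p) z.2.
Proof.
rewrite /dotp big_ord_recl cons_rV0; congr (_ + _).
by apply: eq_bigr => i _; rewrite cons_rVS mxE.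
Qed.

Lemma measurable_dotp n (p : 'rV[R]_n) : measurable_fun setT (dotp p).
Proof.
apply: measurable_sum => i; apply: measurable_funM => //.
exact: measurable_coord.
Qed.

Lemma measurable_hyperplane n (p : 'rV[R]_n) (c : R) :
  measurable [set x | dotp p x = c].
Proof.
have := measurable_dotp p measurableT (measurable_set1 c).
by rewrite setTI.
Qed.

(** If the first entry of p is nonzero, the slices along the first coordinate
    are points, which calls for the product measure in the other order;
    otherwise the slices of the tail are hyperplanes of smaller dimension. *)
Lemma lebesgue_rV_hyperplane n (p : 'rV[R]_n) (c : R) : p != 0 ->
  leb n [set x | dotp p x = c] = 0%E.
Proof.
elim: n p c => [|n IH] p c p0.
  by rewrite thinmx0 eqxx in p0.
rewrite lebesgue_rVS.
set X := _ @^-1` _.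
have mX : measurable X.
  have := measurable_cons_rV measurableT (measurable_hyperplane p c).
  by rewrite setTI.
have XE z : X z = (p ord0 ord0 * z.1 + dotp (behead_rV p) z.2 = c).
  by rewrite /X /preimage /= dotp_cons.
have [p00|p00] := eqVneq (p ord0 ord0) 0.
  rewrite /product_measure1 integral0_eq// => t _ /=.
  have -> : xsection X t = [set y | dotp (behead_rV p) y = c].
    by apply/seteqP; split => y; rewrite /xsection /= inE XE p00 mul0r add0r.
  apply: IH; apply: contra_neq p0 => p0; apply/rowP => i.
  have [j|] := unliftP ord0 i => ->; last by rewrite p00 mxE.
  by move/rowP : p0 => /(_ j); rewrite !mxE.
rewrite (product_measure_unique (m' := (lebesgue_measure \x^ leb n)%E))//; last first.
  by move=> A B mA mB; exact: product_measure2E.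
apply: integral0_eq => y _ /=.
have -> : ysection X y = [set (c - dotp (behead_rV p) y) / p ord0 ord0].
  apply/seteqP; split => t; rewrite /ysection /= inE XE /=.
    by move=> <-; rewrite addrK mulrC mulKf.
  by move=> ->; rewrite mulrC divfK// subrK.
exact: lebesgue_measure_set1.
Qed.

End lebesgue.

(** * Integrals of partial derivatives *)

Lemma bounded_support_integrable d (T : measurableType d) (R : realType)
    (mu : {measure set T -> \bar R}) (A : set T) (C : R) (f : T -> R) :
  measurable A -> (mu A < +oo)%E -> measurable_fun setT f ->
  (forall x, `|f x| <= C) -> (forall x, ~ A x -> f x = 0) ->
  mu.-integrable setT (EFin \o f).
Proof.
move=> mA muA mf fC fA.
have : mu.-integrable A (EFin \o f).
  apply: measurable_bounded_integrable => //; first exact: measurable_funS mf.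
  by exists C; split; rewrite ?num_real// => M CM x _ /=; exact: le_trans (fC x) (ltW CM).
move/(integrable_mkcond _ mA); apply: eq_integrable => // x _.
by rewrite patchE; case: ifPn => //= /negP; rewrite inE => /fA ->.
Qed.

Section line.
Context {R : realType}.

(** A directional derivative depends only on the restriction of the function
    to a line, so it can be carried from one space to another. *)
Lemma is_derive_line (V W : normedModType R) (f : V -> R) (g : W -> R)
    (x v : V) (y w : W) (l : R) :
  (forall h : R, f (h *: v + x) = g (h *: w + y)) ->
  is_derive x v f l -> is_derive y w g l.
Proof.
move=> fg [df fl].
have E : (fun h : R => h^-1 *: ((f \o shift x) (h *: v) - f x)) =
         (fun h : R => h^-1 *: ((g \o shift y) (h *: w) - g y)).
  apply/funext => h /=; rewrite fg.
  by have := fg 0; rewrite !scale0r !add0r => ->.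
by split; [rewrite /derivable -E|rewrite /derive -E].
Qed.

Lemma integral_derive0 (f g : R -> R) (M : R) : 0 < M -> continuous g ->
  (forall t : R, is_derive t 1 f (g t)) ->
  (forall t, M <= `|t| -> f t = 0) -> (forall t, M <= `|t| -> g t = 0) ->
  (\int[@lebesgue_measure R]_t (g t)%:E = 0)%E.
Proof.
move=> M0 cg dfg f0 g0.
have fM : f M = 0 by apply: f0; rewrite gtr0_norm.
have fNM : f (- M) = 0 by apply: f0; rewrite normrN gtr0_norm.
have cf : continuous f.
  move=> t; apply: differentiable_continuous; apply/derivable1_diffP.
  by have [] := dfg t.
have -> : (\int[@lebesgue_measure R]_t (g t)%:E)%E =
    (\int[@lebesgue_measure R]_(t in `[(- M)%R, M]) (g t)%:E)%E.
  rewrite [RHS]integral_mkcond; apply: eq_integral => t _.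
  rewrite patchE; case: ifPn => // /negP; rewrite inE /= in_itv /= -ler_norml.
  by move/negP; rewrite -ltNge => /ltW /g0 ->.
rewrite (@continuous_FTC2 _ _ f) ?fM ?fNM ?subee//; first lra.
- by apply: continuous_subspaceT.
- split; first by move=> t _; have [] := dfg t.
  + by apply: cvg_at_right_filter; exact: cf.
  + by apply: cvg_at_left_filter; exact: cf.
- by move=> t _; rewrite derive1E; have [_ ->] := dfg t.
Qed.

End line.

Section divergence.
Context {R : realType}.
Local Notation leb n := (@lebesgue_rV R n).

(** [cons_rV] in curried form, with a head typed in R itself and not in the
    copy of R that carries the Borel sets: this keeps rewriting syntactic. *)
Definition consr n (t : R) (y : 'rV[R]_n) : 'rV[R]_n.+1 :=
  cons_rV (t : measurableTypeR R, y).

Lemma consr0 n t (y : 'rV[R]_n) : consr t y ord0 ord0 = t.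
Proof. exact: cons_rV0. Qed.

Lemma consrS n t (y : 'rV[R]_n) j : consr t y ord0 (lift ord0 j) = y ord0 j.
Proof. exact: cons_rVS. Qed.

Lemma continuous_consrr n t : continuous (fun y : 'rV[R]_n => consr t y).
Proof.
move=> y A /nbhs_ballP[e /= e0 eA]; apply/nbhs_ballP; exists e => //= z /(ball_rVP _ _ e0) yz.
apply: eA; apply/(ball_rVP _ _ e0) => i.
have [j|] := unliftP ord0 i => ->; first by rewrite !consrS; exact: yz.
by rewrite !consr0 subrr normr0.
Qed.

Lemma continuous_consrl n (y : 'rV[R]_n) : continuous (fun t : R => consr t y).
Proof.
move=> t A /nbhs_ballP[e /= e0 eA]; apply/nbhs_ballP; exists e => //= s ts.
apply: eA; apply/(ball_rVP _ _ e0) => i.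
have [j|] := unliftP ord0 i => ->; last by rewrite !consr0; exact: ts.
by rewrite !consrS subrr normr0.
Qed.

Lemma eq_rV n (x y : 'rV[R]_n) : (forall k, x ord0 k = y ord0 k) -> x = y.
Proof. by move=> xy; apply/rowP. Qed.

Lemma consrD n (h t : R) (i : 'I_n) y :
  consr t (h *: delta_mx ord0 i + y) =
  h *: delta_mx ord0 (lift ord0 i) + consr t y.
Proof.
apply: eq_rV => k; have [j|] := unliftP ord0 k => ->.
  rewrite consrS mxE -(consrS t y j); move: (consr t y) => z.
  by rewrite !mxE (inj_eq lift_inj).
rewrite consr0 -[LHS](consr0 t y); move: (consr t y) => z.
by rewrite !mxE /= mulr0 add0r.
Qed.

Lemma consrDl n (h t : R) (y : 'rV[R]_n) :
  consr (h * 1 + t) y =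
  h *: delta_mx ord0 ord0 + consr t y.
Proof.
apply: eq_rV => k; have [j|] := unliftP ord0 k => ->.
  rewrite consrS -[LHS](consrS t y); move: (consr t y) => z.
  by rewrite !mxE /= mulr0 add0r.
rewrite consr0 -[X in _ + X = _](consr0 t y); move: (consr t y) => z.
by rewrite !mxE !eqxx.
Qed.

Lemma integral_cons n (g : 'rV[R]_n.+1 -> R) : measurable_fun setT g ->
  (lebesgue_measure \x leb n)%E.-integrable setT (EFin \o g \o @cons_rV R n) ->
  (\int[leb n.+1]_x (g x)%:E =
   \int[lebesgue_measure \x leb n]_z (g (cons_rV z))%:E)%E.
Proof.
move=> mg ig.
have mg' : measurable_fun setT (EFin \o g) by exact/measurable_EFinP.
exact: (integral_pushforward (@measurable_cons_rV R n) mg' ig measurableT).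
Qed.

(** By Fubini. When i is the head coordinate, the integral along it vanishes
    by the fundamental theorem of calculus; otherwise the integral over the tail
    vanishes by induction. *)
Lemma integral_partial0 n (i : 'I_n) (f g : 'rV[R]_n -> R) (M C : R) : 0 < M ->
  continuous g -> (forall x, `|g x| <= C) ->
  (forall x, is_derive x (delta_mx ord0 i) f (g x)) ->
  (forall (x : 'rV_n) j, M <= `|x ord0 j| -> f x = 0) ->
  (forall (x : 'rV_n) j, M <= `|x ord0 j| -> g x = 0) ->
  (\int[leb n]_x (g x)%:E = 0)%E.
Proof.
move=> M0; elim: n => [|n IH] in i f g *; first by case: i.
move=> cg gC dfg f0 g0.
have mg : measurable_fun setT g by apply: continuous_measurable_rV; [exact: openT|move=> x _; exact: cg].
have ig : (lebesgue_measure \x leb n)%E.-integrable setT (EFin \o g \o @cons_rV R n).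
  apply: (@bounded_support_integrable _ _ _ _ (@cons_rV R n @^-1` (ball (0 : 'rV[R]_n.+1) M)) C).
  - rewrite -[X in measurable X]setTI; apply: measurable_cons_rV => //.
    exact: measurable_ball_rV.
  - change (leb n.+1 (ball (0%R : 'rV[R]_n.+1) M) < +oo)%E.
    by rewrite lebesgue_rV_ball// ltry.
  - exact: measurableT_comp mg (@measurable_cons_rV R n).
  - by move=> z; exact: gC.
  - move=> z /= /ball_rVP => /(_ M0) /existsNP[j]; rewrite mxE sub0r normrN => /negP.
    by rewrite -leNgt => /g0.
rewrite integral_cons//.
have [j|] := unliftP ord0 i => iE.
  rewrite -integral12_prod_meas1//; apply: integral0_eq => t _.
  apply: (IH j (fun y => f (consr t y))) => //.
  - by move=> y; apply: continuous_comp; [exact: continuous_consrr|exact: cg].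
  - move=> y; have := dfg (consr t y).
    by apply: is_derive_line => h; rewrite consrD iE.
  - by move=> y k yk; apply: (f0 _ (lift ord0 k)); rewrite consrS.
  - by move=> y k yk; apply: (g0 _ (lift ord0 k)); rewrite consrS.
rewrite -integral21_prod_meas1//; apply: integral0_eq => y _.
apply: (@integral_derive0 _ (fun t => f (consr t y)) _ M) => //.
- by move=> t; apply: continuous_comp; [exact: continuous_consrl|exact: cg].
- move=> t; have := dfg (consr t y).
  by apply: is_derive_line => h; rewrite consrDl iE.
- by move=> t tM; apply: (f0 _ ord0); rewrite consr0.
- by move=> t tM; apply: (g0 _ ord0); rewrite consr0.
Qed.

End divergence.

(** * Smooth functions *)

Section smooth.
Context {R : realType} {d : nat}.
Local Notation E := 'rV[R]_d.
Implicit Types (phi psi : E -> R) (i : 'I_d) (x : E).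

Lemma iter_partial_rcons (s : seq 'I_d) i phi :
  iter_partial (rcons s i) phi = iter_partial s (partial i phi).
Proof. by rewrite /iter_partial foldr_rcons. Qed.

Lemma smooth_continuous phi : smooth phi -> continuous phi.
Proof. by move=> sphi x; have [] := sphi [::] x. Qed.

Lemma smooth_derivable phi i x : smooth phi -> derivable phi x (delta_mx ord0 i).
Proof. by move=> sphi; have [_] := sphi [::] x; exact. Qed.

Lemma smooth_is_derive phi i x : smooth phi ->
  is_derive x (delta_mx ord0 i) phi (partial i phi x).
Proof. by move=> sphi; apply: DeriveDef => //; exact: smooth_derivable. Qed.

Lemma smooth_partial phi i : smooth phi -> smooth (partial i phi).
Proof. by move=> sphi s x; rewrite -iter_partial_rcons; exact: sphi. Qed.

(** [smooth] is the largest class of continuous functions with partial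
    derivatives that is stable under partial differentiation. *)
Lemma smooth_coind (P : (E -> R) -> Prop) :
  (forall phi, P phi -> continuous phi /\ forall i,
     (forall x, derivable phi x (delta_mx ord0 i)) /\ P (partial i phi)) ->
  forall phi, P phi -> smooth phi.
Proof.
move=> stepP phi Pphi s; elim/last_ind: s phi Pphi => [|s i IH] phi Pphi x.
  have [cphi dphi] := stepP _ Pphi; split; first exact: cphi.
  by move=> i; have [dp _] := dphi i; exact: dp.
rewrite iter_partial_rcons; apply: IH.
by have [_ /(_ i)[]] := stepP _ Pphi.
Qed.

(** The algebra generated by the smooth functions. The Leibniz rule keeps it
    stable under partial differentiation, so that [smooth_coind] applies to
    it. *)
Inductive smooth_alg : (E -> R) -> Prop :=
| smooth_alg_base phi : smooth phi -> smooth_alg phi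
| smooth_algD phi psi : smooth_alg phi -> smooth_alg psi ->
    smooth_alg (fun x => phi x + psi x)
| smooth_algM phi psi : smooth_alg phi -> smooth_alg psi ->
    smooth_alg (fun x => phi x * psi x).

Lemma partialD phi psi i x : derivable phi x (delta_mx ord0 i) ->
  derivable psi x (delta_mx ord0 i) ->
  partial i (fun x => phi x + psi x) x = partial i phi x + partial i psi x.
Proof. by move=> dphi dpsi; exact: deriveD. Qed.

Lemma partialM phi psi i x : derivable phi x (delta_mx ord0 i) ->
  derivable psi x (delta_mx ord0 i) ->
  partial i (fun x => phi x * psi x) x =
  phi x * partial i psi x + partial i phi x * psi x.
Proof.
by move=> dphi dpsi; rewrite [RHS]addrC [X in X + _]mulrC [RHS]addrC; exact: deriveM.
Qed.

Lemma smooth_alg_smooth phi : smooth_alg phi -> smooth phi.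
Proof.
apply: smooth_coind => {}phi; elim => {phi} [phi sphi|phi psi ap [cp dp] aq [cq dq]|
    phi psi ap [cp dp] aq [cq dq]].
- split; first exact: smooth_continuous.
  move=> i; split=> [x|]; first exact: smooth_derivable.
  exact/smooth_alg_base/smooth_partial.
- split=> [x|i]; first exact: (cvgD (cp x) (cq x)).
  have [dpi api] := dp i; have [dqi aqi] := dq i.
  split=> [x|]; first exact: derivableD.
  rewrite (_ : partial _ _ = fun x => partial i phi x + partial i psi x).
    exact: smooth_algD.
  by apply/funext => x; exact: partialD.
- split=> [x|i]; first exact: (cvgM (cp x) (cq x)).
  have [dpi api] := dp i; have [dqi aqi] := dq i.
  split=> [x|]; first exact: derivableM.
  rewrite (_ : partial _ _ =
    fun x => phi x * partial i psi x + partial i phi x * psi x).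
    by apply: smooth_algD; exact: smooth_algM.
  by apply/funext => x; exact: partialM.
Qed.

Lemma smoothD phi psi : smooth phi -> smooth psi ->
  smooth (fun x => phi x + psi x).
Proof.
by move=> sp sq; apply/smooth_alg_smooth/smooth_algD; exact: smooth_alg_base.
Qed.

Lemma smoothM phi psi : smooth phi -> smooth psi ->
  smooth (fun x => phi x * psi x).
Proof.
by move=> sp sq; apply/smooth_alg_smooth/smooth_algM; exact: smooth_alg_base.
Qed.

Lemma is_derive_affine (p : E) (c : R) i x :
  is_derive x (delta_mx ord0 i) (fun x => dotp p x + c) (p ord0 i).
Proof.
apply: (@is_derive_line _ _ _ (fun t : R => p ord0 i * t + (dotp p x + c)) _ (0 : R) (1 : R)).
  move=> h; rewrite addr0 addrA; congr (_ + _).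
  rewrite /dotp (bigD1 i)//= [in RHS](bigD1 i)//= !mxE !eqxx /= addrA; congr (_ + _).
    by rewrite /GRing.scale /= mulr1; ring.
  by apply: eq_bigr => j ji; rewrite !mxE (negPf ji) andbF mulr0 add0r.
have h : is_derive (0 : R) (1 : R) (cst (p ord0 i) * id + cst (dotp p x + c) : R -> R)
    (p ord0 i *: (1 : R) + (0 : R) *: (0 : R) + 0).
  by apply: is_deriveD; apply: is_deriveM.
by apply: is_derive_eq h _; rewrite scaler0 !addr0 [_ *: _]mulr1.
Qed.

Lemma continuous_coord i : continuous (fun x : E => x ord0 i).
Proof.
by move=> x; exact: coord_continuous.
Qed.

Lemma continuous_affine (p : E) (c : R) : continuous (fun x => dotp p x + c).
Proof.
have h : continuous (dotp p).
  apply: continuous_big => [|i _ x]; first exact: add_continuous.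
  exact: (cvgM (cvg_cst (p ord0 i)) (continuous_coord (x := x))).
by move=> x; exact: (cvgD (h x) (cvg_cst c)).
Qed.

Lemma dotp0 (x : E) : dotp 0 x = 0.
Proof. by rewrite /dotp big1// => i _; rewrite mxE mul0r. Qed.

Lemma smooth_affine (p : E) (c : R) : smooth (fun x => dotp p x + c).
Proof.
apply: (@smooth_coind (fun phi => exists p c, phi = fun x => dotp p x + c)); last by exists p, c.
move=> _ [{}p [{}c ->]]; split; first exact: continuous_affine.
move=> i; split=> [x|]; first by have [] := is_derive_affine p c i x.
exists 0, (p ord0 i); apply/funext => x; rewrite dotp0 add0r.
by have [_] := is_derive_affine p c i x.
Qed.

Lemma smooth_cst (c : R) : smooth (fun _ : E => c).
Proof.
have := smooth_affine 0 c; congr smooth; apply/funext => x.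
by rewrite dotp0 add0r.
Qed.

Lemma dotp_delta i x : dotp (delta_mx ord0 i) x = x ord0 i.
Proof.
rewrite /dotp (bigD1 i)//= mxE !eqxx mul1r big1 ?addr0// => j ji.
by rewrite mxE (negPf ji) andbF mul0r.
Qed.

Lemma smooth_coord i : smooth (fun x : E => x ord0 i).
Proof.
have := smooth_affine (delta_mx ord0 i) 0; congr smooth; apply/funext => x.
by rewrite dotp_delta addr0.
Qed.

End smooth.

(** * The functions p(1/t) exp(-1/t) *)

Section bump.
Context {R : realType}.
Implicit Types (p q : {poly R}) (t : R).

(** The polynomial factor makes this family stable under differentiation. *)
Definition flat p t : R := if 0 < t then p.[t^-1] * expR (- t^-1) else 0.

(** From s^(i+1) / (i+1)! <= exp s, at s = 1/t. Applied to p X, the bound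
    controls the difference quotient of [flat p] at 0. *)
Lemma flat_bound q : exists C, 0 <= C /\ forall t, `|flat q t| <= C * `|t|.
Proof.
exists (\sum_(i < size q) `|q`_i| * i.+1`!%:R); split.
  by apply: sumr_ge0 => i _; rewrite mulr_ge0.
move=> t; rewrite /flat; case: ifPn => [t0|_]; last first.
  by rewrite normr0 mulr_ge0// sumr_ge0// => i _; rewrite mulr_ge0.
rewrite horner_coef (gtr0_norm t0) !mulr_suml (le_trans (ler_norm_sum _ _ _))//.
apply: ler_sum => i _; rewrite !normrM (gtr0_norm (expR_gt0 _)) -!mulrA.
apply: ler_wpM2l => //; rewrite ger0_norm ?exprn_ge0 ?invr_ge0 ?(ltW t0)//.
rewrite expRN ler_pdivrMr ?expR_gt0//.
have s0 : 0 <= t^-1 by rewrite invr_ge0 ltW.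
have := expR_ge1Dxn i s0 => h.
have f0 : (0 : R) < (i.+1)`!%:R by rewrite ltr0n fact_gt0.
have : t^-1 ^+ i.+1 / i.+1`!%:R <= expR t^-1 by apply: le_trans h; rewrite lerDr.
rewrite ler_pdivrMr// exprSr ler_pdivrMr// => h2.
by rewrite (le_trans h2)// [X in _ <= X]mulrC mulrA.
Qed.

Lemma is_derive_flat p t :
  is_derive t 1 (flat p) (flat ('X^2 * (p - p^`())) t).
Proof.
have [t0|t0|->] := ltgtP t 0.
- rewrite [X in is_derive _ _ _ X]/flat ltNge (ltW t0) /=.
  apply: (@near_eq_is_derive _ _ _ (cst 0)).
  by near=> s; rewrite /flat /= ifF//; apply/negbTE; rewrite -leNgt ltW//; near: s; exact: lt_nbhsl.
- rewrite [X in is_derive _ _ _ X]/flat t0.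
  apply: (@near_eq_is_derive R R R (fun s : R => p.[s^-1] * expR (- s^-1))).
    by near=> s; rewrite /flat /= ifT//; near: s; exact: lt_nbhsr.
  have tn0 : t != 0 by rewrite gt_eqF.
  have dV : is_derive t 1 (fun s : R => s^-1) (- t ^- 2).
    by have := is_deriveV tn0 (is_derive_id t 1); rewrite [_ *: _]mulr1.
  have dp := is_derive1_comp (is_derive_poly p t^-1) dV.
  have dN : is_derive t 1 (fun s : R => - s^-1) (- - t ^- 2) by exact: is_deriveN.
  have de := @is_derive1_comp R expR (fun s => - s^-1) t _ _ (is_derive_expR _) dN.
  have := is_deriveM dp de.
  set l := (X in is_derive _ _ _ X -> _); suff -> : l = ('X^2 * (p - p^`())).[t^-1] * expR (- t^-1) by [].
  by rewrite /l !hornerE /GRing.scale /= exprVn; ring.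
- rewrite [X in is_derive _ _ _ X]/flat ltxx.
  have [C [C0 hC]] := flat_bound (p * 'X).
  have h : (fun h : R => h^-1 *: ((flat p \o shift 0) (h *: (1 : R)) - flat p 0)) @ 0^' --> (0 : R).
    apply/cvgrPdist_le => e e0; near=> s.
    have s0 : s != 0 by near: s; exact: nbhs_dnbhs_neq.
    rewrite /= sub0r normrN addr0 [_ *: 1]mulr1 {2}/flat ltxx subr0.
    have -> : s^-1 *: flat p s = flat (p * 'X) s.
      rewrite /flat; case: ifPn => _; last by rewrite scaler0.
      by rewrite hornerMX /GRing.scale /=; ring.
    rewrite (le_trans (hC s))//.
    have : `|s| <= e / (C + 1).
      by near: s; apply: dnbhs0_le; rewrite divr_gt0// ltr_wpDl.
    rewrite ler_pdivlMr ?ltr_wpDl// mulrDr mulr1 mulrC; apply: le_trans.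
    by rewrite lerDl.
  by split; [apply/cvg_ex; exists 0|apply: cvg_lim h].
Unshelve. all: by end_near. Qed.

End bump.

(** * Test functions *)

Section test_functions.
Context {R : realType} {d : nat}.
Local Notation E := 'rV[R]_d.
Local Notation leb := (@lebesgue_rV R d).
Implicit Types (phi psi : E -> R) (i : 'I_d) (x : E) (U K : set E).

Lemma smooth_flat (p : {poly R}) (q : E) (c : R) :
  smooth (fun x => flat p (dotp q x + c)).
Proof.
apply: (@smooth_coind _ _ (fun phi => exists p q c,
  phi = fun x => flat p (dotp q x + c))); last by exists p, q, c.
move=> _ [{}p [{}q [{}c ->]]].
have cflat : continuous (flat p).
  move=> t; apply: differentiable_continuous; apply/derivable1_diffP.
  by have [] := is_derive_flat p t.
split=> [x|i].
  exact: (@continuous_comp _ _ _ (fun x => dotp q x + c) (flat p) x (@continuous_affine _ _ q c x) (cflat _)).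
have D x : is_derive x (delta_mx ord0 i) (fun x => flat p (dotp q x + c))
    (flat (q ord0 i *: ('X^2 * (p - p^`()))) (dotp q x + c)).
  have D1 := is_derive_flat p (dotp q x + c).
  have df : differentiable (flat p) (dotp q x + c).
    by apply/derivable1_diffP; have [] := D1.
  have D2 : is_derive (dotp q x + c) (q ord0 i) (flat p)
      (flat (q ord0 i *: ('X^2 * (p - p^`()))) (dotp q x + c)).
    apply: DeriveDef; first exact: diff_derivable.
    rewrite deriveE// -[q ord0 i in LHS]mulr1 -[_ * 1]/(_ *: _) linearZ /= -deriveE//.
    have [_ ->] := D1; rewrite /flat; case: ifPn => _; last by rewrite scaler0.
    by rewrite hornerZ -mulrA.
  apply: is_derive_line D2 => h; rewrite addrA; congr (flat p (_ + _)).
  rewrite /dotp (bigD1 i)//= [in RHS](bigD1 i)//= !mxE !eqxx /= addrA; congr (_ + _).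
    by rewrite /GRing.scale /= mulr1; ring.
  by apply: eq_bigr => j ji; rewrite !mxE (negPf ji) andbF mulr0 add0r.
split=> [x|]; first by have [] := D x.
exists (q ord0 i *: ('X^2 * (p - p^`()))), q, c; apply/funext => x.
by have [_] := D x.
Qed.

Lemma test_fun_intro U K phi : smooth phi -> compact K -> K `<=` U ->
  (forall x, ~ K x -> phi x = 0) -> test_fun U phi.
Proof.
move=> sphi cK KU phi0.
have sub : closure [set x | phi x != 0] `<=` K.
  rewrite [X in _ `<=` X](closure_id K).1.
    by apply: closure_subset => x /= /eqP phix; apply: contrapT => /phi0.
  by apply: compact_closed => //; exact: norm_hausdorff.
split => //; last exact: subset_trans KU.
by apply: subclosed_compact sub => //; exact: closed_closure.
Qed.

Lemma test_fun_subset U V phi : U `<=` V -> test_fun U phi -> test_fun V phi.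
Proof. by move=> UV [? ? sU]; split => //; exact: subset_trans UV. Qed.

Lemma test_fun_out U phi x : test_fun U phi -> ~ U x -> phi x = 0.
Proof.
by move=> [_ _ sU] nUx; apply/eqP; apply: contra_notT nUx => phix; apply/sU/subset_closure.
Qed.

Lemma test_fun_smooth U phi : test_fun U phi -> smooth phi.
Proof. by case. Qed.

Lemma test_funM U phi psi : test_fun U phi -> smooth psi ->
  test_fun U (fun x => phi x * psi x).
Proof.
move=> [sphi cphi phiU] spsi.
apply: (test_fun_intro _ cphi phiU); first exact: smoothM.
move=> x nx; rewrite (_ : phi x = 0) ?mul0r//.
by apply/eqP; apply: contra_notT nx => phix; exact: subset_closure.
Qed.

Lemma test_funD U phi psi : test_fun U phi -> test_fun U psi ->
  test_fun U (fun x => phi x + psi x).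
Proof.
move=> [sphi cphi phiU] [spsi cpsi psiU].
apply: (@test_fun_intro _ (closure [set x | phi x != 0] `|` closure [set x | psi x != 0])).
- exact: smoothD.
- exact: compactU.
- by move=> x [/phiU|/psiU].
- move=> x /not_orP[nx nx'].
  rewrite (_ : phi x = 0) ?add0r.
    by apply/eqP; apply: contra_notT nx' => phix; exact: subset_closure.
  by apply/eqP; apply: contra_notT nx => phix; exact: subset_closure.
Qed.

Lemma test_funZ U phi (c : R) : test_fun U phi -> test_fun U (fun x => c * phi x).
Proof.
move=> tphi; have := test_funM tphi (@smooth_cst _ _ c).
by congr test_fun; apply/funext => x; rewrite mulrC.
Qed.

Lemma test_fun0 U : test_fun U (fun=> 0).
Proof.
apply: (@test_fun_intro _ set0) => //; first exact: smooth_cst.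
exact: compact0.
Qed.

Lemma test_fun_partial U phi i : test_fun U phi -> test_fun U (partial i phi).
Proof.
move=> [sphi cphi phiU].
apply: (test_fun_intro _ cphi phiU); first exact: smooth_partial.
move=> x nx; rewrite /partial (@near_eq_derive _ _ _ _ (cst 0)) ?derive_cst//.
have : nbhs x (~` closure [set x | phi x != 0]).
  by apply: open_nbhs_nbhs; split => //; rewrite openC; exact: closed_closure.
apply: filterS => y /= ny; apply/eqP; apply: contra_notT ny => phiy.
exact: subset_closure.
Qed.

Lemma test_fun_support U phi : test_fun U phi ->
  exists M, 0 < M /\ forall (x : E) j, M <= `|x ord0 j| -> phi x = 0.
Proof.
move=> [sphi cphi phiU].
have [M M0 HM] := ex_strict_bound_gt0 (compact_bounded cphi).
exists M; split => // x j Mx; apply/eqP/negPn/negP => phix.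
have /HM /= : closure [set x | phi x != 0] x by exact: subset_closure.
apply/negP; rewrite -leNgt (le_trans Mx)//.
have [//|] := leP `|x ord0 j| `|x|.
have n0 : 0 < `|x ord0 j| by apply: lt_le_trans M0 Mx.
move=> xj; have : ball (0 : E) `|x ord0 j| x.
  by rewrite mx_norm_ball /ball_ /= sub0r normrN.
by move/ball_rVP => /(_ n0 j); rewrite mxE sub0r normrN ltxx.
Qed.

Lemma test_fun_bounded U phi : test_fun U phi -> exists C, forall x, `|phi x| <= C.
Proof.
move=> [sphi cphi phiU].
have : compact (phi @` closure [set x | phi x != 0]).
  apply: continuous_compact => //; apply: continuous_subspaceT.
  exact: smooth_continuous.
move=> /compact_bounded /ex_strict_bound_gt0[C C0 HC].
exists C => x; have [->|phix] := eqVneq (phi x) 0; first by rewrite normr0 ltW.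
by apply/ltW/HC; exists x => //; exact: subset_closure.
Qed.

Lemma smooth_measurable phi : smooth phi -> measurable_fun setT phi.
Proof.
move=> sphi; apply: continuous_measurable_rV; [exact: openT|move=> x _].
exact: smooth_continuous.
Qed.

Lemma test_fun_integrable U phi : test_fun U phi ->
  leb.-integrable setT (EFin \o phi).
Proof.
move=> tphi; have [C phiC] := test_fun_bounded tphi.
have [M [M0 phiM]] := test_fun_support tphi.
apply: (@bounded_support_integrable _ _ _ _ (ball (0 : E) M) C) => //.
- exact: measurable_ball_rV.
- by apply: le_lt_trans (ltry ((2 * M) ^+ d)); rewrite -(lebesgue_rV_ball (0 : E) M0).
- exact: (smooth_measurable (test_fun_smooth tphi)).
- move=> x /= /ball_rVP => /(_ M0) /existsNP[j]; rewrite mxE sub0r normrN => /negP.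
  by rewrite -leNgt => /phiM.
Qed.

Lemma integral_test_fun_partial U V phi i : measurable V -> U `<=` V ->
  test_fun U phi -> \int[leb]_(x in V) partial i phi x = 0.
Proof.
move=> mV UV tphi; have tp := test_fun_partial i tphi.
have [M [M0 phiM]] := test_fun_support tphi.
have [M' [M'0 pM]] := test_fun_support tp.
have [C pC] := test_fun_bounded tp.
rewrite Rintegral_mkcond (_ : _ \_ _ = partial i phi); last first.
  apply/funext => x; rewrite patchE; case: ifPn => // /negP; rewrite inE => nVx.
  by rewrite (test_fun_out tp)// => /UV.
rewrite /Rintegral (_ : (\int[leb]_x (partial i phi x)%:E)%E = 0%E)//.
apply: (@integral_partial0 _ _ i phi _ (Num.max M M') C).
- by rewrite lt_max M0.
- exact: (smooth_continuous (test_fun_smooth tp)).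
- exact: pC.
- by move=> x; exact: (smooth_is_derive _ _ (test_fun_smooth tphi)).
- by move=> x j; rewrite ge_max => /andP[h _]; exact: phiM h.
- by move=> x j; rewrite ge_max => /andP[_ h]; exact: pM h.
Qed.

End test_functions.

(** * The L^2 inner product *)

Section L2.
Context {R : realType} {d : nat}.
Local Notation E := 'rV[R]_d.
Local Notation leb := (@lebesgue_rV R d).
Implicit Types (u v w h : E -> R).

(** The inner product of L^2(U). *)
Definition ip (U : set E) u v : R := \int[leb]_(x in U) (u x * v x).

Definition cvgL2 (U : set E) (un : nat -> E -> R) u : Prop :=
  ip U (fun x => un n x - u x) (fun x => un n x - u x) @[n --> \oo] --> (0 : R).

Section domain.
Variable U : set E.
Hypothesis mU : measurable U.

Lemma L2_sqr_integrable u : L2 U u ->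
  leb.-integrable U (EFin \o (fun x => u x ^+ 2)).
Proof.
move=> [mu uoo]; apply/integrableP; split.
  by apply/measurable_EFinP; exact: measurable_funX.
rewrite (eq_integral (fun x => (u x ^+ 2)%:E))// => x _ /=.
by rewrite ger0_norm// sqr_ge0.
Qed.

Lemma L2_integrable u v : L2 U u -> L2 U v ->
  leb.-integrable U (EFin \o (fun x => u x * v x)).
Proof.
move=> lu lv; have iu := L2_sqr_integrable lu; have iv := L2_sqr_integrable lv.
apply: (le_integrable mU _ _ (integrableD mU iu iv)).
  by apply/measurable_EFinP; apply: measurable_funM; [case: lu|case: lv].
move=> x _ /=; rewrite lee_fin normrM [X in _ <= X]ger0_norm ?addr_ge0 ?sqr_ge0//.
rewrite -(real_normK (num_real (u x))) -(real_normK (num_real (v x))).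
have := sqr_ge0 (`|u x| - `|v x|); have := normr_ge0 (u x); have := normr_ge0 (v x).
nra.
Qed.

Lemma L2_of_integrable u : measurable_fun U u ->
  leb.-integrable U (EFin \o (fun x => u x ^+ 2)) -> L2 U u.
Proof.
move=> mu /integrableP[_ uoo]; split => //; apply: le_lt_trans uoo.
rewrite le_eqVlt; apply/orP; left; apply/eqP; apply: eq_integral => x _ /=.
by rewrite ger0_norm// sqr_ge0.
Qed.

Lemma L2D u v : L2 U u -> L2 U v -> L2 U (fun x => u x + v x).
Proof.
move=> lu lv; apply: L2_of_integrable.
  by apply: measurable_funD; [case: lu|case: lv].
have := integrableD mU (integrableD mU (L2_integrable lu lu) (L2_integrable lv lv))
  (integrableD mU (L2_integrable lu lv) (L2_integrable lu lv)).
apply: eq_integrable => // x _ /=.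
by rewrite -!EFinD; congr EFin; ring.
Qed.

Lemma L2_bounded (C : R) h u : measurable_fun U h -> (forall x, U x -> `|h x| <= C) ->
  L2 U u -> L2 U (fun x => h x * u x).
Proof.
move=> mh hC lu; have mu : measurable_fun U u by case: lu.
apply: L2_of_integrable; first exact: measurable_funM.
apply: (le_integrable mU _ _ (integrableZl mU (C ^+ 2) (L2_sqr_integrable lu))).
  by apply/measurable_EFinP; apply: measurable_funX; exact: measurable_funM.
move=> x Ux /=; rewrite lee_fin -exprMn !(ger0_norm (sqr_ge0 _)) !exprMn.
apply: ler_wpM2r; first exact: sqr_ge0.
have := hC _ Ux; rewrite -[h x ^+ 2](real_normK (num_real _)) => hx.
by rewrite lerXn2r// nnegrE//; apply: le_trans hx.
Qed.

Lemma L2Z (c : R) u : L2 U u -> L2 U (fun x => c * u x).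
Proof. by move=> lu; apply: (@L2_bounded `|c| (cst c)). Qed.

Lemma L2B u v : L2 U u -> L2 U v -> L2 U (fun x => u x - v x).
Proof.
move=> lu lv; have := L2D lu (L2Z (-1) lv).
by congr L2; apply/funext => x; rewrite mulN1r.
Qed.

Lemma L2_0 : L2 U (fun=> 0).
Proof.
split; first exact: measurable_cst.
by rewrite integral0_eq// => x _; rewrite expr0n.
Qed.

Lemma L2_sum (I : finType) (P : pred I) (F : I -> E -> R) :
  (forall i, P i -> L2 U (F i)) -> L2 U (fun x => \sum_(i | P i) F i x).
Proof.
move=> lF; pose G := fun s : seq I => (fun x => \sum_(i <- s | P i) F i x).
rewrite -[X in L2 U X]/(G _); elim: (index_enum I) => [|i s IH].
  by rewrite (_ : G _ = fun=> 0); [exact: L2_0|apply/funext => x; rewrite /G big_nil].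
have [Pi|nPi] := boolP (P i); last first.
  rewrite (_ : G _ = G s)//; apply/funext => x; rewrite /G big_cons (negPf nPi)//.
rewrite (_ : G _ = fun x => F i x + G s x); first by apply: L2D => //; exact: lF.
by apply/funext => x; rewrite /G big_cons Pi.
Qed.

Lemma L2_ae u v : measurable_fun U v -> u = v %[ae leb in U] -> L2 U u -> L2 U v.
Proof.
move=> mv uv [mu uoo]; split => //.
rewrite -(@ae_eq_integral _ _ _ leb U _ (fun x => (u x ^+ 2)%:E))//.
- by apply/measurable_EFinP; exact: measurable_funX.
- by apply/measurable_EFinP; exact: measurable_funX.
- by apply: filterS uv => x h /h ->.
Qed.

Lemma L2_test V phi : test_fun V phi -> L2 U phi.
Proof.
move=> tphi; have t2 := test_funM tphi (test_fun_smooth tphi).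
apply: L2_of_integrable.
  exact: measurable_funS (smooth_measurable (test_fun_smooth tphi)).
have := integrableS measurableT mU (@subsetT _ _) (test_fun_integrable t2).
by apply: eq_integrable => // x _ /=; rewrite expr2.
Qed.

Lemma L2_setI (V : set E) u : measurable V -> L2 U u -> L2 (U `&` V) u.
Proof.
move=> mV [mu uoo]; split; first by apply: measurable_funS mu.
apply: le_lt_trans uoo; apply: ge0_subset_integral => //.
- exact: measurableI.
- by apply/measurable_EFinP; exact: measurable_funX.
- by move=> x _; rewrite lee_fin sqr_ge0.
Qed.

Lemma ipC u v : ip U u v = ip U v u.
Proof. by apply: eq_Rintegral => x _; rewrite mulrC. Qed.

Lemma ipDl u v w : L2 U u -> L2 U v -> L2 U w ->
  ip U (fun x => u x + v x) w = ip U u w + ip U v w.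
Proof.
move=> lu lv lw; rewrite /ip -RintegralD//; [|exact: L2_integrable..].
by apply: eq_Rintegral => x _; rewrite mulrDl.
Qed.

Lemma ipZl c u w : L2 U u -> L2 U w -> ip U (fun x => c * u x) w = c * ip U u w.
Proof.
move=> lu lw; rewrite /ip -RintegralZl//; last exact: L2_integrable.
by apply: eq_Rintegral => x _; rewrite mulrA.
Qed.

Lemma ipDr u v w : L2 U u -> L2 U v -> L2 U w ->
  ip U w (fun x => u x + v x) = ip U w u + ip U w v.
Proof. by move=> lu lv lw; rewrite ipC ipDl// ![ip U _ w]ipC. Qed.

Lemma ipZr c u w : L2 U u -> L2 U w -> ip U w (fun x => c * u x) = c * ip U w u.
Proof. by move=> lu lw; rewrite ipC ipZl// ipC. Qed.

Lemma ip0l w : ip U (fun=> 0) w = 0.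
Proof. by rewrite /ip /Rintegral integral0_eq// => x _; rewrite mul0r. Qed.

Lemma ipBl u v w : L2 U u -> L2 U v -> L2 U w ->
  ip U (fun x => u x - v x) w = ip U u w - ip U v w.
Proof.
move=> lu lv lw; have := ipDl lu (L2Z (-1) lv) lw.
rewrite ipZl// mulN1r => <-; congr ip.
by apply/funext => x; rewrite mulN1r.
Qed.

Lemma ip_suml (I : finType) (F : I -> E -> R) w : (forall i, L2 U (F i)) -> L2 U w ->
  ip U (fun x => \sum_i F i x) w = \sum_i ip U (F i) w.
Proof.
move=> lF lw; pose G := fun s : seq I => (fun x => \sum_(i <- s) F i x).
rewrite -[X in ip U X]/(G _).
suff [_ ->] : L2 U (G (index_enum I)) /\ ip U (G (index_enum I)) w =
  \sum_i ip U (F i) w by [].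
elim: (index_enum I) => [|i s [lG IH]].
  rewrite (_ : G _ = fun=> 0); last by apply/funext => x; rewrite /G big_nil.
  by split; [exact: L2_0|rewrite ip0l big_nil].
rewrite (_ : G _ = fun x => F i x + G s x); last first.
  by apply/funext => x; rewrite /G big_cons.
by split; [exact: L2D|rewrite ipDl// IH big_cons].
Qed.

Lemma ip_ge0 u : 0 <= ip U u u.
Proof. by apply: Rintegral_ge0 => x _; rewrite -expr2 sqr_ge0. Qed.

Lemma ip_ae u u' w : measurable_fun U u -> measurable_fun U u' -> measurable_fun U w ->
  u = u' %[ae leb in U] -> ip U u w = ip U u' w.
Proof.
move=> mu mu' mw uu'; congr fine; apply: ae_eq_integral => //.
- by apply/measurable_EFinP; exact: measurable_funM.
- by apply/measurable_EFinP; exact: measurable_funM.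
- by apply: filterS uu' => x h /h ->.
Qed.

Lemma ip_eq0 u : L2 U u -> ip U u u = 0 -> u = (fun=> 0) %[ae leb in U].
Proof.
move=> lu u0; have iu := L2_integrable lu lu.
have : (\int[leb]_(x in U) `|(u x * u x)%:E| = 0)%E.
  rewrite (eq_integral (fun x => (u x * u x)%:E)); last first.
    by move=> x _ /=; rewrite ger0_norm// -expr2 sqr_ge0.
  rewrite -[LHS]fineK; first by congr EFin; exact: u0.
  by have := integrable_fin_num mU iu.
move/(ae_eq_integral_abs leb mU).
move=> h; have /h : measurable_fun U (fun x => (u x * u x)%:E).
  by case/integrableP : iu.
apply: filterS => x hx Ux; have := hx Ux => -[] /eqP.
by rewrite mulf_eq0 orbb => /eqP.
Qed.

Lemma cauchy_schwarz u v : L2 U u -> L2 U v -> ip U u v ^+ 2 <= ip U u u * ip U v v.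
Proof.
move=> lu lv.
have H (s t : R) : 0 <= s ^+ 2 * ip U u u + 2 * s * t * ip U u v + t ^+ 2 * ip U v v.
  have := ip_ge0 (fun x => s * u x + t * v x).
  have lsu := L2Z s lu; have ltv := L2Z t lv.
  rewrite ipDl//; last exact: L2D.
  rewrite !ipDr// !ipZl// !ipZr// (ipC v u) => h.
  by apply: le_trans h _; rewrite le_eqVlt; apply/orP; left; apply/eqP; ring.
(* if (v, v) = 0 the form is affine in t, so (u, v) = 0 *)
have [v0|v0] := eqVneq (ip U v v) 0.
  have := H 1 (- ip U u u); have := H 1 0; have := H (ip U u v) (- (ip U u u + 1)).
  rewrite v0; have := ip_ge0 u; set a := ip U u u; set c := ip U u v.
  move=> a0 h1 _ _.
  have : c ^+ 2 * (a + 2) <= 0 by nra.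
  by have := sqr_ge0 c; nra.
have vp : 0 < ip U v v by rewrite lt_neqAle eq_sym v0 ip_ge0.
(* for s = (v, v), the form is minimal at t = - (u, v) *)
have := H (ip U v v) (- ip U u v).
set a := ip U u u; set c := ip U u v; set e := ip U v v in vp *.
move=> h; have : 0 <= e * (a * e - c ^+ 2) by nra.
by rewrite pmulr_rge0// subr_ge0.
Qed.

Lemma cvgL2_ip (un : nat -> E -> R) u h : (forall n, L2 U (un n)) -> L2 U u ->
  L2 U h -> cvgL2 U un u -> ip U (un n) h @[n --> \oo] --> ip U u h.
Proof.
move=> lun lu lh cu.
have : (ip U (un n) h - ip U u h) ^+ 2 @[n --> \oo] --> (0 : R).
  apply: (@squeeze_cvgr _ _ _ _ (fun=> 0)
     (fun n => ip U (fun x => un n x - u x) (fun x => un n x - u x) * ip U h h)).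
  - apply: nearW => n; rewrite sqr_ge0 /= -ipBl//.
    by apply: cauchy_schwarz => //; exact: L2B.
  - exact: cvg_cst.
  - by rewrite -[X in _ --> X](mul0r (ip U h h)); apply: cvgM => //; exact: cvg_cst.
move=> /cvgrPdist_lt H; apply/cvgrPdist_lt => e e0.
have := H (e ^+ 2) (exprn_gt0 _ e0); apply: filterS => n.
rewrite sub0r normrN ger0_norm ?sqr_ge0// => h2.
by rewrite -(ltr_pXn2r (n := 2))// ?nnegrE ?ltW// real_normK ?num_real// -sqrrN opprB.
Qed.

Lemma ip_sqrD u v : L2 U u -> L2 U v ->
  ip U (fun x => u x + v x) (fun x => u x + v x) =
  ip U u u + 2 * ip U u v + ip U v v.
Proof.
move=> lu lv; rewrite ipDl//; last exact: L2D.
by rewrite !ipDr// (ipC v u); ring.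
Qed.

Lemma ip_sqrD_le u v : L2 U u -> L2 U v ->
  ip U (fun x => u x + v x) (fun x => u x + v x) <= 2 * (ip U u u + ip U v v).
Proof.
move=> lu lv; have := ip_ge0 (fun x => u x + -1 * v x).
have lw := L2Z (-1) lv; rewrite !ip_sqrD// ipZl// !ipZr//; lra.
Qed.

Lemma cvgL2D (un vn : nat -> E -> R) u v : (forall n, L2 U (un n)) ->
  (forall n, L2 U (vn n)) -> L2 U u -> L2 U v -> cvgL2 U un u -> cvgL2 U vn v ->
  cvgL2 U (fun n x => un n x + vn n x) (fun x => u x + v x).
Proof.
move=> lun lvn lu lv cu cv.
apply: (@squeeze_cvgr _ _ _ _ (fun=> 0)
   (fun n => 2 * (ip U (fun x => un n x - u x) (fun x => un n x - u x)
     + ip U (fun x => vn n x - v x) (fun x => vn n x - v x)))).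
- apply: nearW => n; rewrite ip_ge0 /=.
  have la := L2B (lun n) lu; have lb := L2B (lvn n) lv.
  rewrite (_ : ip U _ _ = ip U (fun x => (un n x - u x) + (vn n x - v x))
    (fun x => (un n x - u x) + (vn n x - v x))); last first.
    by congr ip; apply/funext => x; ring.
  exact: ip_sqrD_le.
- exact: cvg_cst.
- rewrite [X in _ --> X](_ : 0 = 2 * (0 + 0)); last by ring.
  by apply: cvgM; [exact: cvg_cst|exact: cvgD].
Qed.

Lemma cvgL2_bounded (C : R) h (un : nat -> E -> R) u : measurable_fun U h ->
  (forall x, U x -> `|h x| <= C) -> (forall n, L2 U (un n)) -> L2 U u ->
  cvgL2 U un u -> cvgL2 U (fun n x => h x * un n x) (fun x => h x * u x).
Proof.
move=> mh hC lun lu cu.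
apply: (@squeeze_cvgr _ _ _ _ (fun=> 0)
   (fun n => C ^+ 2 * (ip U (fun x => un n x - u x) (fun x => un n x - u x)))).
- apply: nearW => n; rewrite ip_ge0 /=.
  have la := L2B (lun n) lu.
  have lb := L2_bounded mh hC la.
  rewrite -ipZl// /ip; apply: le_Rintegral => //.
  + have := L2_integrable lb lb; apply: eq_integrable => // x _ /=.
    by rewrite !mulrBr.
  + by apply: L2_integrable => //; exact: L2Z.
  + move=> x Ux.
    rewrite [X in X <= _](_ : _ = h x ^+ 2 * (un n x - u x) ^+ 2); last by ring.
    rewrite [X in _ <= X](_ : _ = C ^+ 2 * (un n x - u x) ^+ 2); last by ring.
    apply: ler_wpM2r; first exact: sqr_ge0.
    have hx := hC _ Ux; rewrite -[h x ^+ 2](real_normK (num_real _)).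
    by rewrite lerXn2r// nnegrE//; apply: le_trans hx.
- exact: cvg_cst.
- rewrite [X in _ --> X](_ : 0 = C ^+ 2 * 0); last by rewrite mulr0.
  by apply: cvgM; [exact: cvg_cst|].
Qed.

Lemma cvgL2Z (c : R) (un : nat -> E -> R) u : (forall n, L2 U (un n)) -> L2 U u ->
  cvgL2 U un u -> cvgL2 U (fun n x => c * un n x) (fun x => c * u x).
Proof. by move=> lun lu; apply: (@cvgL2_bounded `|c| (cst c)). Qed.

End domain.
End L2.

(** * The fundamental lemma of the calculus of variations *)

Section polyhedral_bump.
Context {R : realType} {d : nat}.
Local Notation E := 'rV[R]_d.
Implicit Types (L : seq (E * R)) (x : E).

Definition halfspaces L : set E :=
  [set x | forall l, l \in L -> 0 < dotp l.1 x + l.2].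

(** As k grows this tends to the indicator of the open polyhedron
    [halfspaces L]. Dilating the argument of exp(-1/t) pushes its value
    towards 1. *)
Definition bump (k : nat) L x : R :=
  \prod_(l <- L) flat 1 (k.+1%:R * (dotp l.1 x + l.2)).

Lemma dotpZl (c : R) (p x : E) : dotp (c *: p) x = c * dotp p x.
Proof. by rewrite /dotp mulr_sumr; apply: eq_bigr => i _; rewrite mxE mulrA. Qed.

Lemma dotpNl (p x : E) : dotp (- p) x = - dotp p x.
Proof. by rewrite -scaleN1r dotpZl mulN1r. Qed.

Lemma smooth_bump k L : smooth (bump k L).
Proof.
elim: L => [|l L IH].
  rewrite (_ : bump k [::] = fun=> 1); first exact: smooth_cst.
  by apply/funext => x; rewrite /bump big_nil.
rewrite (_ : bump k _ = fun x => flat 1 (dotp (k.+1%:R *: l.1) x + k.+1%:R * l.2)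
   * bump k L x); first by apply: smoothM => //; exact: smooth_flat.
by apply/funext => x; rewrite /bump big_cons dotpZl -mulrDr.
Qed.

Lemma flat1_ge0 (t : R) : 0 <= flat 1 t.
Proof. by rewrite /flat; case: ifP => // _; rewrite hornerC mul1r expR_ge0. Qed.

Lemma flat1_le1 (t : R) : flat 1 t <= 1.
Proof.
rewrite /flat; case: ifPn => // t0; rewrite hornerC mul1r -expR0 ler_expR.
by rewrite oppr_le0 invr_ge0 ltW.
Qed.

Lemma bump_ge0 k L x : 0 <= bump k L x.
Proof. by apply: prodr_ge0 => l _; exact: flat1_ge0. Qed.

Lemma bump_le1 k L x : bump k L x <= 1.
Proof.
rewrite /bump; elim: L => [|l L IH]; first by rewrite big_nil.
rewrite big_cons mulr_ile1 ?flat1_ge0 ?flat1_le1//.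
exact: bump_ge0.
Qed.

Lemma bump_out k L x : ~ halfspaces L x -> bump k L x = 0.
Proof.
move=> /existsNP[l] /not_implyP[lL /negP]; rewrite -leNgt => lx.
rewrite /bump (big_rem l)//= {1}/flat ifF ?mul0r//.
by apply/negbTE; rewrite -leNgt mulr_ge0_le0.
Qed.

Lemma bump_cvg L x : halfspaces L x -> bump k L x @[k --> \oo] --> (1 : R).
Proof.
elim: L => [_|l L IH Lx].
  rewrite (_ : (fun k => _) = fun=> 1); first exact: cvg_cst.
  by apply/funext => k; rewrite /bump big_nil.
have l0 : 0 < dotp l.1 x + l.2 by apply: Lx; rewrite inE eqxx.
rewrite (_ : (fun k => _) = fun k => flat 1 (k.+1%:R * (dotp l.1 x + l.2)) * bump k L x); last first.
  by apply/funext => k; rewrite /bump big_cons.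
rewrite -[X in _ --> X](mulr1 1); apply: cvgM; last first.
  by apply: IH => l' l'L; apply: Lx; rewrite inE l'L orbT.
rewrite (_ : (fun k => _) = fun k : nat => expR (- (k.+1%:R^-1 * (dotp l.1 x + l.2)^-1))); last first.
  apply/funext => k; rewrite /flat ifT; last by rewrite mulr_gt0.
  by rewrite hornerC mul1r invfM.
rewrite -[X in _ --> X]expR0.
apply: continuous_cvg; first exact: continuous_expR.
rewrite -[X in _ --> X]oppr0; apply: cvgN.
rewrite -[X in _ --> X](mul0r (dotp l.1 x + l.2)^-1); apply: cvgM; last exact: cvg_cst.
exact: cvg_harmonic.
Qed.

End polyhedral_bump.

Section fundamental_lemma.
Context {R : realType} {d : nat}.
Local Notation E := 'rV[R]_d.
Local Notation leb := (@lebesgue_rV R d).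

(** A pi-system that generates the Borel sets; the empty list gives the whole
    space. *)
Definition orthants : set (set E) :=
  [set A | exists L : seq ('I_d * R),
    A = [set x : E | forall l, l \in L -> l.2 < x ord0 l.1]].

Lemma orthants_setI_closed : setI_closed orthants.
Proof.
move=> _ _ [L ->] [L' ->]; exists (L ++ L'); apply/seteqP; split => x /=.
  by move=> [h h'] l; rewrite mem_cat => /orP[/h|/h'].
by move=> h; split => l lL; apply: h; rewrite mem_cat lL ?orbT.
Qed.

Lemma open_halfspaces (L : seq (E * R)) : open (halfspaces L).
Proof.
rewrite (_ : halfspaces L = \big[setI/setT]_(l <- L) [set x | 0 < dotp l.1 x + l.2]).
  apply: big_rec => [|l A _ oA]; first exact: openT.
  apply: openI => //.
  by have /continuousP := @continuous_affine R d l.1 l.2 => /(_ _ (@open_gt R 0)).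
apply/seteqP; split => x; rewrite -bigcap_seq /=.
  by move=> h l /= lL; exact: h.
by move=> h l lL; exact: (h l).
Qed.

Lemma halfspaces_measurable (L : seq (E * R)) : measurable (halfspaces L).
Proof. by apply: open_measurable_rV; exact: open_halfspaces. Qed.

Lemma orthant_halfspaces (L : seq ('I_d * R)) :
  [set x : E | forall l, l \in L -> l.2 < x ord0 l.1] =
  halfspaces [seq (delta_mx ord0 l.1, - l.2) | l <- L].
Proof.
apply/seteqP; split => x /=.
  by move=> h _ /mapP[l lL ->] /=; rewrite dotp_delta subr_gt0; exact: h.
move=> h l lL; have := h _ (map_f _ lL).
by rewrite /= dotp_delta subr_gt0.
Qed.

Lemma measurable_orthants : @measurable _ E = <<s orthants >>.
Proof.
apply/seteqP; split => A; last first.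
  apply: smallest_sub; first exact: sigma_algebra_measurable.
  by move=> _ [L ->]; rewrite orthant_halfspaces; exact: halfspaces_measurable.
move=> mA.
have mid : measurable_fun (setT : set (g_sigma_algebraType orthants)) (fun x => x : E).
  apply: measurable_fun_rV => i.
  apply: (measurability _ (RGenOInfty.measurableE R)) => _ [_ [a ->] <-].
  apply: sub_sigma_algebra; exists [:: (i, a)]; rewrite setTI.
  apply/seteqP; split => x /=; rewrite in_itv /= andbT.
    by move=> h l; rewrite inE => /eqP ->.
  by move=> /(_ (i, a)); rewrite inE eqxx => /(_ isT).
by have := mid measurableT A mA; rewrite setTI.
Qed.

(** The half-spaces that cut out the ball of centre c and radius r. *)
Definition box_halfspaces (c : E) (r : R) : seq (E * R) :=
  [seq (delta_mx ord0 i, r - c ord0 i) | i <- enum 'I_d] ++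
  [seq (- delta_mx ord0 i, r + c ord0 i) | i <- enum 'I_d].

Lemma halfspaces_cat (L L' : seq (E * R)) :
  halfspaces (L ++ L') = halfspaces L `&` halfspaces L'.
Proof.
apply/seteqP; split => x.
  by move=> h; split => l lL; apply: h; rewrite mem_cat lL ?orbT.
by move=> [h h'] l; rewrite mem_cat => /orP[/h|/h'].
Qed.

Lemma box_halfspacesE (c : E) (r : R) : 0 < r -> halfspaces (box_halfspaces c r) = ball c r.
Proof.
move=> r0; rewrite halfspaces_cat; apply/seteqP; split => x.
  move=> [h h']; apply/ball_rVP => // i; rewrite ltr_norml.
  have := h _ (map_f _ (mem_enum 'I_d i)); have := h' _ (map_f _ (mem_enum 'I_d i)).
  rewrite /= dotpNl !dotp_delta; lra.
move/ball_rVP => /(_ r0) h; split => _ /mapP[i _ ->] /=;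
  have := h i; rewrite ltr_norml ?dotpNl dotp_delta; lra.
Qed.

Lemma compact_cbox (c : E) (r : R) :
  compact [set x : E | forall i, `|c ord0 i - x ord0 i| <= r].
Proof.
have := @rV_compact _ _ (fun i => `[c ord0 i - r, c ord0 i + r]%classic)
  (fun i => @segment_compact R _ _).
congr compact; apply/seteqP; split => x h i; have := h i;
  rewrite /= in_itv /= ler_norml; lra.
Qed.

(** For an open polyhedron P, the bumps on P cut by the ball are test functions
    that tend to its indicator, so the integral of h over it vanishes by dominated
    convergence. Dynkin induction extends this to all Borel subsets of the ball. *)
Lemma weak_zero_ball (U : set E) (h : E -> R) (c : E) (r : R) : measurable U -> 0 < r ->
  [set x : E | forall i, `|c ord0 i - x ord0 i| <= r] `<=` U -> L2 U h ->
  (forall phi, test_fun U phi -> ip U h phi = 0) ->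
  h = (fun=> 0) %[ae leb in ball c r].
Proof.
move=> mU r0 QU lh h0; set Q : set E := ball c r.
have mQ : measurable Q := measurable_ball_rV c r0.
have QsU : Q `<=` U by move=> x /(ball_rVP _ _ r0) hx; apply: QU => i; exact/ltW.
have l1 : L2 Q (cst 1).
  split => //; rewrite (eq_integral (fun=> 1%E)); last by move=> x _; rewrite /= expr1n.
  rewrite integral_cst// mul1e.
  by apply: le_lt_trans (ltry ((2 * r) ^+ d)); rewrite -(lebesgue_rV_ball c r0).
have lhQ : L2 Q h.
  by have := L2_setI mU mQ lh; rewrite setIidr.
have ih : leb.-integrable Q (EFin \o h).
  have := L2_integrable mQ lhQ l1; apply: eq_integrable => // x _ /=.
  by rewrite mulr1.
have main (L : seq (E * R)) : (\int[leb]_(x in Q `&` halfspaces L) (h x)%:E = 0)%E.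
  have mL := halfspaces_measurable L.
  (* cutting with the ball makes the supports compact in U *)
  pose L' := L ++ box_halfspaces c r.
  have L'E : halfspaces L' = halfspaces L `&` Q by rewrite halfspaces_cat box_halfspacesE.
  have tk k : test_fun U (bump k L').
    apply: (test_fun_intro (smooth_bump k L') (@compact_cbox c r) QU) => x nx.
    apply: bump_out; rewrite L'E => -[_ /(ball_rVP _ _ r0) xQ].
    by apply: nx => i; exact/ltW.
  have i0 k : (\int[leb]_(x in Q) (h x * bump k L' x)%:E = 0)%E.
    have iU := L2_integrable mU lh (L2_test mU (tk k)).
    have : (\int[leb]_(x in U) (h x * bump k L' x)%:E = 0)%E.
      rewrite -[LHS]fineK; first by congr EFin; exact: h0.
      by have := integrable_fin_num mU iU.
    rewrite integral_mkcond => H; rewrite integral_mkcond -[RHS]H.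
    apply: eq_integral => x _; rewrite !patchE.
    case: ifPn => [xQ|nxQ]; first by rewrite ifT// inE; apply: QsU; exact: set_mem.
    case: ifPn => // _; rewrite bump_out ?mulr0// L'E => -[_ xQ].
    by move/negP: nxQ; rewrite inE.
  have mb k : measurable_fun Q (bump k L').
    by apply: measurable_funS (smooth_measurable (smooth_bump k L')).
  have mhQ : measurable_fun Q h by case: lhQ.
  have mi : measurable_fun Q (\1_(halfspaces L) : E -> R) by [].
  have hcv x : Q x -> (fun k => (h x * bump k L' x)%:E) @ \oo -->
      (h x * \1_(halfspaces L) x)%:E.
    move=> Qx; apply: cvg_EFin; first exact: nearW.
    apply: cvgM; first exact: cvg_cst.
    rewrite indicE; have [Lx|nLx] := pselect (halfspaces L x).
      by rewrite mem_set//; apply: bump_cvg; rewrite L'E.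
    rewrite memNset//= (_ : (fun k => _) = fun=> 0); first exact: cvg_cst.
    by apply/funext => k; rewrite /= bump_out// L'E => -[].
  have hdom x (k : nat) : Q x -> (`|(h x * bump k L' x)%:E| <= `|h x|%:E)%E.
    move=> _; rewrite /= lee_fin normrM ler_piMr// ger0_norm ?bump_ge0//.
    exact: bump_le1.
  rewrite -[RHS](_ : (\int[leb]_(x in Q) (h x * \1_(halfspaces L) x)%:E = 0)%E).
    rewrite integral_mkcondr; apply: eq_integral => x _ /=.
    rewrite patchE indicE; case: ifPn => _ /=; first by rewrite mulr1.
    by rewrite mulr0.
  have [_ _ cv] := @dominated_convergence _ _ _ leb Q mQ
    (fun k x => (h x * bump k L' x)%:E)
    (fun x => (h x * \1_(halfspaces L) x)%:E) (fun x => `|h x|%:E)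
    (fun k => proj2 (measurable_EFinP _ _) (measurable_funM mhQ (mb k)))
    (proj2 (measurable_EFinP _ _) (measurable_funM mhQ mi))
    (aeW _ hcv) (integrable_norm ih) (aeW _ hdom).
  have := cvg_lim (@ereal_hausdorff _) cv => <-.
  rewrite (_ : [sequence _]_n = fun=> 0%E); first by rewrite lim_cst.
  by apply/funext => k /=; exact: i0.
have P A : measurable A -> (\int[leb]_(x in Q `&` A) (h x)%:E = 0)%E.
  rewrite measurable_orthants; move: A.
  have hQ0 : (\int[leb]_(x in Q) (h x)%:E = 0)%E.
    have := main [::]; rewrite (_ : halfspaces [::] = setT) ?setIT//.
    by apply/seteqP; split.
  apply: (dynkin_induction measurable_orthants orthants_setI_closed).
  - by rewrite setIT.
  - by move=> _ [L ->]; rewrite orthant_halfspaces; exact: main.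
  - move=> A mA A0.
    have := integral_setU_EFin leb (measurableI _ _ mQ mA) (measurableI _ _ mQ (measurableC mA))
      (f := h).
    rewrite -setIUr setUv setIT hQ0 A0 add0e => -> //.
      by case: lhQ.
    rewrite disj_set2E; apply/eqP; rewrite setIACA setIid.
    by rewrite setICr setI0.
  - move=> F mF tF F0; rewrite setI_bigcupr integral_bigcup.
    + by rewrite eseries0// => k _ _; exact: F0.
    + apply/trivIsetP => i j _ _ ij; rewrite setIACA.
      by move/trivIsetP : tF => /(_ i j I I ij) ->; rewrite setI0.
    + by move=> k; exact: measurableI.
    + apply: integrableS ih => //; first by apply: bigcup_measurable => k _; exact: measurableI.
      by apply: bigcup_sub => k _; exact: subIsetl.
have := integral_ae_eq mQ ih (g := cst 0%E) ltac:(exact: measurable_cst).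
have H A : A `<=` Q -> measurable A ->
    (\int[leb]_(x in A) (EFin \o h) x = \int[leb]_(x in A) cst 0 x)%E.
  by move=> AQ mA; rewrite integral0 -[in LHS](setIidr AQ); exact: P.
by move/(_ H); apply: filterS => x hx /hx [].
Qed.

(** U is a countable union of rational balls whose doubles lie in U. *)
Theorem fundamental_lemma (U : set E) (h : E -> R) : open U -> L2 U h ->
  (forall phi, test_fun U phi -> ip U h phi = 0) ->
  h = (fun=> 0) %[ae leb in U].
Proof.
move=> oU lh h0; have mU := open_measurable_rV oU.
pose q (k : 'rV[rat]_d * rat) : set E :=
  ball (map_mx (ratr : rat -> R) k.1) (ratr k.2 : R).
pose q2 (k : 'rV[rat]_d * rat) : set E :=
  ball (map_mx (ratr : rat -> R) k.1) (2 * ratr k.2 : R).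
have H n : \forall x \ae leb, forall k : 'rV[rat]_d * rat,
    unpickle n = Some k -> 0 < k.2 -> q2 k `<=` U -> q k x -> h x = 0.
  case: (unpickle n) => [k|]; last by apply: aeW.
  have [k0|k0] := ltP 0 k.2; last by apply: aeW => x _ [<-]; rewrite ltNge k0.
  have [qU|nqU] := pselect (q2 k `<=` U); last by apply: aeW => x _ [<-].
  have r0 : 0 < ratr k.2 :> R by rewrite ltr0q.
  have : h = (fun=> 0) %[ae leb in q k].
    apply: (weak_zero_ball mU r0 _ lh h0); apply: subset_trans qU => x hx.
    apply/ball_rVP; first by rewrite mulr_gt0.
    by move=> i; apply: le_lt_trans (hx i) _; rewrite ltr_pMl// ltr1n.
  by apply: filterS => x hx _ [<-] _ _ /hx.
have := ae_foralln H; apply: filterS => x hx Ux.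
have /nbhs_ballP[e /= e0 xeA] : nbhs x U by exact: open_nbhs_nbhs.
(* the ball of radius 2 r about a point within r of x lies in the ball of
   radius 3 r about x *)
have [r] := rat_in_itvoo (divr_gt0 e0 (ltr0n R 3)).
rewrite in_itv /= => /andP[r0 re].
have [y yP] : exists y : 'rV[rat]_d, forall i,
    `|x ord0 i - ratr (y ord0 i)| < ratr r.
  have g i : exists z : rat, `|x ord0 i - ratr z| < ratr r.
    have [z] := @rat_in_itvoo R (x ord0 i - ratr r) (x ord0 i + ratr r) ltac:(lra).
    rewrite in_itv /= => /andP[z1 z2]; exists z; rewrite ltr_norml; lra.
  exists (\row_i sval (cid (g i))) => i; rewrite mxE.
  exact: (svalP (cid (g i))).
apply: (hx (pickle (y, r)) (y, r)); first by rewrite pickleK.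
- by rewrite -(ltr0q R).
- move=> z /= /ball_rVP zh; apply: xeA; apply/ball_rVP => // i.
  have := zh (mulr_gt0 (ltr0Sn _ 1) r0) i; have := yP i; rewrite mxE.
  rewrite !ltr_norml; lra.
- by apply/ball_rVP => // i; rewrite mxE distrC.
Qed.

End fundamental_lemma.

(** * Weak gradients and H^1_0 *)

Section sobolev.
Context {R : realType} {d : nat}.
Local Notation E := 'rV[R]_d.
Local Notation leb := (@lebesgue_rV R d).
Implicit Types (U V : set E) (u v w : E -> R) (g h : E -> E) (i : 'I_d).

Lemma eq_cvgR (a b : nat -> R) (l : R) : a =1 b ->
  a n @[n --> \oo] --> l -> b n @[n --> \oo] --> l.
Proof. by move=> /funext ->. Qed.

Lemma cvg_sumR (I : Type) (s : seq I) (a : I -> nat -> R) (l : I -> R) :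
  (forall k, a k n @[n --> \oo] --> l k) ->
  \sum_(k <- s) a k n @[n --> \oo] --> \sum_(k <- s) l k.
Proof.
move=> ak; elim: s => [|k s IH].
  rewrite big_nil; apply: (@eq_cvgR (fun=> 0)); last exact: cvg_cst.
  by move=> n; rewrite big_nil.
rewrite big_cons; apply: eq_cvgR (cvgD (ak k) IH) => n.
by rewrite big_cons.
Qed.

Lemma ip_supported U V u w : U `<=` V -> (forall x, ~ U x -> w x = 0) ->
  ip V u w = ip U u w.
Proof.
move=> UV w0; rewrite /ip Rintegral_mkcond [RHS]Rintegral_mkcond.
congr Rintegral; apply/funext => x; rewrite !patchE.
case: ifPn => [xV|nxV]; case: ifPn => [xU|nxU] //.
  by rewrite w0 ?mulr0//; move/negP: nxU; rewrite inE.
by move/negP: nxV; case; rewrite inE; apply: UV; exact: set_mem.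
Qed.

Definition L2grad U g : Prop := forall i, L2 U (fun x => g x ord0 i).

Lemma weak_grad_test U u g phi i : weak_grad U u g -> test_fun U phi ->
  ip U u (partial i phi) = - ip U (fun x => g x ord0 i) phi.
Proof. by move=> [_ H] /H; exact. Qed.

Lemma weak_gradS U V u g : open U -> open V -> U `<=` V ->
  weak_grad V u g -> weak_grad U u g.
Proof.
move=> oU oV UV [lg H]; have mU := open_measurable_rV oU; have mV := open_measurable_rV oV.
split=> [i|phi i tphi]; first by have := L2_setI mV mU (lg i); rewrite setIidr.
have := H phi i (test_fun_subset UV tphi).
rewrite -/(ip V u (partial i phi)) -/(ip V (fun x => g x ord0 i) phi).
rewrite (ip_supported _ UV); last by move=> x; exact: test_fun_out (test_fun_partial i tphi).
by rewrite (ip_supported _ UV)// => x; exact: test_fun_out tphi.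
Qed.

Section domain.
Variable U : set E.
Hypothesis oU : open U.
Let mU : measurable U := open_measurable_rV oU.

Lemma weak_grad_unique u v g h : L2 U u -> L2 U v -> u = v %[ae leb in U] ->
  weak_grad U u g -> weak_grad U v h ->
  forall i, (fun x => g x ord0 i) = (fun x => h x ord0 i) %[ae leb in U].
Proof.
move=> lu lv uv wg wh i; have lg := wg.1 i; have lh := wh.1 i.
have /(fundamental_lemma oU (L2B mU lg lh)) :
    forall phi, test_fun U phi -> ip U (fun x => g x ord0 i - h x ord0 i) phi = 0.
  move=> phi tphi; have lphi := L2_test mU tphi.
  rewrite ipBl//; apply/eqP; rewrite subr_eq0 -eqr_opp.
  rewrite -(weak_grad_test i wg tphi) -(weak_grad_test i wh tphi); apply/eqP.
  by apply: ip_ae => //; [case: lu|case: lv|case: (L2_test mU (test_fun_partial i tphi))].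
by apply: filterS => x H /H /eqP; rewrite subr_eq0 => /eqP.
Qed.

Lemma gradP u g : weak_grad U u g -> weak_grad U u (grad U u).
Proof. by move=> wg; rewrite /grad; exact: (@xgetPex _ (fun=> 0) [set g | weak_grad U u g]) (ex_intro _ g wg). Qed.

(** The pairs (u, g) with u in H^1_0(U) and g a gradient of u, as graph limits
    of test functions; g is any representative, not only the one that [grad]
    chooses. *)
Definition test_limit u g : Prop :=
  [/\ L2 U u, L2grad U g & exists phi : nat -> E -> R,
    [/\ forall n, test_fun U (phi n), cvgL2 U phi u
      & forall i, cvgL2 U (fun n => partial i (phi n)) (fun x => g x ord0 i)]].

(** Integration by parts between H^1_0 and H^1: for test functions it is the
    definition of the weak gradient, and both sides pass to the limit. *)
Lemma test_limit_parts u g v h i : test_limit u g -> L2 U v -> weak_grad U v h ->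
  ip U u (fun x => h x ord0 i) = - ip U (fun x => g x ord0 i) v.
Proof.
move=> [lu lg [phi [tphi cphi cdphi]]] lv wh; have lh := wh.1 i.
have ltp n : L2 U (phi n) by exact: L2_test.
have ltd n : L2 U (partial i (phi n)) by apply: L2_test => //; exact: test_fun_partial.
have c1 := cvgL2_ip mU ltp lu lh cphi.
have c2 := cvgL2_ip mU ltd (lg i) lv (cdphi i).
have c3 : ip U (phi n) (fun x => h x ord0 i) @[n --> \oo] --> - ip U (fun x => g x ord0 i) v.
  apply: eq_cvgR (cvgN c2) => n.
  by rewrite /= ipC (weak_grad_test i wh (tphi n)) opprK ipC.
by rewrite -(cvg_lim (@Rhausdorff R) c1) -(cvg_lim (@Rhausdorff R) c3).
Qed.

Lemma test_weak_grad V psi : test_fun V psi ->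
  weak_grad U psi (fun x => \row_i partial i psi x).
Proof.
move=> tpsi; split=> [i|phi i tphi].
  under [X in L2 U X]eq_fun do rewrite mxE.
  by apply: L2_test => //; exact: test_fun_partial tpsi.
have t := test_funM tphi (test_fun_smooth tpsi).
have /eqP := integral_test_fun_partial i mU (@subset_refl _ U) t.
have -> : \int[leb]_(x in U) partial i (fun x => phi x * psi x) x =
    ip U (fun x => phi x) (partial i psi) + ip U (partial i phi) psi.
  rewrite -RintegralD//.
  - apply: eq_Rintegral => x _; rewrite partialM//.
      exact: smooth_derivable (test_fun_smooth tphi).
    exact: smooth_derivable (test_fun_smooth tpsi).
  - by apply: L2_integrable => //; [exact: L2_test tphi|exact: L2_test (test_fun_partial i tpsi)].
  - by apply: L2_integrable => //; [exact: L2_test (test_fun_partial i tphi)|exact: L2_test tpsi].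
rewrite addrC addr_eq0 => /eqP H.
rewrite -[LHS]/(ip U psi (partial i phi)) ipC H; congr (- _).
by rewrite ipC; apply: eq_Rintegral => x _; rewrite mxE.
Qed.

Lemma test_limit_weak_grad u g : test_limit u g -> weak_grad U u g.
Proof.
move=> tu; have [_ lg _] := tu; split => // phi i tphi.
have := test_limit_parts i tu (L2_test mU tphi) (test_weak_grad tphi).
rewrite /ip => <-; apply: eq_Rintegral => x _; by rewrite mxE.
Qed.

Lemma Rintegral_sum (I : Type) (s : seq I) (F : I -> E -> R) :
  (forall k, leb.-integrable U (EFin \o F k)) ->
  leb.-integrable U (EFin \o (fun x => \sum_(k <- s) F k x)) /\
  \int[leb]_(x in U) (\sum_(k <- s) F k x) = \sum_(k <- s) \int[leb]_(x in U) F k x.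
Proof.
move=> iF; elim: s => [|k s [IH1 IH2]].
  rewrite big_nil (_ : (fun x => _) = fun=> 0); last by apply/funext => x; rewrite big_nil.
  split; first exact: integrable0.
  by rewrite /Rintegral integral0_eq// => x _; rewrite big_nil.
rewrite (_ : (fun x => \sum_(j <- _) F j x) = (fun x => F k x + \sum_(j <- s) F j x)); last first.
  by apply/funext => x; rewrite big_cons.
split; last rewrite big_cons -IH2 -RintegralD//.
  by have := integrableD mU (iF k) IH1; apply: eq_integrable.
Qed.

(** The single limit in the definition of H^1_0 amounts to the L^2 convergence
    of the functions and of each partial derivative. *)
Lemma test_limit_cvg_energy u g (phi : nat -> E -> R) : L2 U u -> L2grad U g ->
  (forall n, test_fun U (phi n)) ->
  ((fun n => \int[leb]_(x in U) ((phi n x - u x) ^+ 2 +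
     \sum_(i < d) (partial i (phi n) x - g x ord0 i) ^+ 2)%:E)%E @ \oo --> 0%E) <->
  (cvgL2 U phi u /\
   forall i, cvgL2 U (fun n => partial i (phi n)) (fun x => g x ord0 i)).
Proof.
move=> lu lg tphi.
pose N0 n := ip U (fun x => phi n x - u x) (fun x => phi n x - u x).
pose N i n := ip U (fun x => partial i (phi n) x - g x ord0 i)
  (fun x => partial i (phi n) x - g x ord0 i).
have la n : L2 U (fun x => phi n x - u x) by apply: L2B => //; exact: L2_test.
have lb n i : L2 U (fun x => partial i (phi n) x - g x ord0 i).
  by apply: L2B => //; apply: L2_test => //; exact: test_fun_partial.
have -> : (fun n => \int[leb]_(x in U) ((phi n x - u x) ^+ 2 +
     \sum_(i < d) (partial i (phi n) x - g x ord0 i) ^+ 2)%:E)%E =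
   EFin \o (fun n => N0 n + \sum_i N i n).
  apply/funext => n /=.
  have i0 := L2_integrable mU (la n) (la n).
  have [i1 E1] := Rintegral_sum (index_enum 'I_d)
    (fun i => L2_integrable mU (lb n i) (lb n i)).
  rewrite /N0 /N /ip -E1 -RintegralD// fineK.
    by apply: eq_integral => x _; congr EFin; rewrite expr2; congr (_ + _);
      apply: eq_bigr => i _; rewrite expr2.
  by have := integrable_fin_num mU (integrableD mU i0 i1).
have N0ge n : 0 <= N0 n by exact: ip_ge0.
have Nge i n : 0 <= N i n by exact: ip_ge0.
split=> [/fine_cvgP[_ cv]|[c0 c1]].
  split=> [|i].
    apply: (@squeeze_cvgr _ _ _ _ (fun=> 0) (fun n => N0 n + \sum_i N i n)) => //.
      by apply: nearW => n; rewrite N0ge /= lerDl sumr_ge0.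
    exact: cvg_cst.
  apply: (@squeeze_cvgr _ _ _ _ (fun=> 0) (fun n => N0 n + \sum_i N i n)) => //.
    apply: nearW => n; rewrite Nge /= (bigD1 i)//= addrCA lerDl.
    by rewrite addr_ge0// sumr_ge0.
  exact: cvg_cst.
apply: cvg_EFin; first exact: nearW.
have := cvgD c0 (@cvg_sumR _ (index_enum 'I_d) N (fun=> 0) c1).
by rewrite (big1 (index_enum _))// addr0; exact.
Qed.

Lemma H10_test_limit u : H10 U u -> test_limit u (grad U u).
Proof.
move=> [[lu [g wg]] [phi [tphi cv]]]; have wG := gradP wg.
split => //; first exact: wG.1.
by have /(test_limit_cvg_energy lu wG.1 tphi)[c0 c1] := cv; exists phi.
Qed.

Lemma test_limit_ae u v g h : test_limit u g -> L2 U v -> u = v %[ae leb in U] ->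
  L2grad U h ->
  (forall i, (fun x => g x ord0 i) = (fun x => h x ord0 i) %[ae leb in U]) ->
  test_limit v h.
Proof.
move=> [lu lg [phi [tphi c0 c1]]] lv uv lh gh.
have key (un : nat -> E -> R) a b : (forall n, L2 U (un n)) -> L2 U a -> L2 U b ->
    a = b %[ae leb in U] -> cvgL2 U un a -> cvgL2 U un b.
  move=> lun la lb ab; apply: eq_cvgR => n.
  have l1 := L2B mU (lun n) la; have l2 := L2B mU (lun n) lb.
  have E1 : (fun x => un n x - a x) = (fun x => un n x - b x) %[ae leb in U].
    by apply: filterS ab => x H /H ->.
  rewrite (ip_ae mU _ _ _ E1); [|by case: l1|by case: l2|by case: l1].
  by rewrite ipC (ip_ae mU _ _ _ E1); [|by case: l1|by case: l2|by case: l2].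
split => //; exists phi; split => //.
  by apply: key c0 => // n; exact: L2_test.
move=> i; apply: key (c1 i) => // n.
by apply: L2_test => //; exact: test_fun_partial.
Qed.

(** The limit g is a weak gradient of u, so it agrees almost everywhere with
    the representative used in the definition of H^1_0. *)
Lemma test_limit_H10 u g : test_limit u g -> H10 U u.
Proof.
move=> tu; have wg := test_limit_weak_grad tu; have [lu lg _] := tu.
have wG := gradP wg.
have [_ _ [phi [tphi c0 c1]]] : test_limit u (grad U u).
  apply: (test_limit_ae tu lu _ wG.1); first by apply: aeW.
  by move=> i; apply: (weak_grad_unique lu lu _ wg wG); apply: aeW.
split; first by split => //; exists g.
by exists phi; split => //; apply/(test_limit_cvg_energy lu wG.1 tphi).
Qed.

Lemma test_limitD u v g h : test_limit u g -> test_limit v h ->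
  test_limit (fun x => u x + v x) (fun x => g x + h x).
Proof.
move=> [lu lg [phi [tphi c0 c1]]] [lv lh [psi [tpsi e0 e1]]].
have E1 i : (fun x => (g x + h x) ord0 i) = (fun x => g x ord0 i + h x ord0 i).
  by apply/funext => x; rewrite mxE.
split; [exact: L2D|by move=> i; rewrite E1; exact: L2D|].
exists (fun n x => phi n x + psi n x); split=> [n||i].
- exact: test_funD.
- by apply: cvgL2D => // n; exact: L2_test.
- rewrite E1 (_ : (fun n => _) = fun n x => partial i (phi n) x + partial i (psi n) x).
    by apply: cvgL2D => // n; apply: L2_test => //; exact: test_fun_partial.
  apply/funext => n; apply/funext => x; apply: partialD.
    exact: smooth_derivable (test_fun_smooth (tphi n)).
  exact: smooth_derivable (test_fun_smooth (tpsi n)).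
Qed.

Lemma test_limitZ (c : R) u g : test_limit u g ->
  test_limit (fun x => c * u x) (fun x => c *: g x).
Proof.
move=> [lu lg [phi [tphi c0 c1]]].
have E1 i : (fun x => (c *: g x) ord0 i) = (fun x => c * g x ord0 i).
  by apply/funext => x; rewrite mxE.
split; [exact: L2Z|by move=> i; rewrite E1; exact: L2Z|].
exists (fun n x => c * phi n x); split=> [n||i].
- exact: test_funZ.
- by apply: cvgL2Z => // n; exact: L2_test.
- rewrite E1 (_ : (fun n => _) = fun n x => c * partial i (phi n) x).
    by apply: cvgL2Z => // n; apply: L2_test => //; exact: test_fun_partial.
  apply/funext => n; apply/funext => x.
  by apply: deriveZ; exact: smooth_derivable (test_fun_smooth (tphi n)).
Qed.

Lemma test_limit0 : test_limit (fun=> 0) (fun=> 0).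
Proof.
have l0 : L2 U (fun=> 0) by exact: L2_0.
have E1 i : (fun x : E => (0 : E) ord0 i) = (fun=> 0) by apply/funext => x; rewrite mxE.
have z : cvgL2 U (fun=> fun=> 0) (fun=> 0).
  rewrite /cvgL2 (_ : (fun n => _) = fun=> 0); first exact: cvg_cst.
  by apply/funext => n; rewrite subr0 ip0l.
split => //; first by move=> i; rewrite E1.
exists (fun=> fun=> 0); split => //; first by move=> n; exact: test_fun0.
move=> i; rewrite E1 (_ : (fun n => _) = fun=> fun=> 0)//.
by apply/funext => n; apply/funext => x; exact: derive_cst.
Qed.

Lemma test_limit_sum (I : Type) (s : seq I) (F : I -> E -> R) (G : I -> E -> E) :
  (forall k, test_limit (F k) (G k)) ->
  test_limit (fun x => \sum_(k <- s) F k x) (fun x => \sum_(k <- s) G k x).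
Proof.
move=> tF; elim: s => [|k s IH].
  have := test_limit0; congr test_limit; apply/funext => x; by rewrite big_nil.
have := test_limitD (tF k) IH.
by congr test_limit; apply/funext => x; rewrite big_cons.
Qed.

(** Testing the weak gradient of u with x_i times the approximants of u gives
    int u^2 = - 2 int x_i u d_i u; no Poincare inequality is needed. *)
Lemma test_limit_grad0 u g : (0 < d)%N -> bounded_set U -> test_limit u g ->
  (forall i, (fun x => g x ord0 i) = (fun=> 0) %[ae leb in U]) ->
  u = (fun=> 0) %[ae leb in U].
Proof.
move=> d0 bU tu g0; have [lu lg [phi [tphi c0 c1]]] := tu.
have wg := test_limit_weak_grad tu.
pose i := Ordinal d0.
have [C C0 UC] : exists2 C, 0 < C & forall x, U x -> `|x ord0 i| <= C.
  have [C C0 HC] := ex_strict_bound_gt0 bU; exists C => // x /HC /= xC.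
  have /(ball_rVP _ _ C0)/(_ i) : ball (0 : E) C x.
    by rewrite mx_norm_ball /ball_ /= sub0r normrN.
  by rewrite mxE sub0r normrN => /ltW.
have mx : measurable_fun U (fun x : E => x ord0 i).
  by apply: measurable_funS (smooth_measurable (smooth_coord i)).
pose xu (x : E) := x ord0 i * u x; pose xg (x : E) := x ord0 i * g x ord0 i.
have lxu : L2 U xu by exact: (L2_bounded mU mx UC).
have lxg : L2 U xg by exact: (L2_bounded mU mx UC).
have ltp n : L2 U (phi n) by exact: L2_test.
have ltd n : L2 U (partial i (phi n)) by apply: L2_test => //; exact: test_fun_partial.
have k1 := cvgL2_ip mU ltp lu lu c0.
have k2 := cvgL2_ip mU ltd (lg i) lxu (c1 i).
have k3 := cvgL2_ip mU ltp lu lxg c0.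
have eqn n : ip U (phi n) u + ip U (partial i (phi n)) xu + ip U (phi n) xg = 0.
  have t := test_funM (tphi n) (smooth_coord i).
  have := weak_grad_test i wg t.
  have -> : partial i (fun x : E => phi n x * x ord0 i) =
      (fun x : E => phi n x + x ord0 i * partial i (phi n) x).
    apply/funext => x; rewrite partialM; last 2 first.
    - exact: smooth_derivable (test_fun_smooth (tphi n)).
    - exact: smooth_derivable (smooth_coord i).
    have := is_derive_affine (delta_mx ord0 i) 0 i x.
    rewrite (_ : (fun x => _) = (fun x : E => x ord0 i)); last first.
      by apply/funext => y; rewrite dotp_delta addr0.
    by move=> [_ D]; rewrite /partial D mxE !eqxx mulr1 [_ * x _ _]mulrC.
  have -> : ip U u (fun x : E => phi n x + x ord0 i * partial i (phi n) x) =
      ip U (phi n) u + ip U (partial i (phi n)) xu.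
    rewrite ipDr//; last exact: (L2_bounded mU mx UC).
    rewrite ipC; congr (_ + _); apply: eq_Rintegral => x _; rewrite /xu; ring.
  have -> : ip U (fun x => g x ord0 i) (fun x : E => phi n x * x ord0 i) = ip U (phi n) xg.
    by apply: eq_Rintegral => x _; rewrite /xg; ring.
  by move=> ->; rewrite addNr.
have lim0 : ip U u u + ip U (fun x => g x ord0 i) xu + ip U u xg = 0.
  have h : (0 : R) @[n --> \oo] -->
      ip U u u + ip U (fun x => g x ord0 i) xu + ip U u xg.
    by apply: (eq_cvgR eqn); exact: (cvgD (cvgD k1 k2) k3).
  by rewrite -(cvg_lim (@Rhausdorff R) h) lim_cst.
apply: (ip_eq0 mU lu); move: lim0.
have mg : measurable_fun U (fun x => g x ord0 i) by case: (lg i).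
rewrite (ip_ae mU mg _ _ (g0 i)); [|exact: measurable_cst|by case: lxu].
rewrite ip0l addr0 (ipC U u xg).
have xg0 : xg = (fun=> 0) %[ae leb in U].
  by apply: filterS (g0 i) => x H /H h; rewrite /xg h mulr0.
rewrite (ip_ae mU _ _ _ xg0); [|by case: lxg|exact: measurable_cst|by case: lu].
by rewrite ip0l addr0.
Qed.

End domain.

(** The test functions that approximate u on U are test functions on V that
    vanish outside U. *)
Lemma test_limit_extend U V u g : open U -> open V -> U `<=` V ->
  test_limit U u g -> (forall x, ~ U x -> u x = 0) ->
  test_limit V u (fun x => \1_U x *: g x).
Proof.
move=> oU oV UV [lu lg [phi [tphi c0 c1]]] u0.
have mU := open_measurable_rV oU; have mV := open_measurable_rV oV.
have lext w : L2 U w -> L2 V (fun x => \1_U x * w x).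
  move=> lw.
  have E1 : (fun x => \1_U x * w x) = w \_ U.
    apply/funext => x; rewrite patchE indicE; case: ifPn => _; first by rewrite mul1r.
    by rewrite mul0r.
  rewrite E1; split.
    apply: (measurable_funS measurableT) => //.
    by apply/(measurable_restrictT _ mU); case: lw.
  case: lw => _; apply: le_lt_trans.
  rewrite [leLHS]integral_mkcond [leRHS]integral_mkcond le_eqVlt; apply/orP; left.
  apply/eqP; apply: eq_integral => x _; rewrite !patchE.
  case: ifPn => [xV|nxV]; case: ifPn => [xU|nxU] //; first by rewrite expr0n.
  by move/negP: nxV; case; rewrite inE; apply: UV; exact: set_mem.
have cext (un : nat -> E -> R) w : (forall n x, ~ U x -> un n x = 0) ->
    cvgL2 U un w -> cvgL2 V un (fun x => \1_U x * w x).
  move=> un0; apply: eq_cvgR => n; apply/esym.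
  rewrite (ip_supported _ UV); last first.
    by move=> x nx; rewrite un0// indicE memNset// mul0r subr0.
  by apply: eq_Rintegral => x xU; rewrite indicE xU mul1r.
have uE : (fun x => \1_U x * u x) = u.
  apply/funext => x; rewrite indicE; have [/= xU|nxU] := boolP (x \in U); first by rewrite mul1r.
  by rewrite mul0r u0//; move/negP: nxU; rewrite inE.
have gE i : (fun x => (\1_U x *: g x) ord0 i) = (fun x => \1_U x * g x ord0 i).
  by apply/funext => x; rewrite mxE.
split; [by rewrite -uE; exact: lext|by move=> i; rewrite gE; exact: lext|].
exists phi; split=> [n||i]; first exact: test_fun_subset UV (tphi n).
  by rewrite -uE; apply: cext => // n x; exact: test_fun_out.
by rewrite gE; apply: cext => // n x; apply: test_fun_out; exact: test_fun_partial.
Qed.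

End sobolev.

(** * The form a(u, v) *)

Section bilinear_form.
Context {R : realType} {d : nat}.
Local Notation E := 'rV[R]_d.
Local Notation leb := (@lebesgue_rV R d).
Implicit Types (U V : set E) (u v w : E -> R) (g h : E -> E) (i : 'I_d).
Variables (m : R) (b : E).

(** The form a(u, v) with gradients g of u and h of v passed explicitly; u
    itself enters only through g. *)
Definition bil U g v h : R :=
  m * (\sum_i ip U (fun x => g x ord0 i) (fun x => h x ord0 i)) +
  \sum_i b ord0 i * ip U v (fun x => g x ord0 i).

Lemma bil_shrinkl U V g v h : U `<=` V -> (forall x, ~ U x -> g x = 0) ->
  bil V g v h = bil U g v h.
Proof.
move=> UV g0; rewrite /bil; congr (_ * _ + _); apply: eq_bigr => i _.
  rewrite !(ipC _ _ (fun x => h x ord0 i)); apply: ip_supported => // x /g0 ->.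
  by rewrite mxE.
by congr (_ * _); apply: ip_supported => // x /g0 ->; rewrite mxE.
Qed.

Lemma bil_shrinkr U V g v h : U `<=` V -> (forall x, ~ U x -> v x = 0) ->
  (forall x, ~ U x -> h x = 0) -> bil V g v h = bil U g v h.
Proof.
move=> UV v0 h0; rewrite /bil; congr (_ * _ + _); apply: eq_bigr => i _.
  by apply: ip_supported => // x /h0 ->; rewrite mxE.
by congr (_ * _); rewrite !(ipC _ v); apply: ip_supported.
Qed.

Lemma eq_bil U g v h g' v' h' : (forall x, U x -> g x = g' x) ->
  (forall x, U x -> v x = v' x) -> (forall x, U x -> h x = h' x) ->
  bil U g v h = bil U g' v' h'.
Proof.
move=> gg vv hh; rewrite /bil; congr (_ * _ + _); apply: eq_bigr => i _.
  by apply: eq_Rintegral => x /set_mem Ux; rewrite gg// hh.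
by congr (_ * _); apply: eq_Rintegral => x /set_mem Ux; rewrite gg// vv.
Qed.

Section domain.
Variable U : set E.
Hypothesis oU : open U.
Let mU : measurable U := open_measurable_rV oU.

Lemma bil_integral g v h : L2grad U g -> L2 U v -> L2grad U h ->
  leb.-integrable U (EFin \o (fun x => m * dotp (g x) (h x) + v x * dotp b (g x))) /\
  \int[leb]_(x in U) (m * dotp (g x) (h x) + v x * dotp b (g x)) = bil U g v h.
Proof.
move=> lg lv lh.
have [i1 E1] := Rintegral_sum oU (index_enum 'I_d)
  (fun i => L2_integrable mU (L2Z mU m (lg i)) (lh i)).
have [i2 E2] := Rintegral_sum oU (index_enum 'I_d)
  (fun i => L2_integrable mU lv (L2Z mU (b ord0 i) (lg i))).
have F x : m * dotp (g x) (h x) + v x * dotp b (g x) =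
    \sum_i (m * g x ord0 i) * h x ord0 i + \sum_i v x * (b ord0 i * g x ord0 i).
  by rewrite /dotp !mulr_sumr; congr (_ + _); apply: eq_bigr => i _; rewrite mulrA.
split.
  by have := integrableD mU i1 i2; apply: eq_integrable => // x _ /=; rewrite F EFinD.
under eq_Rintegral do rewrite F.
rewrite RintegralD// E1 E2 /bil mulr_sumr; congr (_ + _); apply: eq_bigr => i _.
  by rewrite -ipZl.
by rewrite -ipZr.
Qed.

Lemma bilDl g g' v h : L2grad U g -> L2grad U g' -> L2 U v -> L2grad U h ->
  bil U (fun x => g x + g' x) v h = bil U g v h + bil U g' v h.
Proof.
move=> lg lg' lv lh; rewrite /bil addrACA -mulrDr -!big_split /=.
congr (_ * _ + _); apply: eq_bigr => i _.
  by rewrite -ipDl//; congr ip; apply/funext => x; rewrite mxE.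
by rewrite -mulrDr -ipDr//; congr (_ * ip _ _ _); apply/funext => x; rewrite mxE.
Qed.

Lemma bilZl c g v h : L2grad U g -> L2 U v -> L2grad U h ->
  bil U (fun x => c *: g x) v h = c * bil U g v h.
Proof.
move=> lg lv lh; rewrite /bil mulrDr !mulr_sumr.
congr (_ + _); apply: eq_bigr => i _.
  by rewrite [RHS]mulrCA -(ipZl mU c)//; congr (_ * ip _ _ _); apply/funext => x; rewrite mxE.
by rewrite [RHS]mulrCA -(ipZr mU c)//; congr (_ * ip _ _ _); apply/funext => x; rewrite mxE.
Qed.

Lemma bilDr g v v' h h' : L2grad U g -> L2 U v -> L2 U v' -> L2grad U h ->
  L2grad U h' ->
  bil U g (fun x => v x + v' x) (fun x => h x + h' x) = bil U g v h + bil U g v' h'.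
Proof.
move=> lg lv lv' lh lh'; rewrite /bil addrACA -mulrDr -!big_split /=.
congr (_ * _ + _); apply: eq_bigr => i _.
  by rewrite -ipDr//; congr ip; apply/funext => x; rewrite mxE.
by rewrite -mulrDr -ipDl//.
Qed.

Lemma bilZr c g v h : L2grad U g -> L2 U v -> L2grad U h ->
  bil U g (fun x => c * v x) (fun x => c *: h x) = c * bil U g v h.
Proof.
move=> lg lv lh; rewrite /bil mulrDr !mulr_sumr.
congr (_ + _); apply: eq_bigr => i _.
  by rewrite [RHS]mulrCA -(ipZr mU c)//; congr (_ * ip _ _ _); apply/funext => x; rewrite mxE.
by rewrite [RHS]mulrCA -(ipZl mU c)//.
Qed.

Lemma L2gradD g h : L2grad U g -> L2grad U h -> L2grad U (fun x => g x + h x).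
Proof.
move=> lg lh i; have := L2D mU (lg i) (lh i).
by congr L2; apply/funext => x; rewrite mxE.
Qed.

Lemma L2gradZ c g : L2grad U g -> L2grad U (fun x => c *: g x).
Proof.
move=> lg i; have := L2Z mU c (lg i).
by congr L2; apply/funext => x; rewrite mxE.
Qed.

Lemma bilinE u v g h : L2 U u -> L2 U v -> weak_grad U u g -> weak_grad U v h ->
  bilin m b U u v = bil U g v h.
Proof.
move=> lu lv wg wh; have wG := gradP wg; have wH := gradP wh.
have EG i := weak_grad_unique oU lu lu (aeW _ (fun x _ => erefl)) wG wg i.
have EH i := weak_grad_unique oU lv lv (aeW _ (fun x _ => erefl)) wH wh i.
rewrite /bilin (bil_integral wG.1 lv wH.1).2 /bil.
have mg i : measurable_fun U (fun x => g x ord0 i) by case: (wg.1 i).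
have mh i : measurable_fun U (fun x => h x ord0 i) by case: (wh.1 i).
have mG i : measurable_fun U (fun x => grad U u x ord0 i) by case: (wG.1 i).
have mH i : measurable_fun U (fun x => grad U v x ord0 i) by case: (wH.1 i).
have mv : measurable_fun U v by case: lv.
congr (_ * _ + _); apply: eq_bigr => i _.
  by rewrite (ip_ae mU _ _ _ (EG i))// ipC (ip_ae mU _ _ _ (EH i))// ipC.
by rewrite ipC (ip_ae mU _ _ _ (EG i))// ipC.
Qed.

(** Since b is constant, b . grad is skew-symmetric on H^1_0. *)
Lemma bil_diag u g : test_limit U u g ->
  bil U g u g = m * \sum_i ip U (fun x => g x ord0 i) (fun x => g x ord0 i).
Proof.
move=> tu; have [lu lg _] := tu; rewrite /bil [X in _ + X]big1 ?addr0// => i _.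
have H := test_limit_parts oU i tu lu (test_limit_weak_grad oU tu).
have E1 := ipC U u (fun x => g x ord0 i).
have -> : ip U u (fun x => g x ord0 i) = 0 by lra.
by rewrite mulr0.
Qed.

Lemma bil_coercive u g : 0 < m -> (0 < d)%N -> bounded_set U -> test_limit U u g ->
  bil U g u g <= 0 ->
  u = (fun=> 0) %[ae leb in U] /\
  forall i, (fun x => g x ord0 i) = (fun=> 0) %[ae leb in U].
Proof.
move=> m0 d0 bU tu; rewrite (bil_diag tu) pmulr_rle0// => le0.
have [lu lg _] := tu.
have S0 : \sum_i ip U (fun x => g x ord0 i) (fun x => g x ord0 i) = 0.
  by apply/eqP; rewrite eq_le le0 sumr_ge0// => i _; exact: ip_ge0.
have g0 i : (fun x => g x ord0 i) = (fun=> 0) %[ae leb in U].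
  apply: ip_eq0 => //; have /eqP := S0.
  rewrite psumr_eq0 => [/allP/(_ i)|j _]; last exact: ip_ge0.
  by rewrite mem_index_enum => /(_ isT)/eqP.
by split => //; exact: (test_limit_grad0 oU d0 bU tu).
Qed.

Lemma L2_cst_bounded (c : R) : bounded_set U -> L2 U (fun=> c).
Proof.
move=> bU; split; first exact: measurable_cst.
rewrite integral_cst// lte_mul_pinfty ?lee_fin ?sqr_ge0//.
exact: lebesgue_rV_bounded.
Qed.

Lemma bounded_coord i : bounded_set U ->
  exists C, forall x, U x -> `|x ord0 i| <= C.
Proof.
move=> bU; have [C C0 HC] := ex_strict_bound_gt0 bU; exists C => x /HC /= xC.
have /(ball_rVP _ _ C0)/(_ i) : ball (0 : E) C x.
  by rewrite mx_norm_ball /ball_ /= sub0r normrN.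
by rewrite mxE sub0r normrN => /ltW.
Qed.

Lemma L2_affine (p : E) (c : R) : bounded_set U -> L2 U (fun x => dotp p x + c).
Proof.
move=> bU; apply: L2D => //; last exact: L2_cst_bounded.
apply: L2_sum => // i _; apply: L2Z => //.
have [C HC] := bounded_coord i bU.
have := @L2_bounded _ _ _ mU C (fun x => x ord0 i) (fun=> 1) _ HC (L2_cst_bounded 1 bU).
rewrite (_ : (fun x : E => x ord0 i * 1) = (fun x : E => x ord0 i)).
  by apply; apply: measurable_funS (smooth_measurable (smooth_coord i)).
by apply/funext => x; rewrite mulr1.
Qed.

Lemma weak_grad_affine u (p : E) (c : R) : bounded_set U ->
  (forall x, U x -> u x = dotp p x + c) -> weak_grad U u (fun=> p).
Proof.
move=> bU up; split=> [i|phi i tphi]; first exact: L2_cst_bounded.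
have t := test_funM tphi (smooth_affine p c).
have /eqP := integral_test_fun_partial i mU (@subset_refl _ U) t.
have laff := L2_affine p c bU.
have -> : \int[leb]_(x in U) partial i (fun x => phi x * (dotp p x + c)) x =
    ip U phi (fun=> p ord0 i) + ip U (partial i phi) (fun x => dotp p x + c).
  rewrite -RintegralD//.
  - apply: eq_Rintegral => x _; rewrite partialM//.
    + by congr (_ * _ + _); have [_] := is_derive_affine p c i x.
    + exact: smooth_derivable (test_fun_smooth tphi).
    + exact: smooth_derivable (smooth_affine p c).
  - by apply: L2_integrable => //; [exact: L2_test tphi|exact: L2_cst_bounded].
  - by apply: L2_integrable => //; exact: L2_test (test_fun_partial i tphi).
rewrite addrC addr_eq0 => /eqP H.
rewrite -[X in _ = - X]/(ip U (fun=> p ord0 i) phi) ipC -H ipC.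
by apply: eq_Rintegral => x /set_mem Ux; rewrite up.
Qed.

Lemma L2_affine_on u (p : E) (c : R) : bounded_set U ->
  (forall x, U x -> u x = dotp p x + c) -> L2 U u.
Proof.
move=> bU up; have [ma la] := L2_affine p c bU; split.
  by apply: eq_measurable_fun ma => x /set_mem Ux; rewrite up.
by apply: le_lt_trans la; rewrite le_eqVlt; apply/orP; left; apply/eqP;
  apply: eq_integral => x /set_mem Ux; rewrite up.
Qed.

(** Integration by parts against a constant. *)
Lemma test_limit_grad_mean v h i (c : R) : bounded_set U -> test_limit U v h ->
  ip U (fun x => h x ord0 i) (fun=> c) = 0.
Proof.
move=> bU tv; have wc : weak_grad U (fun=> c) (fun=> 0).
  by apply: (@weak_grad_affine _ 0 c bU) => x _; rewrite dotp0 add0r.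
have := test_limit_parts oU i tv (L2_cst_bounded c bU) wc.
rewrite (_ : (fun x : E => (0 : E) ord0 i) = fun=> 0); last by apply/funext => x; rewrite mxE.
by rewrite ipC ip0l => /eqP; rewrite eq_sym oppr_eq0 => /eqP.
Qed.

(** The diffusion term vanishes because the gradient of v has mean zero. *)
Lemma bil_cstl (p : E) v h : bounded_set U -> test_limit U v h ->
  bil U (fun=> p) v h = dotp b p * ip U v (fun=> 1).
Proof.
move=> bU tv; have [lv lh _] := tv; rewrite /bil [X in m * X]big1 ?mulr0 ?add0r.
  rewrite /dotp mulr_suml; apply: eq_bigr => i _; rewrite -mulrA; congr (_ * _).
  rewrite -ipZr//; last exact: L2_cst_bounded.
  by congr ip; apply/funext => x; rewrite mulr1.
by move=> i _; rewrite ipC; exact: (test_limit_grad_mean _ _ bU tv).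
Qed.

(** The diffusion term vanishes as in [bil_cstl], and the transport term is
    integrated by parts. *)
Lemma bil_cstr (p : E) u g v : bounded_set U -> test_limit U u g -> L2 U v ->
  weak_grad U v (fun=> p) ->
  bil U g v (fun=> p) = - dotp b p * ip U u (fun=> 1).
Proof.
move=> bU tu lv wv; have [lu lg _] := tu; rewrite /bil [X in m * X]big1 ?mulr0 ?add0r.
  rewrite /dotp -sumrN mulr_suml; apply: eq_bigr => i _.
  rewrite mulNr -mulrA -mulrN; congr (_ * _).
  rewrite -ipZr//; last exact: L2_cst_bounded.
  have := test_limit_parts oU i tu lv wv; rewrite ipC => H.
  rewrite ipC; apply/eqP; rewrite -eqr_oppLR -H ipC; apply/eqP.
  by congr ip; apply/funext => x; rewrite mulr1.
by move=> i _; exact: (test_limit_grad_mean _ _ bU tu).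
Qed.

Lemma ip_cst1 v : ip U v (fun=> 1) = \int[leb]_(x in U) v x.
Proof. by apply: eq_Rintegral => x _; rewrite mulr1. Qed.

(** The difference z = w - k Bu satisfies a(z, z) = 0. *)
Lemma weak_sol_unique (Bu w : E -> R) (k : R) : 0 < m -> (0 < d)%N -> bounded_set U ->
  H10 U Bu -> weak_sol m b U Bu (fun v => \int[leb]_(x in U) v x) ->
  H10 U w -> weak_sol m b U w (fun v => k * \int[leb]_(x in U) v x) ->
  w = (fun x => k * Bu x) %[ae leb in U].
Proof.
move=> m0 d0 bU hB sB hw sw.
have tB := H10_test_limit oU hB; have tw := H10_test_limit oU hw.
have tz := test_limitD oU tw (test_limitZ oU (- k) tB).
have hz := test_limit_H10 oU tz.
have [lB gB _] := tB; have [lw gw _] := tw; have [lz gz _] := tz.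
have wB := test_limit_weak_grad oU tB; have ww := test_limit_weak_grad oU tw.
have wz := test_limit_weak_grad oU tz.
have a1 := sB _ hz; have a2 := sw _ hz.
rewrite (bilinE lB lz wB wz) in a1; rewrite (bilinE lw lz ww wz) in a2.
have [] := bil_coercive m0 d0 bU tz.
  rewrite bilDl//; last exact: L2gradZ.
  by rewrite bilZl// a1 a2 mulNr subrr.
by move=> z0 _; apply: filterS z0 => x H /H; rewrite mulNr => /eqP; rewrite subr_eq0 => /eqP.
Qed.

End domain.
End bilinear_form.

(** * Simplices *)

Section simplex.
Context {R : realType} {d : nat}.
Local Notation E := 'rV[R]_d.
Local Notation leb := (@lebesgue_rV R d).
Implicit Types (p : 'I_d.+1 -> E) (x : E).

Lemma dotpDr (q x y : E) : dotp q (x + y) = dotp q x + dotp q y.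
Proof. by rewrite /dotp -big_split; apply: eq_bigr => i _; rewrite mxE mulrDr. Qed.

Lemma dotpDl (q q' x : E) : dotp (q + q') x = dotp q x + dotp q' x.
Proof. by rewrite /dotp -big_split; apply: eq_bigr => i _; rewrite mxE mulrDl. Qed.

Lemma dotpZr (c : R) (q x : E) : dotp q (c *: x) = c * dotp q x.
Proof. by rewrite /dotp mulr_sumr; apply: eq_bigr => i _; rewrite mxE mulrCA. Qed.

Lemma dotp0r (q : E) : dotp q 0 = 0.
Proof. by rewrite /dotp big1// => i _; rewrite mxE mulr0. Qed.

Lemma dotp_sumr (I : Type) (s : seq I) (P : pred I) (q : E) (F : I -> E) :
  dotp q (\sum_(k <- s | P k) F k) = \sum_(k <- s | P k) dotp q (F k).
Proof. by apply: (big_morph (dotp q)); [exact: dotpDr|exact: dotp0r]. Qed.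

Lemma dotp_suml (I : Type) (s : seq I) (P : pred I) (F : I -> E) (x : E) :
  dotp (\sum_(k <- s | P k) F k) x = \sum_(k <- s | P k) dotp (F k) x.
Proof.
by apply: (big_morph (fun q => dotp q x)) => [q q'|]; [exact: dotpDl|exact: dotp0].
Qed.

Lemma affine_combination (I : finType) (t : I -> R) (y : I -> E) (q : E) (c : R) :
  \sum_i t i = 1 ->
  dotp q (\sum_i t i *: y i) + c = \sum_i t i * (dotp q (y i) + c).
Proof.
move=> t1; rewrite dotp_sumr -[X in _ + X]mul1r -t1 mulr_suml -big_split.
by apply: eq_bigr => i _; rewrite dotpZr mulrDr.
Qed.

(** The columns of the inverse of the matrix of edges issued from p 0 are the
    gradients of the barycentric coordinates of the other vertices. *)
Lemma barycentric p : Defs.nondegenerate p -> exists (q : 'I_d.+1 -> E) (c : 'I_d.+1 -> R),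
  [/\ forall k j, dotp (q k) (p j) + c k = (k == j)%:R,
     forall x, \sum_k (dotp (q k) x + c k) = 1
   & forall x, x = \sum_k (dotp (q k) x + c k) *: p k].
Proof.
rewrite /Defs.nondegenerate row_free_unit; set A := \matrix_(i < d) _ => uA.
pose r (i : 'I_d) : E := \row_j invmx A j i.
have rE i x : dotp (r i) x = (x *m invmx A) ord0 i.
  by rewrite mxE; apply: eq_bigr => j _; rewrite mxE mulrC.
pose q k := if unlift ord0 k is Some i then r i else - \sum_i r i.
pose c k := if unlift ord0 k is Some i then - dotp (r i) (p ord0)
            else 1 + \sum_i dotp (r i) (p ord0).
have qS i x : dotp (q (lift ord0 i)) x + c (lift ord0 i) = ((x - p ord0) *m invmx A) ord0 i.
  by rewrite /q /c liftK !rE mulmxBl !mxE.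
have q0 x : dotp (q ord0) x + c ord0 = 1 - \sum_i ((x - p ord0) *m invmx A) ord0 i.
  rewrite /q /c unlift_none dotpNl dotp_suml addrCA; congr (_ + _).
  rewrite -sumrN -big_split -sumrN; apply: eq_bigr => i _ /=.
  by rewrite !rE mulmxBl !mxE opprB addrC.
have S1 x : \sum_k (dotp (q k) x + c k) = 1.
  rewrite big_ord_recl q0 [X in _ + X](eq_bigr (fun i => ((x - p ord0) *m invmx A) ord0 i)).
    by rewrite subrK.
  by move=> i _; exact: qS.
have pA i : (p (lift ord0 i) - p ord0) *m invmx A = delta_mx ord0 i.
  have -> : p (lift ord0 i) - p ord0 = row i A by rewrite rowK.
  by rewrite -row_mul mulmxV// row1.
exists q, c; split => // [k j|x].
  have [i|] := unliftP ord0 k => ->; have [l|] := unliftP ord0 j => ->.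
  - by rewrite qS pA mxE eqxx /= (inj_eq lift_inj) eq_sym.
  - by rewrite qS subrr mul0mx mxE.
  - rewrite q0 pA (bigD1 l)//= big1 ?addr0 ?mxE ?eqxx ?subrr//.
    by move=> i il; rewrite mxE (negPf il) andbF.
  - by rewrite q0 subrr mul0mx big1 ?subr0// => i _; rewrite mxE.
rewrite big_ord_recl q0.
rewrite [X in _ = _ + X](eq_bigr (fun i => ((x - p ord0) *m invmx A) ord0 i *: p (lift ord0 i))); last first.
  by move=> i _; congr (_ *: _); exact: qS.
set y := (x - p ord0) *m invmx A.
have -> : \sum_(i < d) y ord0 i *: p (lift ord0 i) =
    y *m A + (\sum_i y ord0 i) *: p ord0.
  rewrite mulmx_sum_row scaler_suml -big_split; apply: eq_bigr => i _ /=.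
  by rewrite rowK scalerBr subrK.
by rewrite /y mulmxKV// scalerBl scale1r addrACA [- _ + _]addrC subrr addr0 addrC subrK.
Qed.

Lemma vertex_hull p k : hull p predT (p k).
Proof.
exists (fun j => (j == k)%:R); split => [j||]; first exact: ler0n.
  by rewrite (bigD1 k)//= eqxx big1 ?addr0// => j /negPf ->.
rewrite (bigD1 k)//= eqxx scale1r big1 ?addr0// => j /negPf ->.
by rewrite scale0r.
Qed.

Lemma affine_on_hull_eq0 p (v : E -> R) q : affine_on (hull p predT) v q ->
  (forall k, v (p k) = 0) -> forall x, hull p predT x -> v x = 0.
Proof.
move=> [c vq] v0 x hx; rewrite vq//; have [t [_ t1 ->]] := hx.
rewrite affine_combination// big1// => k _.
by rewrite -vq ?v0 ?mulr0//; exact: vertex_hull.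
Qed.

(** Writing x in barycentric coordinates, the difference of the two affine
    expressions vanishes everywhere and not only on the simplex. *)
Lemma affine_on_unique p (v : E -> R) q q' : Defs.nondegenerate p ->
  affine_on (hull p predT) v q -> affine_on (hull p predT) v q' -> q = q'.
Proof.
move=> /barycentric[l [e [_ S1 xE]]] [c vq] [c' vq'].
have H x : dotp (q - q') x + (c - c') = 0.
  rewrite {1}(xE x) affine_combination// big1// => k _.
  have hk := vertex_hull p k.
  have := vq _ hk; rewrite vq'// => h.
  have -> : dotp (q - q') (p k) + (c - c') = 0 by rewrite dotpDl dotpNl; lra.
  by rewrite mulr0.
have H0 x : dotp (q - q') x = 0.
  by have := H x; have := H 0; rewrite dotp0r add0r => ->; rewrite addr0.
apply/eqP; rewrite -subr_eq0; apply/eqP/rowP => i; rewrite [RHS]mxE.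
have := H0 (delta_mx ord0 i); rewrite /dotp (bigD1 i)//= [X in _ * X]mxE !eqxx mulr1 big1 ?addr0//.
by move=> j ji; rewrite [X in _ * X]mxE (negPf ji) andbF mulr0.
Qed.

(** A point of the simplex that avoids the hyperplanes where a barycentric
    coordinate vanishes has positive coordinates, which is an open condition. *)
Lemma simplex_boundary_null p : (0 < d)%N -> Defs.nondegenerate p ->
  \forall x \ae leb, hull p predT x -> (hull p predT)° x.
Proof.
move=> d0 /barycentric[q [c [qp S1 xE]]].
have q0 k : q k != 0.
  have [j kj] : exists j : 'I_d.+1, k != j.
    have [k0|k0] := eqVneq k ord0; last by exists ord0.
    by exists (lift ord0 (Ordinal d0)); rewrite k0 neq_lift.
  apply/eqP => qk; have := qp k j; have := qp k k.
  by rewrite qk !dotp0 !add0r eqxx (negPf kj) => -> /eqP; rewrite oner_eq0.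
have H k : \forall x \ae leb, dotp (q k) x + c k != 0.
  exists [set x | dotp (q k) x = - c k]; split.
  - exact: measurable_hyperplane.
  - exact: lebesgue_rV_hyperplane.
  - by move=> x /= /negP; rewrite negbK addr_eq0 => /eqP.
have HA : \forall x \ae leb, forall k, dotp (q k) x + c k != 0 by apply: filter_forall.
apply: filterS HA => x xn0 hx.
have : (halfspaces [seq (q k, c k) | k <- enum 'I_d.+1]) x.
  move=> _ /mapP[k _ ->] /=; rewrite lt_neqAle eq_sym xn0 /=.
  have [t [t0 t1 ->]] := hx; rewrite affine_combination//.
  by rewrite sumr_ge0// => j _; rewrite mulr_ge0// qp ler0n.
have oH := @open_halfspaces R d [seq (q k, c k) | k <- enum 'I_d.+1].
move=> Hx; apply: (@interiorS _ (halfspaces [seq (q k, c k) | k <- enum 'I_d.+1])); last first.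
  by rewrite (interior_id _).1.
move=> y Hy; exists (fun k => dotp (q k) y + c k); split => // k.
by apply/ltW/(Hy (q k, c k)); apply: map_f; rewrite mem_enum.
Qed.

End simplex.

(** * The mesh and its piecewise affine functions *)

Section mesh.
Context {R : realType} {d : nat}.
Local Notation E := 'rV[R]_d.
Local Notation leb := (@lebesgue_rV R d).
Context (hd : (0 < d)%N) (Omega : set E) (hOmega : open_polytope Omega).
Context (T : finType) (vtx : T -> 'I_d.+1 -> E) (hmesh : conforming_mesh vtx Omega).
Implicit Types (K L : T) (v w : E -> R).
Local Notation elt := (elt vtx).
Local Notation cell := (cell vtx).
Local Notation P1 := (P1 vtx Omega).
Local Notation cell_grad := (cell_grad vtx).
Local Notation pwconst := (pwconst vtx).

Lemma Omega_open : open Omega. Proof. by case: hOmega. Qed.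

Lemma Omega_bounded : bounded_set Omega. Proof. by case: hOmega. Qed.

Lemma Omega_measurable : measurable Omega.
Proof. exact: (open_measurable_rV Omega_open). Qed.

Lemma cell_closure K : cell K `<=` closure Omega.
Proof. by case: hmesh => _ -> _ _ x Kx; exists K. Qed.

Lemma elt_Omega K : elt K `<=` Omega.
Proof.
by case: hOmega => _ _ <- _; apply: interiorS; exact: cell_closure.
Qed.

Lemma elt_cell K : elt K `<=` cell K.
Proof. exact: interior_subset. Qed.

Lemma elt_open K : open (elt K). Proof. exact: open_interior. Qed.

Lemma elt_measurable K : measurable (elt K).
Proof. by apply: open_measurable_rV; exact: elt_open. Qed.

Lemma elt_bounded K : bounded_set (elt K).
Proof.
have [M [rM HM]] := Omega_bounded; exists M; split => // y My x /elt_Omega.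
exact: HM.
Qed.

Lemma elt_disjoint K L x : elt K x -> elt L x -> K = L.
Proof.
move=> Kx Lx; apply/eqP; apply: contraT => KL.
have [_ _ /(_ K L KL) H _] := hmesh.
by have : (elt K `&` elt L) x by []; rewrite H.
Qed.

Lemma closure_Omega x : closure Omega x -> Omega x \/ bdry Omega x.
Proof.
move=> cx; have [|nx] := pselect (Omega x); [by left|right; split => //].
by rewrite (interior_id _).1//; exact: Omega_open.
Qed.

Lemma ae_elt : \forall x \ae leb, Omega x -> exists K, elt K x.
Proof.
have [nd cE _ _] := hmesh.
have H : \forall x \ae leb, forall K, cell K x -> elt K x.
  by apply: filter_forall => K; apply: simplex_boundary_null.
apply: filterS H => x H Ox; have : closure Omega x by exact: subset_closure.
by rewrite cE => -[K _ /H]; exists K.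
Qed.

Lemma ae_on_elts (u v : E -> R) : (forall K, u = v %[ae leb in elt K]) ->
  u = v %[ae leb in Omega].
Proof.
move=> H; have HA : \forall x \ae leb, forall K, elt K x -> u x = v x by apply: filter_forall.
by apply: filterS2 ae_elt HA => x H1 H2 /H1[K /H2].
Qed.

Lemma pwconst_in (c : T -> R) K x : elt K x -> pwconst c x = c K.
Proof.
move=> Kx; rewrite /pwconst (bigD1 K)//= indicE mem_set// mulr1 big1 ?addr0// => L LK.
rewrite indicE memNset ?mulr0// => Lx.
by move/eqP: LK; apply; exact: elt_disjoint Lx Kx.
Qed.

Lemma pwconst_out (c : T -> R) x : (forall K, ~ elt K x) -> pwconst c x = 0.
Proof. by move=> nx; rewrite /pwconst big1// => K _; rewrite indicE memNset ?mulr0. Qed.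

Lemma L2_indic K : L2 Omega (\1_(elt K) : E -> R).
Proof.
have := @L2_bounded _ _ _ Omega_measurable 1 (\1_(elt K)) (fun=> 1) _ _
  (L2_cst_bounded Omega_open 1 Omega_bounded).
rewrite (_ : (fun x : E => \1_(elt K) x * 1) = \1_(elt K)); last first.
  by apply/funext => x; rewrite mulr1.
apply=> [|x _].
  by apply: measurable_funS (@measurable_indic _ _ _ setT _ (elt_measurable K)).
by rewrite indicE; case: (_ \in _); rewrite ?normr1 ?normr0.
Qed.

Lemma L2_pwconst (c : T -> R) : L2 Omega (pwconst c).
Proof.
apply: (L2_sum Omega_measurable) => K _; apply: (L2Z Omega_measurable).
exact: L2_indic.
Qed.

Lemma pwconst_bounded (c : T -> R) x : `|pwconst c x| <= \sum_K `|c K|.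
Proof.
apply: le_trans (ler_norm_sum _ _ _) _; apply: ler_sum => K _.
by rewrite normrM ler_piMr// indicE; case: (_ \in _); rewrite ?normr1 ?normr0.
Qed.

Lemma integral_pwconst (c : T -> R) :
  \int[leb]_(x in Omega) pwconst c x = \sum_K c K * fine (leb (elt K)).
Proof.
have i1 K : leb.-integrable Omega (EFin \o (fun x => c K * \1_(elt K) x)).
  exact: (L2_integrable Omega_measurable (L2_cst_bounded Omega_open (c K) Omega_bounded) (L2_indic K)).
have [_ ->] := Rintegral_sum Omega_open (index_enum T) i1.
apply: eq_bigr => K _.
rewrite -[LHS]/(ip Omega (fun=> c K) (\1_(elt K))) (ip_supported _ (@elt_Omega K)).
  rewrite -(Rintegral_cst leb (elt_measurable K)).
  by apply: eq_Rintegral => x xK; rewrite indicE xK mulr1.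
by move=> x nx; rewrite indicE memNset.
Qed.

Lemma P1_affine v K : P1 v -> affine_on (cell K) v (cell_grad v K).
Proof.
by move=> [_ /(_ K) av _]; rewrite /Defs.cell_grad; exact: (@xgetPex _ 0 [set p | affine_on (cell K) v p]).
Qed.

Lemma P1_elt v K : P1 v -> exists c, forall x, elt K x -> v x = dotp (cell_grad v K) x + c.
Proof.
by move=> /(P1_affine K)[c vc]; exists c => x /elt_cell; exact: vc.
Qed.

Lemma cell_grad_eq v K p : P1 v -> affine_on (cell K) v p -> cell_grad v K = p.
Proof.
move=> Pv av; have [nd _ _ _] := hmesh.
exact: affine_on_unique (nd K) (P1_affine K Pv) av.
Qed.

Lemma P1D v w : P1 v -> P1 w -> P1 (fun x => v x + w x).
Proof.
move=> Pv Pw; have [cv _ v0] := Pv; have [cw _ w0] := Pw; split.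
- move=> x; exact: (cvgD (cv x) (cw x)).
- move=> K; have [c vc] := P1_affine K Pv; have [e we] := P1_affine K Pw.
  exists (cell_grad v K + cell_grad w K), (c + e) => x Kx.
  by rewrite vc// we// dotpDl addrACA.
- by move=> x bx; rewrite v0// w0// addr0.
Qed.

Lemma P1Z (c : R) v : P1 v -> P1 (fun x => c * v x).
Proof.
move=> Pv; have [cv _ v0] := Pv; split.
- move=> x; exact: (cvgM (cvg_cst c) (cv x)).
- move=> K; have [e ve] := P1_affine K Pv.
  by exists (c *: cell_grad v K), (c * e) => x Kx; rewrite ve// dotpZl mulrDr.
- by move=> x bx; rewrite v0// mulr0.
Qed.

Lemma P1_0 : P1 (fun=> 0).
Proof.
split=> //; first by move=> x; exact: cvg_cst.
by move=> K; exists 0, 0 => x _; rewrite dotp0 addr0.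
Qed.

Lemma cell_gradD v w K : P1 v -> P1 w ->
  cell_grad (fun x => v x + w x) K = cell_grad v K + cell_grad w K.
Proof.
move=> Pv Pw; apply: (cell_grad_eq (P1D Pv Pw)).
have [c vc] := P1_affine K Pv; have [e we] := P1_affine K Pw.
by exists (c + e) => x Kx; rewrite vc// we// dotpDl addrACA.
Qed.

Lemma cell_gradZ (c : R) v K : P1 v ->
  cell_grad (fun x => c * v x) K = c *: cell_grad v K.
Proof.
move=> Pv; apply: (cell_grad_eq (P1Z c Pv)).
have [e ve] := P1_affine K Pv.
by exists (c * e) => x Kx; rewrite ve// dotpZl mulrDr.
Qed.

Lemma cell_grad0 K : cell_grad (fun=> 0) K = 0.
Proof.
by apply: (cell_grad_eq P1_0); exists 0 => x _; rewrite dotp0 addr0.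
Qed.

Lemma P1_sum (I : Type) (s : seq I) (F : I -> E -> R) : (forall i, P1 (F i)) ->
  P1 (fun x => \sum_(i <- s) F i x) /\
  forall K, cell_grad (fun x => \sum_(i <- s) F i x) K = \sum_(i <- s) cell_grad (F i) K.
Proof.
move=> PF; elim: s => [|i s [IH1 IH2]].
  rewrite (_ : (fun x => _) = fun=> 0); last by apply/funext => x; rewrite big_nil.
  by split=> [|K]; [exact: P1_0|rewrite big_nil cell_grad0].
rewrite (_ : (fun x => \sum_(j <- _) F j x) = fun x => F i x + \sum_(j <- s) F j x); last first.
  by apply/funext => x; rewrite big_cons.
by split=> [|K]; [exact: P1D|rewrite cell_gradD// big_cons IH2].
Qed.

Lemma P1_continuous v : P1 v -> {in Omega, continuous v}.
Proof.
move=> [cv _ _]; rewrite -(continuous_open_subspace v Omega_open).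
exact: continuous_subspaceW (@subset_closure _ Omega) cv.
Qed.

Lemma P1_measurable v : P1 v -> measurable_fun Omega v.
Proof.
by move=> Pv; apply: continuous_measurable_rV; [exact: Omega_open|exact: P1_continuous].
Qed.

(** A continuous function that vanishes almost everywhere vanishes on Omega,
    since nonempty open sets have positive measure. *)
Lemma P1_ae0 v : P1 v -> v = (fun=> 0) %[ae leb in Omega] ->
  forall x, closure Omega x -> v x = 0.
Proof.
move=> Pv [N [mN N0 HN]] x /closure_Omega[Ox|bx]; last by case: Pv => _ _; exact.
apply/eqP; apply: contraT => vx; exfalso.
pose O := Omega `&` [set y | v y != 0].
have oO : open O.
  rewrite openE => y [Oy vy]; apply: filterI.
    by apply: open_nbhs_nbhs; split => //; exact: Omega_open.
  have cv := P1_continuous Pv (mem_set Oy).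
  have : nbhs (v y) [set t : R | t != 0].
    by apply: open_nbhs_nbhs; split => //; exact: open_neq.
  by move/cv.
have := lebesgue_rV_open_gt0 oO (conj Ox vx : O x).
rewrite ltNge => /negP; apply; rewrite -N0; apply: le_measure; rewrite ?inE//.
  exact: open_measurable_rV.
by move=> y [Oy /eqP vy]; apply: HN => /= H; apply: vy; exact: H.
Qed.

(** A vertex that is not internal lies on the boundary, where v is zero. *)
Lemma P1_vertices0 v : P1 v -> (forall z, internal_vertices vtx Omega z -> v z = 0) ->
  forall x, closure Omega x -> v x = 0.
Proof.
move=> Pv v0 x; have [_ -> _ _] := hmesh => -[K _ Kx].
apply: (affine_on_hull_eq0 (P1_affine K Pv) _ Kx) => k.
have : closure Omega (vtx K k) by apply: (@cell_closure K); exact: vertex_hull.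
move/closure_Omega => [Ok|bk]; last by case: Pv => _ _; exact.
by apply: v0; split => //; exists K, k.
Qed.

Definition pw_grad v (x : E) : E := \sum_K \1_(elt K) x *: cell_grad v K.

Lemma pw_grad_in v K x : elt K x -> pw_grad v x = cell_grad v K.
Proof.
move=> Kx; rewrite /pw_grad (bigD1 K)//= indicE mem_set// scale1r big1 ?addr0// => L LK.
rewrite indicE memNset ?scale0r// => Lx.
by move/eqP: LK; apply; exact: elt_disjoint Lx Kx.
Qed.

Lemma L2_pw_grad v : L2grad Omega (pw_grad v).
Proof.
move=> i; have := L2_pwconst (fun K => cell_grad v K ord0 i).
congr L2; apply/funext => x; rewrite /pw_grad summxE; apply: eq_bigr => K _.
by rewrite mxE mulrC.
Qed.

Lemma P1_weak_grad_elt v K : P1 v -> weak_grad (elt K) v (fun=> cell_grad v K).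
Proof.
move=> Pv; have [c vc] := P1_elt K Pv.
exact: (weak_grad_affine (@elt_open K) (@elt_bounded K) vc).
Qed.

Lemma P1_L2_elt v K : P1 v -> L2 (elt K) v.
Proof.
move=> Pv; have [c vc] := P1_elt K Pv.
exact: (L2_affine_on (@elt_open K) (@elt_bounded K) vc).
Qed.

End mesh.

(** * Bubbles and the adapted basis functions *)

Lemma weak_gradD (R : realType) (d : nat) (U : set 'rV[R]_d) (u v : 'rV[R]_d -> R)
    (g h : 'rV[R]_d -> 'rV[R]_d) : open U -> L2 U u -> L2 U v ->
  weak_grad U u g -> weak_grad U v h ->
  weak_grad U (fun x => u x + v x) (fun x => g x + h x).
Proof.
move=> oU lu lv wg wh; have mU := open_measurable_rV oU.
split=> [|phi i tphi]; first exact: (L2gradD oU wg.1 wh.1).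
have lp := L2_test mU tphi; have ld := L2_test mU (test_fun_partial i tphi).
rewrite -[LHS]/(ip U (fun x => u x + v x) (partial i phi)) ipDl//.
rewrite (weak_grad_test i wg tphi) (weak_grad_test i wh tphi) -opprD -ipDl//.
- by congr (- _); apply: eq_Rintegral => x _; rewrite mxE.
- exact: wg.1.
- exact: wh.1.
Qed.

Section bubbles.
Context {R : realType} {d : nat}.
Local Notation E := 'rV[R]_d.
Local Notation leb := (@lebesgue_rV R d).
Context (hd : (0 < d)%N) (m : R) (hm : 0 < m) (b : E).
Context (Omega : set E) (hOmega : open_polytope Omega).
Context (T : finType) (vtx : T -> 'I_d.+1 -> E) (hmesh : conforming_mesh vtx Omega).
Context (B : T -> E -> R) (hB : bubbles vtx m b B).
Implicit Types (K L : T) (v w : E -> R) (c : T -> R).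
Local Notation elt := (elt vtx).
Local Notation P1 := (P1 vtx Omega).
Local Notation cell_grad := (cell_grad vtx).
Local Notation pw_grad := (pw_grad vtx).
Let oO : open Omega := Omega_open hOmega.
Let mO : measurable Omega := Omega_measurable hOmega.
Let oK K : open (elt K) := @elt_open _ _ _ vtx K.
Let mK K : measurable (elt K) := @elt_measurable _ _ _ vtx K.
Let bK K : bounded_set (elt K) := @elt_bounded R d Omega hOmega T vtx hmesh K.
Let KO K : elt K `<=` Omega := @elt_Omega R d Omega hOmega T vtx hmesh K.

Definition bubble_grad K (x : E) : E := \1_(elt K) x *: grad (elt K) (B K) x.

Definition bubble_mass K : R := \int[leb]_(x in elt K) B K x.

Lemma bubble_out K x : ~ elt K x -> B K x = 0.
Proof. by have [_ _] := hB K; exact. Qed.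

Lemma bubble_test_limit_elt K : test_limit (elt K) (B K) (grad (elt K) (B K)).
Proof. by have [hK _ _] := hB K; exact: (H10_test_limit (@oK K) hK). Qed.

Lemma bubble_test_limit K : test_limit Omega (B K) (bubble_grad K).
Proof.
exact: (test_limit_extend (@oK K) oO (@KO K) (bubble_test_limit_elt K) (@bubble_out K)).
Qed.

Lemma bubble_grad_out K x : ~ elt K x -> bubble_grad K x = 0.
Proof. by move=> nx; rewrite /bubble_grad indicE memNset ?scale0r. Qed.

Lemma bubble_grad_in K x : elt K x -> bubble_grad K x = grad (elt K) (B K) x.
Proof. by move=> Kx; rewrite /bubble_grad indicE mem_set// scale1r. Qed.

Lemma bubble_bil K :
  bil m b (elt K) (grad (elt K) (B K)) (B K) (grad (elt K) (B K)) = bubble_mass K.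
Proof.
have [hK sK _] := hB K; have t := bubble_test_limit_elt K.
have [l _ _] := t; have w := test_limit_weak_grad (@oK K) t.
by rewrite -(bilinE m b (@oK K) l l w w) sK.
Qed.

Lemma bubble_mass_ge0 K : 0 <= bubble_mass K.
Proof.
rewrite -bubble_bil (bil_diag m b (@oK K) (bubble_test_limit_elt K)).
by rewrite mulr_ge0 ?(ltW hm)// sumr_ge0// => i _; exact: ip_ge0.
Qed.

(** The mass of the bubble is its energy a(B_K, B_K). *)
Lemma bubble_mass_eq0 K : bubble_mass K = 0 -> B K = (fun=> 0) %[ae leb in Omega].
Proof.
move=> s0; have [|z _] := bil_coercive (b := b) (@oK K) hm hd (@bK K) (bubble_test_limit_elt K).
  by rewrite bubble_bil s0.
apply: filterS z => x H _; have [/H//|/bubble_out//] := pselect (elt K x).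
Qed.

Lemma bil_P1_bubble v K : P1 v ->
  bil m b Omega (pw_grad v) (B K) (bubble_grad K) =
  dotp b (cell_grad v K) * bubble_mass K.
Proof.
move=> Pv; rewrite (bil_shrinkr m b _ (@KO K) (@bubble_out K) (@bubble_grad_out K)).
rewrite (@eq_bil _ _ _ _ _ _ _ _ (fun=> cell_grad v K) (B K) (grad (elt K) (B K)))//.
- by rewrite (bil_cstl m b (@oK K) _ (@bK K) (bubble_test_limit_elt K)) ip_cst1.
- by move=> x Kx; exact: (pw_grad_in hmesh).
- exact: bubble_grad_in.
Qed.

Lemma bil_bubble_P1 w K : P1 w ->
  bil m b Omega (bubble_grad K) w (pw_grad w) =
  - dotp b (cell_grad w K) * bubble_mass K.
Proof.
move=> Pw; rewrite (bil_shrinkl m b _ _ (@KO K) (@bubble_grad_out K)).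
rewrite (@eq_bil _ _ _ _ _ _ _ _ (grad (elt K) (B K)) w (fun=> cell_grad w K))//.
- rewrite (bil_cstr m b (@oK K) (@bK K) (bubble_test_limit_elt K)).
  + by rewrite ip_cst1.
  + exact: (P1_L2_elt hOmega hmesh).
  + exact: (P1_weak_grad_elt hOmega hmesh).
- exact: bubble_grad_in.
- by move=> x Kx; exact: (pw_grad_in hmesh).
Qed.

Lemma bil_bubble_bubble K L :
  bil m b Omega (bubble_grad K) (B L) (bubble_grad L) = (K == L)%:R * bubble_mass K.
Proof.
rewrite (bil_shrinkl m b _ _ (@KO K) (@bubble_grad_out K)).
have [<-|KL] := eqVneq K L.
  rewrite mul1r -bubble_bil; apply: eq_bil => //; exact: bubble_grad_in.
rewrite mul0r (@eq_bil _ _ _ _ _ _ _ _ (bubble_grad K) (fun=> 0) (fun=> 0))//.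
- have [_ lg _] := bubble_test_limit K.
  rewrite /bil !big1 ?mulr0 ?addr0// => i _; first by rewrite ip0l mulr0.
  rewrite ipC (_ : (fun x : E => (0 : E) ord0 i) = fun=> 0) ?ip0l//.
  by apply/funext => x; rewrite mxE.
- move=> x Kx; apply: bubble_out => Lx; move/eqP: KL; apply.
  exact: (elt_disjoint hmesh Kx Lx).
- move=> x Kx; apply: bubble_grad_out => Lx; move/eqP: KL; apply.
  exact: (elt_disjoint hmesh Kx Lx).
Qed.

(** On K the difference psi - v solves the bubble problem with right-hand side
    - b . grad v. *)
Lemma adv_eq_P1_bubbles v psi : P1 v -> H10 Omega psi ->
  (forall K, weak_sol m b (elt K) psi (fun=> 0) /\
     H10 (elt K) (fun x => psi x - v x)) ->
  psi = (fun x => v x + \sum_K - dotp b (cell_grad v K) * B K x) %[ae leb in Omega].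
Proof.
move=> Pv hpsi hK; apply: (ae_on_elts hd hmesh) => K.
have [sK hw] := hK K; have [hBK sBK _] := hB K.
have tpsi := H10_test_limit oO hpsi; have [lpsi _ _] := tpsi.
have lpsiK : L2 (elt K) psi by have := L2_setI mO (mK K) lpsi; rewrite (setIidr (@KO K)).
have wpsi := weak_gradS (@oK K) oO (@KO K) (test_limit_weak_grad oO tpsi).
have lv := P1_L2_elt hOmega hmesh K Pv.
pose p := cell_grad v K.
have [c vc] := P1_elt K Pv.
have vNc x : elt K x -> - v x = dotp (- p) x + - c.
  by move=> Kx; rewrite vc// dotpNl opprD.
have lNv := L2_affine_on (@oK K) (@bK K) vNc.
have wNv := weak_grad_affine (@oK K) (@bK K) vNc.
have ww := weak_gradD (@oK K) lpsiK lNv wpsi wNv.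
have lw := L2D (mK K) lpsiK lNv.
have : (fun x => psi x - v x) = (fun x => - dotp b p * B K x) %[ae leb in elt K].
  apply: (weak_sol_unique (@oK K) hm hd (@bK K) hBK sBK hw) => z hz.
  have tz := H10_test_limit (@oK K) hz; have [lz gz _] := tz.
  have wz := test_limit_weak_grad (@oK K) tz.
  rewrite (bilinE m b (@oK K) lw lz ww wz) bilDl//; last exact: wNv.1; last exact: wpsi.1.
  rewrite -(bilinE m b (@oK K) lpsiK lz wpsi wz) sK// add0r.
  rewrite (bil_cstl m b (@oK K) _ (@bK K) tz) ip_cst1; congr (_ * _).
  by rewrite /dotp -sumrN; apply: eq_bigr => i _; rewrite mxE mulrN.
apply: filterS => x H Kx.
rewrite (bigD1 K)//= big1 ?addr0; last first.
  move=> L LK; rewrite bubble_out ?mulr0// => Lx; move/eqP: LK; apply.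
  exact: (elt_disjoint hmesh Lx Kx).
by rewrite -H// addrC subrK.
Qed.

(** By [adv_eq_P1_bubbles], v is a combination of psi and the bubbles, all in
    H^1_0(Omega); its weak gradient is then identified on each element. *)
Lemma P1_test_limit_of_adv v psi : P1 v -> H10 Omega psi ->
  (forall K, weak_sol m b (elt K) psi (fun=> 0) /\
     H10 (elt K) (fun x => psi x - v x)) ->
  test_limit Omega v (pw_grad v).
Proof.
move=> Pv hpsi hK; have ae := adv_eq_P1_bubbles Pv hpsi hK.
have t := test_limitD oO (H10_test_limit oO hpsi) (test_limit_sum oO (index_enum T)
  (fun K => test_limitZ oO (dotp b (cell_grad v K)) (bubble_test_limit K))).
set u := (fun x => _ + _) in t; set g := (fun x => _ + _) in t.
have uv : u = v %[ae leb in Omega].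
  apply: filterS ae => x H Ox; rewrite /u H// -addrA -big_split big1 ?addr0// => K _.
  by rewrite /= mulNr addNr.
have [lu _ _] := t.
have lv : L2 Omega v := L2_ae mO (P1_measurable hOmega Pv) uv lu.
apply: (test_limit_ae oO t lv uv (L2_pw_grad hOmega vtx v)) => i.
apply: (ae_on_elts hd hmesh) => K.
have wK := weak_gradS (@oK K) oO (@KO K) (test_limit_weak_grad oO t).
have luK : L2 (elt K) u by have := L2_setI mO (mK K) lu; rewrite (setIidr (@KO K)).
have uvK : u = v %[ae leb in elt K].
  by apply: filterS uv => x H Kx; apply: H; exact: (@KO K).
have := weak_grad_unique (@oK K) luK (P1_L2_elt hOmega hmesh K Pv) uvK
  wK (P1_weak_grad_elt hOmega hmesh K Pv) i.
by move=> h; apply: filterS h => x H Kx; rewrite H// (pw_grad_in hmesh _ Kx).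
Qed.

End bubbles.

(** * The enriched Galerkin space and the SUPG scheme *)

Section bil_sums.
Context {R : realType} {d : nat}.
Local Notation E := 'rV[R]_d.
Variables (m : R) (b : E) (U : set E).
Hypothesis oU : open U.

Lemma bil0l v h : bil m b U (fun=> 0) v h = 0.
Proof.
have z i : (fun x : E => (0 : E) ord0 i) = fun=> 0 by apply/funext => x; rewrite mxE.
rewrite /bil !big1 ?mulr0 ?addr0// => i _; first by rewrite ipC z ip0l mulr0.
by rewrite z ip0l.
Qed.

Lemma bil0r g : bil m b U g (fun=> 0) (fun=> 0) = 0.
Proof.
have z i : (fun x : E => (0 : E) ord0 i) = fun=> 0 by apply/funext => x; rewrite mxE.
rewrite /bil !big1 ?mulr0 ?addr0// => i _; first by rewrite ip0l mulr0.
by rewrite ipC z ip0l.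
Qed.

Lemma bil_suml (I : Type) (s : seq I) (c : I -> R) (g : I -> E -> E) v h :
  (forall k, L2grad U (g k)) -> L2 U v -> L2grad U h ->
  L2grad U (fun x => \sum_(k <- s) c k *: g k x) /\
  bil m b U (fun x => \sum_(k <- s) c k *: g k x) v h =
  \sum_(k <- s) c k * bil m b U (g k) v h.
Proof.
move=> lg lv lh; elim: s => [|k s [IH1 IH2]].
  rewrite (_ : (fun x => _) = fun=> 0); last by apply/funext => x; rewrite big_nil.
  rewrite bil0l big_nil; split => // i.
  rewrite (_ : (fun x : E => (0 : E) ord0 i) = fun=> 0); first exact: L2_0.
  by apply/funext => x; rewrite mxE.
rewrite (_ : (fun x => \sum_(j <- _) c j *: g j x) =
  fun x => c k *: g k x + \sum_(j <- s) c j *: g j x); last first.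
  by apply/funext => x; rewrite big_cons.
have lk := L2gradZ oU (c k) (lg k).
by split; [exact: L2gradD|rewrite bilDl// bilZl// big_cons IH2].
Qed.

Lemma bil_sumr (I : Type) (s : seq I) (c : I -> R) (v : I -> E -> R) g (h : I -> E -> E) :
  L2grad U g -> (forall k, L2 U (v k)) -> (forall k, L2grad U (h k)) ->
  [/\ L2 U (fun x => \sum_(k <- s) c k * v k x),
    L2grad U (fun x => \sum_(k <- s) c k *: h k x) &
  bil m b U g (fun x => \sum_(k <- s) c k * v k x) (fun x => \sum_(k <- s) c k *: h k x) =
  \sum_(k <- s) c k * bil m b U g (v k) (h k)].
Proof.
move=> lg lv lh; elim: s => [|k s [IH0 IH1 IH2]].
  rewrite (_ : (fun x => \sum_(j <- _) _ * _) = fun=> 0); last by apply/funext => x; rewrite big_nil.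
  rewrite (_ : (fun x => \sum_(j <- _) _ *: _) = fun=> 0); last by apply/funext => x; rewrite big_nil.
  rewrite bil0r big_nil; split => //; first exact: L2_0.
  move=> i; rewrite (_ : (fun x : E => (0 : E) ord0 i) = fun=> 0); first exact: L2_0.
  by apply/funext => x; rewrite mxE.
rewrite (_ : (fun x => \sum_(j <- _) c j * v j x) =
  fun x => c k * v k x + \sum_(j <- s) c j * v j x); last first.
  by apply/funext => x; rewrite big_cons.
rewrite (_ : (fun x => \sum_(j <- _) c j *: h j x) =
  fun x => c k *: h k x + \sum_(j <- s) c j *: h j x); last first.
  by apply/funext => x; rewrite big_cons.
have lk := L2gradZ oU (c k) (lh k).
have lz := L2Z (open_measurable_rV oU) (c k) (lv k).
split; [exact: (L2D (open_measurable_rV oU))|exact: L2gradD|].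
by rewrite bilDr// bilZr// big_cons IH2.
Qed.

End bil_sums.

Section msfem.
Context {R : realType} {d : nat}.
Local Notation E := 'rV[R]_d.
Local Notation leb := (@lebesgue_rV R d).
Context (hd : (0 < d)%N) (m : R) (hm : 0 < m) (b : E).
Context (Omega : set E) (hOmega : open_polytope Omega).
Context (T : finType) (vtx : T -> 'I_d.+1 -> E) (hmesh : conforming_mesh vtx Omega).
Context (N : nat) (phi : 'I_N -> E -> R) (z : 'I_N -> E).
Context (zi : range z = internal_vertices vtx Omega).
Context (Pphi : forall i, P1 vtx Omega (phi i)) (phiz : forall i j, phi i (z j) = (i == j)%:R).
Context (phiadv : 'I_N -> E -> R) (hphiadv : adv_basis vtx m b Omega phi phiadv).
Context (B : T -> E -> R) (hB : bubbles vtx m b B) (fK : T -> R).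
Implicit Types (K L : T) (u v w : E -> R) (c e : 'I_N -> R) (gam del : T -> R).
Local Notation elt := (elt vtx).
Local Notation P1 := (P1 vtx Omega).
Local Notation cell_grad := (cell_grad vtx).
Local Notation pw_grad := (pw_grad vtx).
Local Notation bgrad v K := (dotp b (cell_grad v K)).
Local Notation mass := (bubble_mass vtx B).
Local Notation f := (pwconst vtx fK).
Local Notation tau := (tauB vtx B).
Let oO : open Omega := Omega_open hOmega.
Let mO : measurable Omega := Omega_measurable hOmega.
Let mK K : measurable (elt K) := @elt_measurable _ _ _ vtx K.
Let KO K : elt K `<=` Omega := @elt_Omega R d Omega hOmega T vtx hmesh K.

Definition nodal_comb c (x : E) : R := \sum_i c i * phi i x.

Lemma P1_comb c : P1 (nodal_comb c).
Proof. by apply: (P1_sum hmesh _ _).1 => i; exact: P1Z. Qed.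

Lemma cell_grad_comb c K : cell_grad (nodal_comb c) K = \sum_i c i *: cell_grad (phi i) K.
Proof.
rewrite (P1_sum hmesh _ _).2; last by move=> i; exact: P1Z.
by apply: eq_bigr => i _; exact: (cell_gradZ hmesh).
Qed.

Lemma bgrad_comb c K : bgrad (nodal_comb c) K = \sum_i c i * bgrad (phi i) K.
Proof.
rewrite cell_grad_comb dotp_sumr; apply: eq_bigr => i _.
by rewrite dotpZr.
Qed.

Lemma pw_grad_comb c : pw_grad (nodal_comb c) = fun x => \sum_i c i *: pw_grad (phi i) x.
Proof.
apply/funext => x; rewrite /pw_grad.
under eq_bigr do rewrite cell_grad_comb scaler_sumr.
rewrite exchange_big /=; apply: eq_bigr => i _; rewrite scaler_sumr.
by apply: eq_bigr => K _; rewrite !scalerA mulrC.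
Qed.

Lemma eq_cell_grad v w K : P1 v -> P1 w -> (forall x, closure Omega x -> v x = w x) ->
  cell_grad v K = cell_grad w K.
Proof.
move=> Pv Pw vw; apply: (cell_grad_eq hmesh Pv).
have [c wc] := P1_affine K Pw; exists c => x Kx; rewrite vw ?wc//.
exact: (cell_closure hmesh Kx).
Qed.

Lemma eq_pw_grad v w : P1 v -> P1 w -> (forall x, closure Omega x -> v x = w x) ->
  pw_grad v = pw_grad w.
Proof.
move=> Pv Pw vw; apply/funext => x; apply: eq_bigr => K _.
by rewrite (eq_cell_grad K Pv Pw vw).
Qed.

(** Both sides agree at the internal vertices. *)
Lemma P1_eq_comb v x : P1 v -> closure Omega x -> v x = nodal_comb (v \o z) x.
Proof.
move=> Pv cx.
have Pd := P1D Pv (P1Z (-1) (P1_comb (v \o z))).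
have := P1_vertices0 hOmega hmesh Pd _ cx.
rewrite mulN1r => H; apply/eqP; rewrite -subr_eq0; apply/eqP/H => y.
rewrite -zi => -[j _ <-]; rewrite /nodal_comb (bigD1 j)//= phiz eqxx mulr1.
rewrite big1 ?addr0 ?mulN1r ?subrr// => i /negPf ij.
by rewrite phiz ij mulr0.
Qed.

Lemma P1_test_limit v : P1 v -> test_limit Omega v (pw_grad v).
Proof.
move=> Pv.
have t := test_limit_sum oO (index_enum 'I_N) (fun i => test_limitZ oO (v (z i))
  (P1_test_limit_of_adv hd hm hOmega hmesh hB (Pphi i) (hphiadv i).1 (hphiadv i).2)).
have vE x : Omega x -> nodal_comb (v \o z) x = v x.
  by move=> Ox; rewrite -P1_eq_comb//; exact: subset_closure.
have [lt _ _] := t.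
have ae : nodal_comb (v \o z) = v %[ae leb in Omega] by apply: aeW.
have lv := L2_ae mO (P1_measurable hOmega Pv) ae lt.
apply: (test_limit_ae oO t lv ae (L2_pw_grad hOmega vtx v)) => i; apply: aeW => x _.
rewrite (eq_pw_grad Pv (P1_comb (v \o z))) ?pw_grad_comb//.
by move=> y cy; exact: P1_eq_comb.
Qed.

Lemma P1_L2 v : P1 v -> L2 Omega v.
Proof. by move=> /P1_test_limit[]. Qed.

(** The elements of V_H plus the span of the bubbles. *)
Definition enriched v gam (x : E) : R := v x + \sum_K gam K * B K x.

Definition enriched_grad v gam (x : E) : E :=
  pw_grad v x + \sum_K gam K *: bubble_grad vtx B K x.

Lemma enriched_test_limit v gam : P1 v ->
  test_limit Omega (enriched v gam) (enriched_grad v gam).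
Proof.
move=> Pv; apply: (test_limitD oO (P1_test_limit Pv)).
apply: (test_limit_sum oO) => K; apply: (test_limitZ oO).
exact: (bubble_test_limit hOmega hmesh hB).
Qed.

Let bL2 K : L2 Omega (B K).
Proof. by have [] := bubble_test_limit hOmega hmesh hB K. Qed.

Let bgL2 K : L2grad Omega (bubble_grad vtx B K).
Proof. by have [] := bubble_test_limit hOmega hmesh hB K. Qed.

Let pgL2 v : L2grad Omega (pw_grad v). Proof. exact: L2_pw_grad. Qed.

Definition P1_form v w : R := bil m b Omega (pw_grad v) w (pw_grad w).

(** The SUPG form, with tau_K |K| replaced by the mass of the bubble. *)
Definition supg_form v w : R :=
  P1_form v w + \sum_K mass K * (bgrad v K * bgrad w K).

Definition supg_load w : R := ip Omega f w + \sum_K mass K * (fK K * bgrad w K).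

Lemma bil_enriched v gam w del : P1 v -> P1 w ->
  bil m b Omega (enriched_grad v gam) (enriched w del) (enriched_grad w del) =
  P1_form v w + \sum_K mass K *
    (bgrad v K * del K - bgrad w K * gam K + gam K * del K).
Proof.
move=> Pv Pw; have [le lge _] := enriched_test_limit del Pw.
have lw := P1_L2 Pw.
have [lsg E1] := bil_suml m b oO (index_enum T) gam bgL2 le lge.
rewrite /enriched_grad in lsg E1 *; rewrite bilDl// E1.
have R1 g : L2grad Omega g ->
    bil m b Omega g (enriched w del) (enriched_grad w del) =
    bil m b Omega g w (pw_grad w) + \sum_K del K * bil m b Omega g (B K) (bubble_grad vtx B K).
  move=> lg; have [l1 l2 E2] := bil_sumr m b oO (index_enum T) del lg bL2 bgL2.
  by rewrite -E2 -bilDr.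
rewrite R1// -/(P1_form v w) -addrA; congr (_ + _).
rewrite -big_split; apply: eq_bigr => K _ /=; rewrite R1//.
rewrite (bil_P1_bubble hOmega hmesh hB _ Pv) (bil_bubble_P1 hOmega hmesh hB _ Pw).
rewrite (bigD1 K)//= big1; last first.
  move=> L LK; rewrite (bil_bubble_bubble hOmega hmesh hB) eq_sym (negPf LK).
  by rewrite mul0r mulr0.
by rewrite (bil_bubble_bubble hOmega hmesh hB) eqxx mul1r; ring.
Qed.

Lemma load_bubble K : ip Omega f (B K) = fK K * mass K.
Proof.
rewrite (ip_supported _ (@KO K) (bubble_out hB (K:=K))).
have lK : L2 (elt K) (B K) by have := L2_setI mO (mK K) (bL2 K); rewrite (setIidr (@KO K)).
have l1 : L2 (elt K) (fun=> 1).
  exact: (L2_cst_bounded (@elt_open _ _ _ vtx K) 1 (@elt_bounded R d Omega hOmega T vtx hmesh K)).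
rewrite /bubble_mass -ip_cst1 -ipZl//.
by apply: eq_Rintegral => x /set_mem Kx; rewrite (pwconst_in hmesh _ Kx) mulr1 mulrC mulrC.
Qed.

Lemma load_enriched w del : P1 w ->
  ip Omega f (enriched w del) = ip Omega f w + \sum_K mass K * (fK K * del K).
Proof.
move=> Pw; have lf := L2_pwconst hOmega vtx fK.
have lb K : L2 Omega (fun x => del K * B K x) by apply: L2Z.
rewrite ipDr//; last 2 first.
- exact: P1_L2.
- by apply: L2_sum.
congr (_ + _); rewrite ipC ip_suml//; apply: eq_bigr => K _.
by rewrite ipZl// ipC load_bubble; ring.
Qed.

Lemma adv_comb_enriched c :
  (fun x => \sum_i c i * phiadv i x) = enriched (nodal_comb c) (fun K => - bgrad (nodal_comb c) K)
  %[ae leb in Omega].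
Proof.
have H : \forall x \ae leb, forall i, Omega x ->
    phiadv i x = phi i x + \sum_K - bgrad (phi i) K * B K x.
  apply: filter_forall => i.
  exact: (adv_eq_P1_bubbles hd hm hOmega hmesh hB (Pphi i) (hphiadv i).1 (hphiadv i).2).
apply: filterS H => x H Ox; rewrite /enriched /nodal_comb.
under eq_bigr do rewrite H// mulrDr.
rewrite big_split /=; congr (_ + _).
under eq_bigr do rewrite mulr_sumr.
rewrite exchange_big /=; apply: eq_bigr => K _.
rewrite -/(nodal_comb c) bgrad_comb -sumrN mulr_suml; apply: eq_bigr => i _.
by rewrite mulrA mulrN.
Qed.

Lemma VHB_enriched w del : P1 w -> VHB Omega phiadv B (enriched w del).
Proof.
move=> Pw; split; first exact: (test_limit_H10 oO (enriched_test_limit del Pw)).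
exists (w \o z), (fun K => del K + bgrad w K).
apply: filterS (adv_comb_enriched (w \o z)) => x H Ox; rewrite H// /enriched.
rewrite -(P1_eq_comb Pw); last exact: subset_closure.
rewrite -addrA -big_split; congr (_ + _); apply: eq_bigr => K _ /=.
rewrite -(eq_cell_grad K Pw (P1_comb _)); first by ring.
by move=> y cy; exact: P1_eq_comb.
Qed.

Lemma VHB_repr u : VHB Omega phiadv B u ->
  exists v gam, P1 v /\ u = enriched v gam %[ae leb in Omega].
Proof.
move=> [_ [c [beta ub]]].
exists (nodal_comb c), (fun K => beta K - bgrad (nodal_comb c) K); split; first exact: P1_comb.
apply: filterS2 (adv_comb_enriched c) ub => x H1 H2 Ox; rewrite H2// H1// /enriched.
by rewrite -addrA -big_split; congr (_ + _); apply: eq_bigr => K _ /=; ring.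
Qed.

Lemma enriched_ae_test_limit u v gam : H10 Omega u -> P1 v ->
  u = enriched v gam %[ae leb in Omega] -> test_limit Omega u (enriched_grad v gam).
Proof.
move=> hu Pv uE; have [lu _ _] := H10_test_limit oO hu.
have t := enriched_test_limit gam Pv; have [_ lg _] := t.
by apply: (test_limit_ae oO t lu _ lg) => [|i]; [apply: filterS uE => x H /H ->|apply: aeW].
Qed.

Lemma bilin_enriched u v gam u' w del : H10 Omega u -> P1 v ->
  u = enriched v gam %[ae leb in Omega] -> H10 Omega u' -> P1 w ->
  u' = enriched w del %[ae leb in Omega] ->
  bilin m b Omega u u' = P1_form v w + \sum_K mass K *
    (bgrad v K * del K - bgrad w K * gam K + gam K * del K).
Proof.
move=> hu Pv uE hu' Pw uE'.
have t := enriched_ae_test_limit hu Pv uE; have t' := enriched_ae_test_limit hu' Pw uE'.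
have [lu lg _] := t; have [lu' _ _] := t'; have [le _ _] := enriched_test_limit del Pw.
rewrite (bilinE m b oO lu lu' (test_limit_weak_grad oO t) (test_limit_weak_grad oO t')).
rewrite -(bil_enriched gam del Pv Pw) /bil; congr (_ + _); apply: eq_bigr => i _.
by rewrite (ip_ae mO _ _ _ uE')//; [case: lu'|case: le|case: (lg i)].
Qed.

Lemma load_ae u' w del : H10 Omega u' -> P1 w ->
  u' = enriched w del %[ae leb in Omega] ->
  \int[leb]_(x in Omega) (f x * u' x) =
  ip Omega f w + \sum_K mass K * (fK K * del K).
Proof.
move=> hu' Pw uE'; rewrite -load_enriched// -[LHS]/(ip Omega f u') ipC [RHS]ipC.
have [lu' _ _] := H10_test_limit oO hu'; have [le _ _] := enriched_test_limit del Pw.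
by apply: ip_ae => //; [case: lu'|case: le|case: (L2_pwconst hOmega vtx fK)].
Qed.

Lemma bgrad0 K : bgrad (fun=> 0) K = 0.
Proof. by rewrite (cell_grad0 hmesh) dotp0r. Qed.

(** Testing with one bubble determines gamma_K up to the factor sigma_K; this
    relation turns the equation tested with w in V_H into the SUPG equation. *)
Lemma galerkin_supg u v gam : P1 v -> VHB Omega phiadv B u ->
  u = enriched v gam %[ae leb in Omega] ->
  galerkin m b Omega phiadv B f u <->
  (forall w, P1 w -> supg_form v w = supg_load w) /\
  (forall K, mass K * gam K = mass K * (fK K - bgrad v K)).
Proof.
move=> Pv Vu uE; have hu := Vu.1.
have key w del : P1 w ->
    bilin m b Omega u (enriched w del) = \int[leb]_(x in Omega) (f x * enriched w del x) <->
    P1_form v w + \sum_K mass K * (bgrad v K * del K - bgrad w K * gam K + gam K * del K) =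
    ip Omega f w + \sum_K mass K * (fK K * del K).
  move=> Pw; have hw := (VHB_enriched del Pw).1.
  have ew : enriched w del = enriched w del %[ae leb in Omega] by apply: aeW.
  by rewrite (bilin_enriched hu Pv uE hw Pw ew) (load_ae hw Pw ew).
split=> [[_ G]|[S M]].
  have M K : mass K * gam K = mass K * (fK K - bgrad v K).
    have P0 : P1 (fun=> 0) by exact: P1_0.
    have /(key _ (fun L => (L == K)%:R) P0) := G _ (VHB_enriched (fun L => (L == K)%:R) P0).
    have -> : P1_form v (fun=> 0) = 0.
      rewrite /P1_form (_ : pw_grad (fun=> 0) = fun=> 0) ?bil0r//.
      apply/funext => x; rewrite /pw_grad big1// => L _.
      by rewrite (cell_grad0 hmesh) scaler0.
    rewrite ipC ip0l !add0r (bigD1 K)//= big1 ?addr0; last first.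
      by move=> L /negPf LK; rewrite LK -[false%:R]/(0 : R) bgrad0; ring.
    rewrite (bigD1 K)//= big1 ?addr0; last first.
      by move=> L /negPf LK; rewrite LK !mulr0.
    rewrite eqxx -[true%:R]/(1 : R) bgrad0 !mulr1 mul0r subr0 => H.
    by rewrite mulrBr -H; ring.
  split => // w Pw.
  have /(key _ (fun=> 0) Pw) := G _ (VHB_enriched (fun=> 0) Pw).
  have -> : \sum_K mass K * (fK K * 0) = 0 by rewrite big1// => K _; rewrite !mulr0.
  rewrite addr0 /supg_form /supg_load => <-; rewrite -[RHS]addrA -big_split; congr (_ + _).
  apply: eq_bigr => K _ /=; rewrite !mulr0 add0r addr0.
  have := M K; set x := mass K; set g := gam K => MK.
  rewrite (_ : x * - (bgrad w K * g) = - bgrad w K * (x * g)); last by ring.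
  by rewrite MK; ring.
split=> // u' Vu'; have [w [del [Pw uE']]] := VHB_repr Vu'.
rewrite (bilin_enriched hu Pv uE Vu'.1 Pw uE') (load_ae Vu'.1 Pw uE').
have := S _ Pw; rewrite /supg_form /supg_load => S'.
have -> : P1_form v w = ip Omega f w + \sum_K mass K * (fK K * bgrad w K) -
    \sum_K mass K * (bgrad v K * bgrad w K) by rewrite -S' addrK.
rewrite -!addrA; congr (_ + _); rewrite -sumrN -!big_split; apply: eq_bigr => K _ /=.
have := M K; set x := mass K; set g := gam K => MK.
have -> : x * (bgrad v K * del K - bgrad w K * g + g * del K) =
   x * (bgrad v K * del K) + (x * g) * (del K - bgrad w K) by ring.
by rewrite MK; ring.
Qed.

Definition bdot (g : E -> E) (x : E) : R := dotp b (g x).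

Lemma L2_bdot g : L2grad Omega g -> L2 Omega (bdot g).
Proof. by move=> lg; apply: (L2_sum mO) => i _; apply: (L2Z mO). Qed.

Lemma bdot_ae (g h : E -> E) : (forall i, (fun x => g x ord0 i) = (fun x => h x ord0 i) %[ae leb in Omega]) ->
  bdot g = bdot h %[ae leb in Omega].
Proof.
move=> gh; have H : \forall x \ae leb, forall i, Omega x -> g x ord0 i = h x ord0 i.
  exact: filter_forall.
apply: filterS H => x H Ox; rewrite /bdot /dotp.
by apply: eq_bigr => i _; rewrite H.
Qed.

Lemma L2_tau_mul v : L2 Omega v -> L2 Omega (fun x => tau x * v x).
Proof.
apply: (L2_bounded mO (proj1 (L2_pwconst hOmega vtx _))) => x _.
exact: pwconst_bounded.
Qed.

(** On an empty element both sides vanish, whatever the inverse of 0 is. *)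
Lemma tau_measure K : (fine (leb (elt K)))^-1 * \int[leb]_(x in elt K) B K x *
  fine (leb (elt K)) = mass K.
Proof.
have [K0|/set0P[x Kx]] := eqVneq (elt K) set0.
  by rewrite /bubble_mass K0 Rintegral_set0 mulr0 mul0r.
have bK := @elt_bounded R d Omega hOmega T vtx hmesh K.
have fp : 0 < fine (leb (elt K)).
  rewrite fine_gt0// (lebesgue_rV_open_gt0 (@elt_open _ _ _ vtx K) Kx) /=.
  exact: lebesgue_rV_bounded.
by rewrite mulrAC mulVf ?gt_eqF// mul1r.
Qed.

Lemma integral_tau (c : T -> R) (h : E -> R) :
  (forall K x, elt K x -> h x = c K) ->
  \int[leb]_(x in Omega) (tau x * h x) = \sum_K mass K * c K.
Proof.
move=> hc; transitivity (\int[leb]_(x in Omega) pwconst vtx (fun K =>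
    (fine (leb (elt K)))^-1 * (\int[leb]_(x in elt K) B K x) * c K) x).
  apply: eq_Rintegral => x _; have [[K Kx]|nK] := pselect (exists K, elt K x).
    by rewrite /tauB !(pwconst_in hmesh _ Kx) (hc K).
  have nK' K : ~ elt K x by move=> Kx; apply: nK; exists K.
  by rewrite /tauB !pwconst_out// mul0r.
rewrite (integral_pwconst hOmega hmesh); apply: eq_bigr => K _.
by rewrite mulrAC tau_measure.
Qed.

Lemma P1_grad v : P1 v -> weak_grad Omega v (grad Omega v) /\
  forall i, (fun x => grad Omega v x ord0 i) = (fun x => pw_grad v x ord0 i) %[ae leb in Omega].
Proof.
move=> Pv; have t := P1_test_limit Pv; have [lv _ _] := t.
have w := test_limit_weak_grad oO t; have wG := gradP w; split => // i.
by apply: (weak_grad_unique oO lv lv _ wG w); apply: aeW.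
Qed.

Lemma ip_tau_bdot v w : P1 v -> P1 w ->
  ip Omega (fun x => tau x * bdot (grad Omega v) x) (bdot (grad Omega w)) =
  \sum_K mass K * (bgrad v K * bgrad w K).
Proof.
move=> Pv Pw; have [[lv _] ev] := P1_grad Pv; have [[lw _] ew] := P1_grad Pw.
have dv := bdot_ae ev; have dw := bdot_ae ew.
have lbv := L2_bdot lv; have lbw := L2_bdot lw.
have lpv := L2_bdot (@pgL2 v); have lpw := L2_bdot (@pgL2 w).
have ltv := L2_tau_mul lbv; have ltp := L2_tau_mul lpv.
have e1 : (fun x => tau x * bdot (grad Omega v) x) = (fun x => tau x * bdot (pw_grad v) x) %[ae leb in Omega].
  by apply: filterS dv => x H /H ->.
rewrite (ip_ae mO _ _ _ e1); [|by case: ltv|by case: ltp|by case: lbw].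
rewrite ipC (ip_ae mO _ _ _ dw); [|by case: lbw|by case: lpw|by case: ltp].
rewrite ipC -(@integral_tau (fun K => bgrad v K * bgrad w K) (fun x => bdot (pw_grad v) x * bdot (pw_grad w) x)).
  by apply: eq_Rintegral => x _; rewrite mulrA.
by move=> K x Kx; rewrite /bdot !(pw_grad_in hmesh _ Kx).
Qed.

Lemma supg_lhs v w : P1 v -> P1 w ->
  \int[leb]_(x in Omega)
      (m * dotp (grad Omega v x) (grad Omega w x) + w x * dotp b (grad Omega v x)
       + tau x * dotp b (grad Omega v x) * dotp b (grad Omega w x)) = supg_form v w.
Proof.
move=> Pv Pw; have [wv ev] := P1_grad Pv; have [ww ew] := P1_grad Pw.
have [i1 _] := bil_integral m b oO wv.1 (P1_L2 Pw) ww.1.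
have i2 := L2_integrable mO (L2_tau_mul (L2_bdot wv.1)) (L2_bdot ww.1).
rewrite (RintegralD mO i1 i2) -[X in X + _]/(bilin m b Omega v w); congr (_ + _).
  have tv := P1_test_limit Pv; have tw := P1_test_limit Pw.
  exact: (bilinE m b oO (P1_L2 Pv) (P1_L2 Pw) (test_limit_weak_grad oO tv) (test_limit_weak_grad oO tw)).
exact: ip_tau_bdot.
Qed.

Lemma supg_rhs w : P1 w ->
  \int[leb]_(x in Omega) (f x * w x + tau x * f x * dotp b (grad Omega w x)) = supg_load w.
Proof.
move=> Pw; have [ww ew] := P1_grad Pw; have lf := L2_pwconst hOmega vtx fK.
have ltf := L2_tau_mul lf; have lbw := L2_bdot ww.1; have lpw := L2_bdot (@pgL2 w).
have i1 := L2_integrable mO lf (P1_L2 Pw); have i2 := L2_integrable mO ltf lbw.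
rewrite (RintegralD mO i1 i2); congr (_ + _).
rewrite -[LHS]/(ip Omega (fun x => tau x * f x) (bdot (grad Omega w))) ipC.
rewrite (ip_ae mO _ _ _ (bdot_ae ew)); [|by case: lbw|by case: lpw|by case: ltf].
rewrite ipC -(@integral_tau (fun K => fK K * bgrad w K) (fun x => f x * bdot (pw_grad w) x)).
  by apply: eq_Rintegral => x _; rewrite mulrA.
by move=> K x Kx; rewrite /bdot (pw_grad_in hmesh _ Kx) (pwconst_in hmesh _ Kx).
Qed.

Lemma supgE v : supg vtx m b Omega tau f v <->
  P1 v /\ forall w, P1 w -> supg_form v w = supg_load w.
Proof.
split=> -[Pv H]; split => // w Pw; first by rewrite -supg_lhs// -supg_rhs//; exact: H.
by rewrite supg_lhs// supg_rhs// H.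
Qed.

Lemma supg_formDl v v' w : P1 v -> P1 v' -> P1 w ->
  supg_form (fun x => v x + v' x) w = supg_form v w + supg_form v' w.
Proof.
move=> Pv Pv' Pw; rewrite /supg_form addrACA -big_split; congr (_ + _).
  rewrite /P1_form -bilDl//; last exact: P1_L2.
  congr bil; apply/funext => x; rewrite /pw_grad -big_split.
  by apply: eq_bigr => K _; rewrite (cell_gradD hmesh)// scalerDr.
by apply: eq_bigr => K _ /=; rewrite (cell_gradD hmesh)// dotpDr; ring.
Qed.

Lemma supg_formZl (k : R) v w : P1 v -> P1 w ->
  supg_form (fun x => k * v x) w = k * supg_form v w.
Proof.
move=> Pv Pw; rewrite /supg_form mulrDr mulr_sumr; congr (_ + _).
  rewrite /P1_form -bilZl//; last exact: P1_L2.
  congr bil; apply/funext => x; rewrite /pw_grad scaler_sumr.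
  by apply: eq_bigr => K _; rewrite (cell_gradZ hmesh)// !scalerA mulrC.
by apply: eq_bigr => K _ /=; rewrite (cell_gradZ hmesh)// dotpZr; ring.
Qed.

Lemma supg_form_combl c w : P1 w ->
  supg_form (nodal_comb c) w = \sum_i c i * supg_form (phi i) w.
Proof.
move=> Pw; have [_ E1] := bil_suml m b oO (index_enum 'I_N) c (fun i => @pgL2 (phi i)) (P1_L2 Pw) (@pgL2 w).
rewrite /supg_form /P1_form pw_grad_comb E1.
under [RHS]eq_bigr do rewrite mulrDr mulr_sumr.
rewrite big_split /= exchange_big; congr (_ + _); apply: eq_bigr => K _ /=.
by rewrite bgrad_comb mulr_suml mulr_sumr; apply: eq_bigr => i _; ring.
Qed.

Lemma supg_form_combr v c : P1 v ->
  supg_form v (nodal_comb c) = \sum_i c i * supg_form v (phi i).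
Proof.
move=> Pv; have [_ _ E1] := bil_sumr m b oO (index_enum 'I_N) c (@pgL2 v)
  (fun i => P1_L2 (Pphi i)) (fun i => @pgL2 (phi i)).
rewrite /supg_form /P1_form pw_grad_comb E1.
under [RHS]eq_bigr do rewrite mulrDr mulr_sumr.
rewrite big_split /= exchange_big; congr (_ + _); apply: eq_bigr => K _ /=.
by rewrite bgrad_comb mulr_sumr mulr_sumr; apply: eq_bigr => i _; ring.
Qed.

Lemma supg_load_comb c : supg_load (nodal_comb c) = \sum_i c i * supg_load (phi i).
Proof.
have lf := L2_pwconst hOmega vtx fK.
rewrite /supg_load; under [RHS]eq_bigr do rewrite mulrDr mulr_sumr.
rewrite big_split /= exchange_big; congr (_ + _).
  rewrite ipC ip_suml//; last by move=> i; apply: (L2Z mO); exact: P1_L2.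
  by apply: eq_bigr => i _; rewrite ipZl// ?(ipC _ (phi i))//; exact: P1_L2.
apply: eq_bigr => K _ /=.
by rewrite bgrad_comb mulr_sumr mulr_sumr; apply: eq_bigr => i _; ring.
Qed.

Lemma eq_supg_formr v w w' : P1 w -> P1 w' -> (forall x, closure Omega x -> w x = w' x) ->
  supg_form v w = supg_form v w' /\ supg_load w = supg_load w'.
Proof.
move=> Pw Pw' ww; rewrite /supg_form /supg_load /P1_form (eq_pw_grad Pw Pw' ww).
have wO x : Omega x -> w x = w' x by move=> Ox; apply: ww; exact: subset_closure.
split; congr (_ + _).
- exact: eq_bil.
- by apply: eq_bigr => K _; rewrite (eq_cell_grad K Pw Pw' ww).
- by apply: eq_Rintegral => x /set_mem /wO ->.
- by apply: eq_bigr => K _; rewrite (eq_cell_grad K Pw Pw' ww).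
Qed.

(** The stabilization term is nonnegative because the bubbles have nonnegative
    mass. *)
Lemma supg_coercive v : P1 v -> supg_form v v <= 0 ->
  forall x, closure Omega x -> v x = 0.
Proof.
move=> Pv le0; apply: (P1_ae0 hOmega Pv).
have [|v0 _] := bil_coercive (b := b) oO hm hd (Omega_bounded hOmega) (P1_test_limit Pv) => //.
apply: le_trans le0; rewrite lerDl sumr_ge0// => K _.
by rewrite mulr_ge0 -?expr2 ?sqr_ge0// (bubble_mass_ge0 hm hB).
Qed.

Lemma supg_unique v v' : P1 v -> P1 v' ->
  (forall w, P1 w -> supg_form v w = supg_load w) ->
  (forall w, P1 w -> supg_form v' w = supg_load w) ->
  forall x, closure Omega x -> v x = v' x.
Proof.
move=> Pv Pv' Sv Sv' x cx.
have Pn := P1Z (-1) Pv'; have Pd := P1D Pv Pn.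
have := supg_coercive Pd _ cx; rewrite mulN1r => H; apply/eqP; rewrite -subr_eq0.
apply/eqP/H; rewrite supg_formDl// supg_formZl// Sv// Sv'//.
by rewrite mulN1r subrr.
Qed.

(** A square linear system, injective by coercivity. *)
Lemma supg_exists : exists v, P1 v /\ forall w, P1 w -> supg_form v w = supg_load w.
Proof.
pose M := \matrix_(i < N, j < N) supg_form (phi i) (phi j).
have ME (r : 'rV[R]_N) j : (r *m M) ord0 j = supg_form (nodal_comb (r ord0)) (phi j).
  rewrite mxE supg_form_combl//; apply: eq_bigr => i _; by rewrite mxE.
have uM : M \in unitmx.
  rewrite -row_free_unit; apply: inj_row_free => r rM0.
  have r0 : forall x, closure Omega x -> nodal_comb (r ord0) x = 0.
    apply: supg_coercive; first exact: P1_comb.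
    rewrite supg_form_combr; last exact: P1_comb.
    by rewrite big1// => j _; rewrite -ME rM0 mxE mulr0.
  apply/rowP => j; rewrite [RHS]mxE.
  have Oz : Omega (z j).
    by have [] : internal_vertices vtx Omega (z j) by rewrite -zi; exists j.
  have := r0 (z j) (subset_closure Oz).
  rewrite /nodal_comb (bigD1 j)//= phiz eqxx mulr1 big1 ?addr0//.
  by move=> i /negPf ij; rewrite phiz ij mulr0.
pose r := (\row_j supg_load (phi j)) *m invmx M.
exists (nodal_comb (r ord0)); split; first exact: P1_comb.
move=> w Pw; have [-> ->] := eq_supg_formr (nodal_comb (r ord0)) Pw (P1_comb (w \o z)) (fun x cx => P1_eq_comb Pw cx).
rewrite supg_form_combr ?supg_load_comb; last exact: P1_comb.
by apply: eq_bigr => j _; rewrite -ME /r mulmxKV// mxE.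
Qed.

(** The corrector solves the bubble problem with right-hand side - b_alpha. *)
Lemma corrector_bubble chi K alpha : correctors vtx m b chi ->
  chi K alpha = (fun x => - b ord0 alpha * B K x) %[ae leb in Omega].
Proof.
move=> /(_ K alpha)[hc sc c0]; have [hBK sBK _] := hB K.
have bK := @elt_bounded R d Omega hOmega T vtx hmesh K.
have oK := @elt_open _ _ _ vtx K.
have H : chi K alpha = (fun x => - b ord0 alpha * B K x) %[ae leb in elt K].
  apply: (weak_sol_unique oK hm hd bK hBK sBK hc) => v hv.
  have tv := H10_test_limit oK hv; have [lv _ _] := tv.
  have xE (x : E) : elt K x -> x ord0 alpha = dotp (delta_mx ord0 alpha) x + 0.
    by rewrite dotp_delta addr0.
  rewrite sc// mulNr; congr (- _).
  rewrite (bilinE m b oK (L2_affine_on oK bK xE) lv (weak_grad_affine oK bK xE)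
    (test_limit_weak_grad oK tv)).
  rewrite (bil_cstl m b oK _ bK tv) ip_cst1; congr (_ * _).
  rewrite /dotp (bigD1 alpha)//= mxE !eqxx mulr1 big1 ?addr0// => j /negPf ja.
  by rewrite mxE ja andbF mulr0.
apply: filterS H => x H _; have [/H//|nKx] := pselect (elt K x).
by rewrite c0// (bubble_out hB nKx) mulr0.
Qed.

Lemma enriched_correctors chi v : correctors vtx m b chi ->
  enriched v (fun K => fK K - bgrad v K) =
  (fun x => v x + \sum_K \sum_(alpha < d) cell_grad v K ord0 alpha * chi K alpha x
     + \sum_K fK K * B K x) %[ae leb in Omega].
Proof.
move=> hc.
have H : \forall x \ae leb, forall Ka : T * 'I_d, Omega x ->
    chi Ka.1 Ka.2 x = - b ord0 Ka.2 * B Ka.1 x.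
  by apply: filter_forall => -[K a]; exact: corrector_bubble.
apply: filterS H => x H Ox; rewrite /enriched -addrA; congr (_ + _).
rewrite -big_split; apply: eq_bigr => K _ /=; rewrite mulrBl addrC; congr (_ + _).
rewrite /dotp -mulNr -sumrN mulr_suml; apply: eq_bigr => a _.
by rewrite (H (K, a))//=; ring.
Qed.

(** A bubble of mass zero vanishes almost everywhere. *)
Lemma enriched_bubble_ae v gam gam' :
  (forall K, mass K * gam K = mass K * gam' K) ->
  enriched v gam = enriched v gam' %[ae leb in Omega].
Proof.
move=> gg.
have H : \forall x \ae leb, forall K, Omega x -> gam K * B K x = gam' K * B K x.
  apply: filter_forall => K; have [s0|s0] := eqVneq (mass K) 0.
    apply: filterS (bubble_mass_eq0 hd hm hOmega hmesh hB s0) => x H Ox.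
    by rewrite H// !mulr0.
  by apply: aeW => x _; rewrite (mulfI s0 (gg K)).
by apply: filterS H => x H Ox; congr (_ + _); apply: eq_bigr => K _; exact: H.
Qed.

Lemma galerkin_of_supg v : P1 v -> (forall w, P1 w -> supg_form v w = supg_load w) ->
  galerkin m b Omega phiadv B f (enriched v (fun K => fK K - bgrad v K)).
Proof.
move=> Pv Sv; apply/(galerkin_supg Pv (VHB_enriched _ Pv)); first exact: aeW.
by split.
Qed.

Lemma galerkin_eq u v : galerkin m b Omega phiadv B f u ->
  P1 v -> (forall w, P1 w -> supg_form v w = supg_load w) ->
  u = enriched v (fun K => fK K - bgrad v K) %[ae leb in Omega].
Proof.
move=> Gu Pv Sv; have [v' [gam [Pv' uE]]] := VHB_repr Gu.1.
have /(galerkin_supg Pv' Gu.1 uE)[Sv' M] := Gu.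
have vv := supg_unique Pv' Pv Sv' Sv.
have := enriched_bubble_ae v' M; apply: filterS2 uE => x H1 H2 Ox.
rewrite H1// H2// /enriched vv; last exact: subset_closure.
by congr (_ + _); apply: eq_bigr => K _; rewrite (eq_cell_grad K Pv' Pv vv).
Qed.

End msfem.

Theorem mainTheorem3 (R : realType) (d : nat) (hd : (0 < d)%N)
  (m : R) (hm : 0 < m) (b : 'rV[R]_d)
  (Omega : set 'rV[R]_d) (hOmega : open_polytope Omega)
  (T : finType) (vtx : T -> 'I_d.+1 -> 'rV[R]_d)
  (hmesh : conforming_mesh vtx Omega)
  (N : nat) (phi : 'I_N -> 'rV[R]_d -> R) (hphi : nodal_basis vtx Omega phi)
  (phiadv : 'I_N -> 'rV[R]_d -> R)
  (hphiadv : adv_basis vtx m b Omega phi phiadv)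
  (B : T -> 'rV[R]_d -> R) (hB : bubbles vtx m b B)
  (chi : T -> 'I_d -> 'rV[R]_d -> R) (hchi : correctors vtx m b chi)
  (fK : T -> R) :
  let f := pwconst vtx fK in
  let tau := tauB vtx B in
  let leb := @lebesgue_rV R d in
  (exists uHB, galerkin m b Omega phiadv B f uHB /\
     forall w, galerkin m b Omega phiadv B f w ->
       w = uHB %[ae leb in Omega]) /\
  (exists uH, supg vtx m b Omega tau f uH /\
     forall w, supg vtx m b Omega tau f w ->
       forall x, closure Omega x -> w x = uH x) /\
  (forall uHB uH,
     galerkin m b Omega phiadv B f uHB -> supg vtx m b Omega tau f uH ->
     uHB = (fun x => uH x
              + \sum_K \sum_(alpha < d)
                  cell_grad vtx uH K ord0 alpha * chi K alpha x
              + \sum_K fK K * B K x)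
       %[ae leb in Omega]).

Proof.
move=> f tau leb; have [z [_ zi Pphi phiz]] := hphi.
have [v [Pv Sv]] := supg_exists hd hm hOmega hmesh zi Pphi phiz hphiadv hB fK.
have SE := supgE hd hm hOmega hmesh zi Pphi phiz hphiadv hB fK.
have GE u w := @galerkin_eq R d hd m hm b Omega hOmega T vtx hmesh N phi z zi Pphi phiz
  phiadv hphiadv B hB fK u w.
split; last split.
- exists (enriched B v (fun K => fK K - dotp b (cell_grad vtx v K))).
  split; first exact: (galerkin_of_supg hd hm hOmega hmesh zi Pphi phiz hphiadv hB Pv Sv).
  by move=> w Gw; exact: GE.
- exists v; split; first exact/SE.
  by move=> w /SE[Pw Sw]; exact: (supg_unique hd hm hOmega hmesh zi Pphi phiz hphiadv hB Pw Pv Sw Sv).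
move=> uHB uH Gu /SE[PuH SuH].
have := enriched_correctors hd hm hOmega hmesh hB fK uH hchi.
by apply: filterS2 (GE _ _ Gu PuH SuH) => x H1 H2 Ox; rewrite H1// H2.
Qed.
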